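(* Let $d_3\ge p_2>p_1\ge 3$ be integers such that $p_1$ and $p_2$ are prime numbers. Then $(p_1,p_2,d_3)\in \operatorname{mdeg}(\operatorname{Tame}(\mathbb{C}^3))$ if and only if $d_3\in p_1\mathbb{N}+p_2\mathbb{N}$, i.e. if and only if $d_3=k_1p_1+k_2p_2$ for some $k_1,k_2\in\mathbb{N}=\{0,1,2,\dots\}$.
   Context: For a polynomial mapping $F=(F_1,\dots,F_n):\mathbb{C}^n\to\mathbb{C}^n$, its multidegree is $\operatorname{mdeg}F=(\deg F_1,\dots,\deg F_n)$. A triangular automorphism of $\mathbb{C}^n$ is a map of the form $(x_1,\dots,x_n)\mapsto (x_1,\,x_2+f_2(x_1),\,\dots,\,x_n+f_n(x_1,\dots,x_{n-1}))$ with polynomials $f_i$. The group $\operatorname{Tame}(\mathbb{C}^n)$ of tame automorphisms is the group generated by the affine linear automorphisms and the triangular automorphisms of $\mathbb{C}^n$. $\operatorname{mdeg}(\operatorname{Tame}(\mathbb{C}^3))$ denotes the set of multidegrees of tame automorphisms of $\mathbb{C}^3$. *)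

(* Defs.v *)
(* Polynomials in C[x1,x2,x3] are encoded as nested univariate
   polynomials {poly {poly {poly C}}}: innermost variable x1, middle x2, outer x3. *)
From HB Require Import structures.
From mathcomp Require Import all_boot all_order all_algebra.
Set Implicit Arguments. Unset Strict Implicit. Unset Printing Implicit Defensive.
Import Order.TTheory GRing.Theory Num.Theory.
Local Open Scope ring_scope.

Section Defs.
Variable C : numClosedFieldType.

Definition mpoly := {poly {poly {poly C}}}.

Definition X1 : mpoly := 'X%:P%:P.
Definition X2 : mpoly := 'X%:P.
Definition X3 : mpoly := 'X.
Definition Xv (j : 'I_3) : mpoly := tnth [tuple X1; X2; X3] j.

Definition cst (c : C) : mpoly := c%:P%:P%:P.

(* total degree (the zero polynomial gets degree 0; irrelevant here) *)
Definition deg1 (p : {poly C}) : nat := (size p).-1.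
Definition deg2 (q : {poly {poly C}}) : nat := \max_(i < size q) (i + deg1 q`_i)%N.
Definition deg3 (f : mpoly) : nat := \max_(i < size f) (i + deg2 f`_i)%N.

Definition subst (f g1 g2 g3 : mpoly) : mpoly :=
  \sum_(i < size f) (\sum_(j < size f`_i)
     (\sum_(k < size f`_i`_j) cst f`_i`_j`_k * g1 ^+ k) * g2 ^+ j) * g3 ^+ i.

Record polymap := PMap { pm1 : mpoly; pm2 : mpoly; pm3 : mpoly }.

Definition polymap_id : polymap := PMap X1 X2 X3.

Definition pcomp (F G : polymap) : polymap :=
  PMap (subst (pm1 F) (pm1 G) (pm2 G) (pm3 G))
       (subst (pm2 F) (pm1 G) (pm2 G) (pm3 G))
       (subst (pm3 F) (pm1 G) (pm2 G) (pm3 G)).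

Definition affine_comp (A : 'M[C]_3) (b : 'cV[C]_3) (i : 'I_3) : mpoly :=
  \sum_(j < 3) cst (A i j) * Xv j + cst (b i 0).

Definition affine_aut (F : polymap) : Prop :=
  exists (A : 'M[C]_3) (b : 'cV[C]_3), A \in unitmx /\
    F = PMap (affine_comp A b (inord 0)) (affine_comp A b (inord 1))
             (affine_comp A b (inord 2)).

Definition triangular_aut (F : polymap) : Prop :=
  exists (f2 : {poly C}) (f3 : {poly {poly C}}),
    F = PMap X1 (X2 + f2%:P%:P) (X3 + f3%:P).

Inductive tame : polymap -> Prop :=
| tame_affine F : affine_aut F -> tame F
| tame_triangular F : triangular_aut F -> tame F
| tame_comp F G : tame F -> tame G -> tame (pcomp F G)
| tame_inv F G : tame F -> pcomp F G = polymap_id -> pcomp G F = polymap_id -> tame G.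

Definition mdeg (F : polymap) : nat * nat * nat :=
  (deg3 (pm1 F), deg3 (pm2 F), deg3 (pm3 F)).

End Defs.

(* Main.v *)
(* The combinations [k1 * p1 + k2 * p2] are realized by composing the shears
   [(x + z^p1, y + z^p2, z)] and [(x, y, z + x^k1 * y^k2)].

   Conversely, the degrees of a tame automorphism are controlled by reduction theory, in the spirit
   of Shestakov, Umirbaev and Kuroda. Every tame triple is reached from affine coordinates by affine
   changes, by adding to one component a polynomial in the two others so that its degree grows, and
   by one exceptional operation [reach_K], available only when [2 deg x = 3 deg y] for two
   components. The key point [reach_closed] is that the set of triples so reached is stable under all
   elementary changes; it is proved by induction on the sum of the degrees, a local maximum of this
   sum along a path of elementary changes being bypassed by commuting the two changes around it, or
   else by the exceptional operation. The quantitative input is a lower bound for the degree of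
   [phi(f, g)] when its leading terms cancel, in terms of the 2-form [df /\ dg].

   If the last operation producing the degrees [p1 < p2 < d3] is exceptional, then [p2] is even. If it
   is elementary, either there is no cancellation and one degree is a combination of the two others,
   or the lower bound gives [p1 * p2 < d3 + p1 + p2] and Sylvester's theorem applies. *)
From Pilot Require Import Defs.
From HB Require Import structures.
From mathcomp Require Import all_boot all_order all_algebra.
From mathcomp Require Import perm ring lra zify mpoly.
From Stdlib Require Import Classical_Prop Classical_Pred_Type.
Set Implicit Arguments. Unset Strict Implicit. Unset Printing Implicit Defensive.

(** Degrees are leading monomials in a total order, not total degrees. Two polynomials of equal
    degree then have proportional leading terms, so subtracting a scalar multiple of one lowers the
    other; linear changes can thus make degrees distinct, and degree 0 means constant. Total degrees
    depend monotonically on these degrees and are read off at the end.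

    The obstacle is that [reach] admits elementary steps only upwards, whereas a product of tame
    generators climbs and descends at will.

    The ratio 3 : 2 comes from arithmetic. If leading terms in two components of degrees [x] and [y]
    cancel and leave a degree [e], the common multiple [L] satisfies [L < e + x + y]. If moreover a
    monomial involving [e] fits below [x], [nonres_num] leaves only [e] itself, or [2 e] with
    [2 x = 3 y]. The first possibility is linear; the second, where the square of one component
    modifies another, is what [reach_K] records. *)

(** * Arithmetic of the degrees *)

Lemma sylvester p q n : coprime p q -> (0 < p)%N -> (0 < q)%N -> (p * q < n + p + q)%N ->
  exists a b, n = (a * p + b * q)%N.
Proof.
(* [c] is the multiple of [p] in [[0, p q)] congruent to [n] modulo [q]. If [c <= n], it gives the
   combination; if [c > n], then [c - n >= q] and [c <= p q - p] contradict the bound. *)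
move=> pq p0 q0 lt; set c := (chinese p q 0 n %% (p * q))%N.
have c1 : (c %% p = 0)%N by rewrite /c modn_dvdm ?dvdn_mulr // chinese_modl // mod0n.
have c2 : (c %% q = n %% q)%N by rewrite /c modn_dvdm ?dvdn_mull // chinese_modr.
have c3 : (c < p * q)%N by rewrite ltn_mod muln_gt0 p0.
have /dvdnP[a ca] : (p %| c)%N by rewrite /dvdn c1.
exists a; have [le|gt] := leqP c n.
  have /dvdnP[b e] : (q %| n - c)%N by rewrite -eqn_mod_dvd // c2.
  by exists b; rewrite -ca -e subnKC.
have /dvdnP[b e] : (q %| c - n)%N by rewrite -eqn_mod_dvd ?c2 // ltnW.
exfalso; have aq : (a < q)%N by rewrite -(ltn_pmul2r p0) -ca (mulnC q).
have b0 : (0 < b)%N by case: b e => // e; move: gt; rewrite -subn_gt0 e.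
have : (a * p + p <= q * p)%N by rewrite -mulSnr leq_mul2r aq orbT.
have : (q <= b * q)%N by rewrite leq_pmull.
by rewrite -ca (mulnC q p); move: e gt lt; clear; lia.
Qed.

(** One disjunct per outcome of [alg_dich] for the step that produced [n3]. In the last one [n1 * a]
    is the common multiple, and the inequality is strict because a nonzero 2-form has positive
    degree. *)
Definition elementary_degrees (n1 n2 n3 : nat) :=
  [\/ exists a b, n3 = (a * n1 + b * n2)%N, exists N, n1 = (n2 * N)%N \/ n2 = (n1 * N)%N |
      exists a b, [/\ coprime a b, (n1 * a = n2 * b)%N & (n1 * a < n1 + n2 + n3)%N]].

Lemma elementary_degrees_sym n1 n2 n3 : elementary_degrees n1 n2 n3 -> elementary_degrees n2 n1 n3.
Proof.
case=> [[a [b e]]|[N e]|[a [b [ab e lt]]]].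
- by constructor 1; exists b, a; rewrite addnC.
- by constructor 2; exists N; case: e; [right|left].
by constructor 3; exists b, a; rewrite coprime_sym -e (addnC n2).
Qed.

Lemma nonres_lcm n1 n2 a b : coprime n1 n2 -> coprime a b -> (n1 * a = n2 * b)%N -> (0 < a)%N ->
  (n1 * n2 <= n1 * a)%N.
Proof.
move=> c12 ab e a0; have : (n2 %| n1 * a)%N by rewrite e dvdn_mulr.
by rewrite Gauss_dvdr 1?coprime_sym // => /dvdn_leq -/(_ a0) le; rewrite leq_mul2l le orbT.
Qed.

Section Arith.
Variables p1 p2 d3 : nat.
Hypotheses (pr1 : prime p1) (pr2 : prime p2) (p13 : (3 <= p1)%N) (p12 : (p1 < p2)%N)
  (p23 : (p2 < d3)%N).
Let goal := exists k1 k2 : nat, d3 = (k1 * p1 + k2 * p2)%N.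

Lemma coprime_or_multiple p : prime p -> coprime p d3 \/ exists k, d3 = (k * p)%N.
Proof.
by move=> pr; rewrite prime_coprime //; case: (boolP (p %| d3)%N) => [/dvdnP|]; [right|left].
Qed.

Lemma elementary_arith n1 n2 n3 : elementary_degrees n1 n2 n3 ->
  [\/ [/\ n1 = p1, n2 = p2 & n3 = d3], [/\ n1 = p1, n2 = d3 & n3 = p2] |
      [/\ n1 = p2, n2 = d3 & n3 = p1]] -> goal.
Proof.
move=> H; have c12 : coprime p1 p2 by rewrite prime_coprime // dvdn_prime2 // ltn_eqF.
have n12 : ~~ (p1 %| p2)%N by rewrite -prime_coprime.
have a0 x y a b : (0 < y)%N -> (x * a = y * b)%N -> coprime a b -> (0 < a)%N.
  case: a => // y0; rewrite muln0 => /esym/eqP; rewrite muln_eq0 => /orP[/eqP e|/eqP ->//].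
  by rewrite e in y0.
(* If [p] were coprime to [d3], the common multiple would be at least [p * d3], hence at least
   [3 * d3], against the last inequality. *)
have lcm p a b : prime p -> (3 <= p)%N -> coprime a b -> (p * a = d3 * b)%N ->
    (p * a < d3 + d3 + d3)%N -> exists k, d3 = (k * p)%N.
  move=> pr p3 ab e lt; case: (coprime_or_multiple pr) => // cp.
  have := nonres_lcm cp ab e (a0 _ _ _ _ (ltn_trans (ltnW (ltnW p13)) (ltn_trans p12 p23)) e ab).
  by move: p3 lt; clear; nia.
case=> -[e1 e2 e3]; subst n1 n2 n3; case: H => [[a [b e]]|[N [e|e]]|[a [b [ab e lt]]]].
- by exists a, b.
- by case: N e => [|N] e; [move: e p13|move: e p12]; clear; nia.
- by rewrite e dvdn_mulr in n12.
- apply: (sylvester c12); [by lia|by lia|].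
  by apply: leq_ltn_trans (nonres_lcm c12 ab e (a0 _ _ _ _ _ e ab)) _; [lia|rewrite addnAC (addnC d3) in lt *; lia].
- case: b e => [|b] e; last by move: e p23; clear; nia.
  by move: n12; rewrite e mul0n addn0 dvdn_mull.
- by case: N e => [|N] e; [move: e p13|move: e p12 p23]; clear; nia.
- by exists N, 0%N; rewrite e mul0n addn0 mulnC.
- have [k ek] : exists k, d3 = (k * p1)%N by apply: lcm ab e _ => //; move: lt p12 p23; clear; lia.
  by exists k, 0%N; rewrite mul0n addn0.
- by exfalso; case: a e => [|a]; case: b => [|b] e; move: e p13 p12 p23; clear; nia.
- by case: N e => [|N] e; [move: e p13 p12|move: e p23]; clear; nia.
- by exists 0%N, N; rewrite e mul0n add0n mulnC.
have [k ek] : exists k, d3 = (k * p2)%N.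
  by apply: lcm ab e _ => //; [apply: leq_trans p13 (ltnW p12)|move: lt p12 p23; clear; lia].
by exists 0%N, k; rewrite mul0n add0n.
Qed.
End Arith.

Import Order.TTheory GRing.Theory Num.Theory.
Local Open Scope ring_scope.

(** * Ordered degrees *)

(* Ordered by the sign of the leading coefficient, this domain contains the monomials in degree
   lexicographic order; having degrees in a [realDomainType] makes [lra] available. *)
Definition lexdom : Type := {poly rat}.
HB.instance Definition _ := GRing.IntegralDomain.on lexdom.

Module LexOrder.
Section LexOrder.
Implicit Types p q : lexdom.
Definition nonneg p := 0 <= lead_coef p.
Definition le p q := nonneg (q - p).
Definition lt p q := (q != p) && le p q.
Definition norm p := if nonneg p then p else - p.

Lemma nonneg_def p : nonneg p = le 0 p.
Proof. by rewrite /le subr0. Qed.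
Lemma nonnegD p q : le 0 p -> le 0 q -> le 0 (p + q).
Proof.
rewrite -!nonneg_def /nonneg => hp hq.
have [->|p0] := eqVneq p 0; first by rewrite add0r.
have [->|q0] := eqVneq q 0; first by rewrite addr0.
have lp : 0 < lead_coef p by rewrite lt0r hp lead_coef_eq0 p0.
have lq : 0 < lead_coef q by rewrite lt0r hq lead_coef_eq0 q0.
have [h|h|h] := ltngtP (size p) (size q).
- by rewrite lead_coefDr.
- by rewrite lead_coefDl.
rewrite lead_coefE; have -> : size (p + q) = size p.
  apply/eqP; rewrite eqn_leq; apply/andP; split.
    by apply: leq_trans (size_polyD _ _) _; rewrite h maxnn.
  rewrite leqNgt; apply/negP => hs.
  have : (p + q)`_(size p).-1 = 0.
    by apply: nth_default; move: hs; case: (size p) => // n.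
  rewrite coefD -lead_coefE h -lead_coefE => /eqP; apply/negP.
  by rewrite gt_eqF // addr_gt0.
by rewrite coefD -lead_coefE h -lead_coefE addr_ge0 // ltW.
Qed.
Lemma nonnegM p q : le 0 p -> le 0 q -> le 0 (p * q).
Proof. by rewrite -!nonneg_def /nonneg lead_coefM => *; rewrite mulr_ge0. Qed.
Lemma nonneg_anti p : le 0 p -> le p 0 -> p = 0.
Proof.
rewrite -nonneg_def /le /nonneg sub0r lead_coefN oppr_ge0 => h1 h2.
by apply/eqP; rewrite -lead_coef_eq0 eq_le h1 h2.
Qed.
Lemma sub_nonneg p q : le 0 (q - p) = le p q.
Proof. by rewrite -nonneg_def. Qed.
Lemma nonneg_total p : le 0 p || le p 0.
Proof. by rewrite -nonneg_def /le /nonneg sub0r lead_coefN oppr_ge0 le_total. Qed.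
Lemma normN p : norm (- p) = norm p.
Proof.
rewrite /norm /nonneg lead_coefN oppr_ge0.
case: ltgtP => [h|h|h] //; rewrite ?opprK //.
suff -> : p = 0 by rewrite oppr0.
by apply/eqP; rewrite -lead_coef_eq0 -h.
Qed.
Lemma ge0_norm p : le 0 p -> norm p = p.
Proof. by rewrite -nonneg_def /norm => ->. Qed.
Lemma lt_def p q : lt p q = (q != p) && le p q. Proof. by []. Qed.
End LexOrder.
End LexOrder.

HB.instance Definition _ := Num.IntegralDomain_isLeReal.Build lexdom
  LexOrder.nonnegD LexOrder.nonnegM LexOrder.nonneg_anti LexOrder.sub_nonneg
  LexOrder.nonneg_total LexOrder.normN LexOrder.ge0_norm LexOrder.lt_def.

Definition lex3 (a b c : rat) : lexdom := a%:P * 'X^2 + b%:P * 'X + c%:P.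

Lemma lex3D a b c a' b' c' :
  lex3 (a + a') (b + b') (c + c') = lex3 a b c + lex3 a' b' c'.
Proof. by rewrite /lex3 !polyCD; ring. Qed.

Lemma lex3_gt0 a b c :
  [|| 0 < a, (a == 0) && (0 < b) | [&& a == 0, b == 0 & 0 < c]] -> 0 < lex3 a b c.
Proof.
suff h : [|| 0 < a, (a == 0) && (0 < b) | [&& a == 0, b == 0 & 0 < c]] ->
    0 < lead_coef (lex3 a b c : {poly rat}).
  move=> /h h1; rewrite lt0r; apply/andP; split.
    by apply/eqP => h0; move: h1; rewrite h0 lead_coef0 ltxx.
  by have -> : 0 <= lex3 a b c = LexOrder.le 0 (lex3 a b c) by [];
     rewrite -LexOrder.nonneg_def /LexOrder.nonneg ltW.
case/or3P => [a0|/andP[/eqP-> b0]|/and3P[/eqP-> /eqP-> c0]]; rewrite /lex3.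
- rewrite -addrA lead_coefDl.
    by rewrite lead_coefM lead_coefXn lead_coefC mulr1.
  rewrite size_Cmul ?gt_eqF // size_polyXn ltnS.
  apply: leq_trans (size_polyD _ _) _; rewrite geq_max size_polyC.
  apply/andP; split; last by case: (c != 0).
  apply: leq_trans (size_polyMleq _ _) _; rewrite size_polyX size_polyC.
  by case: (b != 0).
- rewrite polyC0 mul0r add0r lead_coefDl.
    by rewrite lead_coefM lead_coefX lead_coefC mulr1.
  by rewrite size_Cmul ?gt_eqF // size_polyX ltnS size_polyC; case: (c != 0).
- by rewrite !polyC0 !mul0r !add0r lead_coefC.
Qed.

(** The third exponent is determined by the total degree and the other two. *)
Definition lexemb (m : 'X_{1..3}) : lexdom :=
  lex3 (mdeg m)%:R (m ord0)%:R (m (lift ord0 ord0))%:R.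

Lemma lexembD m m' : lexemb (m + m')%MM = lexemb m + lexemb m'.
Proof. by rewrite /lexemb mdegD !mnmDE !natrD lex3D. Qed.

Lemma lexemb_lt0 m m' : (m < m')%O -> lexemb m < lexemb m'.
Proof.
move=> h; rewrite -subr_gt0.
have -> : lexemb m' - lexemb m = lex3 ((mdeg m')%:R - (mdeg m)%:R)
  ((m' ord0)%:R - (m ord0)%:R)
  ((m' (lift ord0 ord0))%:R - (m (lift ord0 ord0))%:R).
  by apply/eqP; rewrite subr_eq -lex3D !subrK.
apply: lex3_gt0; rewrite !subr_gt0 !subr_eq0 !ltr_nat !eqr_nat.
have [hd|hd] := leqP (mdeg m') (mdeg m); last by [].
have e : mdeg m = mdeg m' by apply/eqP; rewrite eqn_leq hd lemc_mdeg // ltW.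
case/(ltmcP e): h => -[[|[|[|//]]] hi] hj lt.
- have -> : (m ord0 < m' ord0)%N.
    by move: lt; rewrite (_ : Ordinal hi = ord0) //; apply: val_inj.
  by rewrite e eqxx orbT.
- have -> : m' ord0 = m ord0 by rewrite (hj ord0).
  have -> : (m (lift ord0 ord0) < m' (lift ord0 ord0))%N.
    by move: lt; rewrite (_ : Ordinal hi = lift ord0 ord0) //; apply: val_inj.
  by rewrite e !eqxx !orbT.
- exfalso; move: e; rewrite !mdegE !big_ord_recl !big_ord0.
  rewrite (hj ord0) // (hj (lift ord0 ord0)) //.
  move: lt; rewrite (_ : Ordinal hi = lift ord0 (lift ord0 ord0)); last exact: val_inj.
  move=> lt /addnI/addnI; rewrite !addn0 => e; by rewrite e ltnn in lt.
Qed.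

(* Sealed by [Qed]: otherwise failing unifications unfold [lexemb] down to polynomial arithmetic. *)
Lemma lex_embedding : {G : realDomainType & {e : 'X_{1..3} -> G |
  (forall m m', e (m + m')%MM = e m + e m') /\
  (forall m m', (m < m')%O -> e m < e m')}}.
Proof. by exists lexdom, lexemb; split; [apply: lexembD|apply: lexemb_lt0]. Qed.

Definition Gam : realDomainType := projT1 lex_embedding.
Definition emb : 'X_{1..3} -> Gam := sval (projT2 lex_embedding).

Lemma embD m m' : emb (m + m')%MM = emb m + emb m'.
Proof. exact: (proj1 (svalP (projT2 lex_embedding))). Qed.
Lemma emb_lt0 m m' : (m < m')%O -> emb m < emb m'.
Proof. exact: (proj2 (svalP (projT2 lex_embedding))). Qed.
Lemma emb0 : emb 0%MM = 0.
Proof. by apply: (addrI (emb 0%MM)); rewrite -embD addm0 addr0. Qed.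
Lemma embMn m n : emb (m *+ n)%MM = emb m *+ n.
Proof. by elim: n => [|n IH]; rewrite ?mulm0n ?emb0 // mulmS embD IH mulrS. Qed.

Lemma emb_lt m m' : (emb m < emb m') = (m < m')%O.
Proof.
apply/idP/idP => [|/emb_lt0//]; case: (ltgtP m m') => // [/emb_lt0 h|->].
  by rewrite ltNge ltW.
by rewrite ltxx.
Qed.
Lemma emb_le m m' : (emb m <= emb m') = (m <= m')%O.
Proof. by rewrite !leNgt emb_lt. Qed.
Lemma emb_inj : injective emb.
Proof. by move=> m m' e; apply/eqP; rewrite eq_le -!emb_le e lexx. Qed.
Lemma emb_ge0 m : 0 <= emb m.
Proof. by rewrite -emb0 emb_le le0m. Qed.
Lemma emb_gt0 m : (0 < emb m) = (m != 0%MM).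
Proof. by rewrite lt_neqAle emb_ge0 andbT eq_sym -emb0 (inj_eq emb_inj). Qed.
Lemma emb_mdeg m m' : emb m <= emb m' -> (mdeg m <= mdeg m')%N.
Proof. by rewrite emb_le => /lemc_mdeg. Qed.

(** [Gam] is not well ordered, but the monomials are; the induction runs on them. *)
Lemma emb_wf_ind (T : Type) (mu : T -> 'X_{1..3}) (Q : T -> Prop) :
  (forall x, (forall y, emb (mu y) < emb (mu x) -> Q y) -> Q x) -> forall x, Q x.
Proof.
move=> IH x; have [m hm] : exists m, mu x = m by exists (mu x).
elim/(well_founded_ind (@ltom_wf 3)): m x hm => m IHm x hm.
by apply: IH => y; rewrite emb_lt hm => /IHm; apply.
Qed.

(* Definitions through an opaque [sig] are sealed: failing unifications do not unfold them. *)

Section LogDerivation.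
Variables (C : numFieldType) (n : nat).
Implicit Types (f g : {mpoly C[n]}) (i : 'I_n).

Lemma ld_seal : {d : 'I_n -> {mpoly C[n]} -> {mpoly C[n]} |
  forall i f, d i f = 'X_i * f^`M(i)}.
Proof. by exists (fun i f => 'X_i * f^`M(i)). Qed.
Definition ld := sval ld_seal.
Lemma ldE i f : ld i f = 'X_i * f^`M(i). Proof. exact: (svalP ld_seal). Qed.

(** Monomials are eigenvectors, with the exponent of [i] as eigenvalue. Hence supports never grow,
    and polynomials in [ld i] can separate exponents, as in [cancel_deriv]. *)
Lemma ld_coeff i f m : (ld i f)@_m = (m i)%:R * f@_m.
Proof.
have [mi|mi] := posnP (m i).
  rewrite mi mul0r !ldE mulrC.
  have [->|] := eqVneq (f^`M(i) * 'X_i)@_m 0; first by [].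
  rewrite -mcoeff_msupp (perm_mem (msuppMX _ _)) => /mapP[k _ e].
  by move: mi; rewrite e mnmDE mnm1E eqxx.
have -> : m = (U_(i) + (m - U_(i)))%MM.
  by rewrite addmC submK // lep1mP -lt0n.
by rewrite !ldE mulrC mcoeffMX mcoeff_deriv addmC mulr_natl mnmDE mnm1E eqxx.
Qed.
Lemma ldD i f g : ld i (f + g) = ld i f + ld i g.
Proof. by rewrite !ldE mderivD mulrDr. Qed.
Lemma ldN i f : ld i (- f) = - ld i f.
Proof. by rewrite !ldE mderivN mulrN. Qed.
Lemma ldC i (c : C) : ld i c%:MP = 0.
Proof. by rewrite !ldE mderivC mulr0. Qed.
Lemma ldM i f g : ld i (f * g) = f * ld i g + g * ld i f.
Proof. by rewrite !ldE mderivM mulrDr; ring. Qed.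
Lemma ldZ i (c : C) f : ld i (c *: f) = c *: ld i f.
Proof. by rewrite !ldE mderivZ -scalerAr. Qed.
End LogDerivation.

(** * Degrees of polynomials and of 2-forms *)

Section Degree.
Variable C : numFieldType.
Local Notation P := {mpoly C[3]}.
Implicit Types f g h : P.

(** The zero polynomial gets degree 0, like the other constants; [0 < deg f] therefore says that [f]
    is not constant. *)
Lemma deg_seal : {d : P -> Gam | forall f, d f = emb (mlead f)}.
Proof. by exists (fun f => emb (mlead f)). Qed.
Definition deg := sval deg_seal.
Lemma degE f : deg f = emb (mlead f). Proof. exact: (svalP deg_seal). Qed.

Lemma deg_ge0 f : 0 <= deg f. Proof. by rewrite degE emb_ge0. Qed.
Lemma degC (c : C) : deg c%:MP = 0. Proof. by rewrite !degE mleadC emb0. Qed.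
Lemma deg0 : deg 0 = 0. Proof. exact: degC. Qed.
Lemma deg_gt0_neq0 f : 0 < deg f -> f != 0.
Proof. by apply: contraTneq => ->; rewrite deg0 ltxx. Qed.
Lemma degM f g : f != 0 -> g != 0 -> deg (f * g) = deg f + deg g.
Proof. by move=> f0 g0; rewrite !degE mleadM // embD. Qed.
Lemma degXn f n : f != 0 -> deg (f ^+ n) = deg f *+ n.
Proof. by move=> f0; rewrite !degE mleadX // embMn. Qed.
Lemma degZ (c : C) f : c != 0 -> deg (c *: f) = deg f.
Proof. by move=> c0; rewrite !degE mleadZ. Qed.
Lemma degZ_le (c : C) f : deg (c *: f) <= deg f.
Proof. by rewrite !degE emb_le mleadZ_le. Qed.
Lemma degN f : deg (- f) = deg f. Proof. by rewrite !degE mleadN. Qed.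
Lemma deg_coeff f m : f@_m != 0 -> emb m <= deg f.
Proof. by rewrite -mcoeff_msupp degE emb_le => /msupp_le_mlead. Qed.
Lemma deg_le_coeff a f : 0 <= a -> (forall m, f@_m != 0 -> emb m <= a) -> deg f <= a.
Proof.
move=> a0 h; have [->|f0] := eqVneq f 0; first by rewrite deg0.
by rewrite degE; apply: h; rewrite mleadc_eq0.
Qed.
Lemma degD_le a f g : deg f <= a -> deg g <= a -> deg (f + g) <= a.
Proof.
move=> hf hg; apply: deg_le_coeff => [|m]; first exact: le_trans (deg_ge0 f) hf.
rewrite mcoeffD; have [->|/deg_coeff h _] := eqVneq f@_m 0.
  by rewrite add0r => /deg_coeff h; apply: le_trans hg.
exact: le_trans hf.
Qed.
Lemma degB_le a f g : deg f <= a -> deg g <= a -> deg (f - g) <= a.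
Proof. by move=> hf hg; apply: degD_le; rewrite ?degN. Qed.
Lemma degD_lt f g : deg f < deg g -> deg (f + g) = deg g.
Proof. by move=> h; rewrite !degE mleadDr // -emb_lt -!degE. Qed.
Lemma degD_lt_l f g : deg g < deg f -> deg (f + g) = deg f.
Proof. by move=> h; rewrite addrC degD_lt. Qed.
Lemma degD_ltr a f g : deg f < a -> deg g < a -> deg (f + g) < a.
Proof.
move=> hf hg; case: (leP (deg f) (deg g)) => h.
  by apply: le_lt_trans hg; apply: degD_le.
by apply: le_lt_trans hf; apply: degD_le => //; apply: ltW.
Qed.
Lemma deg_sum_le a (I : Type) (r : seq I) (Q : pred I) (F : I -> P) :
  0 <= a -> (forall i, Q i -> deg (F i) <= a) -> deg (\sum_(i <- r | Q i) F i) <= a.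
Proof.
move=> a0 h; elim/big_rec: _ => [|i x Qi hx]; first by rewrite deg0.
by apply: degD_le => //; apply: h.
Qed.
Lemma degM_le f g : deg (f * g) <= deg f + deg g.
Proof.
have [->|f0] := eqVneq f 0; first by rewrite mul0r deg0 addr_ge0 ?deg_ge0.
have [->|g0] := eqVneq g 0; first by rewrite mulr0 deg0 addr_ge0 ?deg_ge0.
by rewrite degM.
Qed.
Lemma coeff_deg f m : deg f < emb m -> f@_m = 0.
Proof. by rewrite degE emb_lt; apply: mcoeff_gt_mlead. Qed.
Lemma deg_const f : deg f = 0 -> exists c, f = c%:MP.
Proof.
rewrite degE.
have [->|f0 d] := eqVneq f 0; first by exists 0.
exists f@_0%MM; apply: msize1_polyC; rewrite -mlead_deg //.
by rewrite ltnS leqn0 mdeg_eq0 -(inj_eq emb_inj) emb0; apply/eqP.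
Qed.

(** Equal degrees mean equal leading monomials, so the quotient of the leading coefficients cancels
    them. *)
Lemma deg_sub_lt f g : 0 < deg g -> deg f = deg g ->
  exists2 c : C, c != 0 & deg (f - c *: g) < deg g.
Proof.
move=> g0 e; have f0 : f != 0 by apply: deg_gt0_neq0; rewrite e.
have gn0 := deg_gt0_neq0 g0; have em : mlead f = mlead g by apply: emb_inj; rewrite -!degE.
have c0 : mleadc f / mleadc g != 0.
  by rewrite mulf_neq0 ?invr_eq0 ?mleadc_eq0.
exists (mleadc f / mleadc g) => //; rewrite lt_neqAle; apply/andP; split; last first.
  by apply: degB_le; rewrite ?e // degZ.
apply/eqP => d; have : mlead (f - mleadc f / mleadc g *: g) = mlead g by apply: emb_inj; rewrite -!degE.
move=> ml; have : mleadc (f - mleadc f / mleadc g *: g) != 0.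
  by rewrite mleadc_eq0; apply: deg_gt0_neq0; rewrite d.
rewrite ml mcoeffB mcoeffZ -{1}em divfK ?subrr ?eqxx //.
by rewrite mleadc_eq0.
Qed.

Lemma deg_ld i f : deg (ld i f) <= deg f.
Proof.
apply: deg_le_coeff => [|m]; first exact: deg_ge0.
by rewrite ld_coeff mulf_eq0 negb_or => /andP[_ /deg_coeff].
Qed.
Definition euler f := \sum_i ld i f.
(** [euler] multiplies each monomial by its total degree, and in characteristic 0 this does not kill
    a nonconstant leading term. *)
Lemma deg_euler f : 0 < deg f -> deg (euler f) = deg f.
Proof.
move=> f0; apply/eqP; rewrite eq_le; apply/andP; split.
  by apply: deg_sum_le => [|i _]; [apply: deg_ge0|apply: deg_ld].
rewrite (degE f); apply: deg_coeff; rewrite /euler raddf_sum /=.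
under eq_bigr do rewrite ld_coeff.
rewrite -mulr_suml -natr_sum -mdegE mulf_neq0 ?mleadc_eq0 ?deg_gt0_neq0 //.
by rewrite pnatr_eq0 mdeg_eq0 -emb_gt0 -degE.
Qed.

Local Notation F2 := 'rV[P]_3.
Lemma fdeg_seal : {d : F2 -> Gam |
  forall w, d w = Num.max (deg (w 0 0)) (Num.max (deg (w 0 1)) (deg (w 0 2)))}.
Proof. by eexists => w. Qed.
Definition fdeg := sval fdeg_seal.
Lemma fdegE w : fdeg w = Num.max (deg (w 0 0)) (Num.max (deg (w 0 1)) (deg (w 0 2))).
Proof. exact: (svalP fdeg_seal). Qed.

Lemma ord3 (k : 'I_3) : [\/ k = 0, k = 1 | k = 2].
Proof.
by case: k => -[|[|[|//]]] h; [apply: Or31|apply: Or32|apply: Or33]; apply: val_inj.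
Qed.
Lemma fdeg_le a (w : F2) : (forall k, deg (w 0 k) <= a) <-> fdeg w <= a.
Proof.
split=> [h|]; first by rewrite !fdegE !ge_max !h.
by rewrite !fdegE !ge_max => /andP[h0 /andP[h1 h2]] k; case: (ord3 k) => ->.
Qed.
Lemma deg_le_fdeg (w : F2) k : deg (w 0 k) <= fdeg w.
Proof. by move: k; apply/fdeg_le. Qed.
Lemma fdeg_ge0 w : 0 <= fdeg w.
Proof. by apply: le_trans (deg_le_fdeg w 0); apply: deg_ge0. Qed.
Lemma fdeg_attained (w : F2) : w != 0 -> exists2 k, w 0 k != 0 & fdeg w = deg (w 0 k).
Proof.
move=> w0; have [k hk] : exists k, fdeg w = deg (w 0 k).
  rewrite fdegE; case: (leP (deg (w 0 1))) => _; case: (leP (deg (w 0 0))) => _;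
  by [exists 0|exists 1|exists 2].
(* If the maximum is reached at a zero coordinate, it is 0, and any nonzero coordinate reaches it
   too. *)
have [e|] := eqVneq (w 0 k) 0; last by exists k.
have [j hj] : exists j, w 0 j != 0.
  apply/existsP; apply: contraNT w0 => /existsPn h; apply/eqP/rowP => j.
  by rewrite mxE; apply/eqP; rewrite -[_ == _]negbK; apply: h.
exists j => //; apply/eqP; rewrite eq_le deg_le_fdeg andbT hk e deg0; exact: deg_ge0.
Qed.
Lemma fdeg0 : fdeg 0 = 0. Proof. by rewrite !fdegE !mxE deg0 !maxxx. Qed.
Lemma fdegD_le a w w' : fdeg w <= a -> fdeg w' <= a -> fdeg (w + w') <= a.
Proof. by move=> /fdeg_le h /fdeg_le h'; apply/fdeg_le => k; rewrite mxE degD_le. Qed.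
Lemma fdegN w : fdeg (- w) = fdeg w.
Proof. by rewrite !fdegE !mxE !degN. Qed.
Lemma fdegD_lt w w' : fdeg w < fdeg w' -> fdeg (w + w') = fdeg w'.
Proof.
move=> h; apply/eqP; rewrite eq_le fdegD_le //; last exact: ltW.
have w0 : w' != 0.
  by apply: contraTneq h => ->; rewrite fdeg0 -leNgt fdeg_ge0.
have [k _ hk] := fdeg_attained w0; have := deg_le_fdeg (w + w') k.
rewrite mxE degD_lt ?hk // -hk.
by apply: le_lt_trans h; apply: deg_le_fdeg.
Qed.
Lemma formZ_eq0 h (w : F2) : (h *: w == 0) = (h == 0) || (w == 0).
Proof.
have [->|h0] /= := eqVneq h 0; first by rewrite scale0r eqxx.
apply/eqP/eqP => [e|->]; last exact: scaler0.
apply/rowP => k; have := congr1 (fun x : F2 => x 0 k) e; rewrite !mxE => /eqP.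
by rewrite mulf_eq0 (negPf h0) => /eqP.
Qed.
Lemma fdegZ h w : h != 0 -> w != 0 -> fdeg (h *: w) = deg h + fdeg w.
Proof.
move=> h0 w0; apply/eqP; rewrite eq_le; apply/andP; split.
  apply/fdeg_le => k; rewrite mxE; apply: le_trans (degM_le _ _) _.
  by rewrite lerD2l deg_le_fdeg.
have [k k0 ->] := fdeg_attained w0; rewrite -degM //.
by have := deg_le_fdeg (h *: w) k; rewrite mxE.
Qed.
Lemma fdegZC (c : C) w : c != 0 -> fdeg (c%:MP *: w) = fdeg w.
Proof.
move=> c0; have [->|w0] := eqVneq w 0; first by rewrite scaler0.
by rewrite fdegZ ?degC ?add0r // mpolyC_eq0.
Qed.
End Degree.

(** * Differential forms *)

Section Wedge.
Variable C : numFieldType.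
Local Notation P := {mpoly C[3]}.
Local Notation F2 := 'rV[P]_3.
Implicit Types f g h : P.

Lemma wedge_seal : {w : P -> P -> F2 | forall f g k,
  w f g 0 k = ld (k + 1) f * ld (k + 2) g - ld (k + 2) f * ld (k + 1) g}.
Proof.
exists (fun f g => \row_k (ld (k + 1) f * ld (k + 2) g - ld (k + 2) f * ld (k + 1) g)).
by move=> f g k; rewrite mxE.
Qed.
(* The coordinates of the 2-form [df /\ dg] in the logarithmic basis [dx_i / x_i], chosen
   because [deg (ld i f) <= deg f]. *)
Definition wedge := sval wedge_seal.
Lemma wedgeE f g k :
  wedge f g 0 k = ld (k + 1) f * ld (k + 2) g - ld (k + 2) f * ld (k + 1) g.
Proof. exact: (svalP wedge_seal). Qed.

Lemma wedgeDl f f' g : wedge (f + f') g = wedge f g + wedge f' g.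
Proof. by apply/rowP => k; rewrite !(mxE, wedgeE) !ldD; ring. Qed.
Lemma wedgeC f g : wedge f g = - wedge g f.
Proof. by apply/rowP => k; rewrite !(mxE, wedgeE); ring. Qed.
Lemma wedgeDr f g g' : wedge f (g + g') = wedge f g + wedge f g'.
Proof. by rewrite wedgeC wedgeDl opprD -!wedgeC. Qed.
Lemma wedgeff f : wedge f f = 0.
Proof. by apply/rowP => k; rewrite !(mxE, wedgeE); ring. Qed.
Lemma wedgeZl (c : C) f g : wedge (c *: f) g = c%:MP *: wedge f g.
Proof. by apply/rowP => k; rewrite !(mxE, wedgeE) !ldZ -!mul_mpolyC; ring. Qed.
Lemma wedgeZr (c : C) f g : wedge f (c *: g) = c%:MP *: wedge f g.
Proof. by rewrite wedgeC wedgeZl -scalerN -wedgeC. Qed.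
Lemma wedgeNl f g : wedge (- f) g = - wedge f g.
Proof. by apply/rowP => k; rewrite !(mxE, wedgeE) !ldN; ring. Qed.
Lemma wedgeNr f g : wedge f (- g) = - wedge f g.
Proof. by apply/rowP => k; rewrite !(mxE, wedgeE) !ldN; ring. Qed.
Lemma wedgeCl (c : C) g : wedge c%:MP g = 0.
Proof. by apply/rowP => k; rewrite !(mxE, wedgeE) !ldC; ring. Qed.
Lemma wedgeCr (c : C) g : wedge g c%:MP = 0.
Proof. by rewrite wedgeC wedgeCl oppr0. Qed.
Lemma wedgeM f g h : wedge (f * g) h = f *: wedge g h + g *: wedge f h.
Proof. by apply/rowP => k; rewrite !(mxE, wedgeE) !ldM; ring. Qed.
Lemma fdeg_wedge f g : fdeg (wedge f g) <= deg f + deg g.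
Proof.
apply/fdeg_le => k; rewrite wedgeE; apply: degB_le.
  by apply: le_trans (degM_le _ _) _; apply: lerD; apply: deg_ld.
by apply: le_trans (degM_le _ _) _; apply: lerD; apply: deg_ld.
Qed.
Lemma mcoeff0M f g : (f * g)@_0%MM = f@_0%MM * g@_0%MM.
Proof. exact: rmorphM. Qed.
Lemma ld_coeff0 i f : (ld i f)@_0%MM = 0.
Proof. by rewrite ld_coeff mnm0E mul0r. Qed.
(** Logarithmic derivatives have no constant term, hence neither have the coordinates of the form; a
    nonzero one is not constant. *)
Lemma fdeg_wedge_gt0 f g : wedge f g != 0 -> 0 < fdeg (wedge f g).
Proof.
move=> /fdeg_attained[k k0 ->]; rewrite degE emb_gt0; apply: contraNneq k0 => e.
by rewrite -mleadc_eq0 e wedgeE mcoeffB !(mcoeff0M (ld _ _)) !ld_coeff0 !mul0r subrr.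
Qed.

Lemma jac_seal : {j : P -> P -> P -> P |
  forall f g h, j f g h = \sum_k ld k f * wedge g h 0 k}.
Proof. by exists (fun f g h => \sum_k ld k f * wedge g h 0 k). Qed.
(* The Jacobian determinant times the product of the three variables. *)
Definition jac := sval jac_seal.
Lemma jac_def f g h : jac f g h = \sum_k ld k f * wedge g h 0 k.
Proof. exact: (svalP jac_seal). Qed.

Lemma jacE f g h : jac f g h =
  ld 0 f * (ld 1 g * ld 2 h - ld 2 g * ld 1 h) +
  ld 1 f * (ld 2 g * ld 0 h - ld 0 g * ld 2 h) +
  ld 2 f * (ld 0 g * ld 1 h - ld 1 g * ld 0 h).
Proof.
rewrite jac_def !big_ord_recl big_ord0 addr0 !wedgeE addrA.
have -> : lift ord0 ord0 = 1 :> 'I_3 by apply: val_inj.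
have -> : lift ord0 (lift ord0 ord0) = 2 :> 'I_3 by apply: val_inj.
have -> : ord0 = 0 :> 'I_3 by apply: val_inj.
have -> : 0 + 1 = 1 :> 'I_3 by apply: val_inj.
have -> : 0 + 2 = 2 :> 'I_3 by apply: val_inj.
have -> : 1 + 1 = 2 :> 'I_3 by apply: val_inj.
have -> : 1 + 2 = 0 :> 'I_3 by apply: val_inj.
have -> : 2 + 1 = 0 :> 'I_3 by apply: val_inj.
have -> : 2 + 2 = 1 :> 'I_3 by apply: val_inj.
by [].
Qed.
Lemma deg_jac f g h : deg (jac f g h) <= deg f + fdeg (wedge g h).
Proof.
rewrite jac_def; apply: deg_sum_le => [|k _]; first by rewrite addr_ge0 ?deg_ge0 ?fdeg_ge0.
by apply: le_trans (degM_le _ _) _; apply: lerD; [apply: deg_ld|apply: deg_le_fdeg].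
Qed.
Lemma jac_rot f g h : jac f g h = jac g h f.
Proof. by rewrite !jacE; ring. Qed.
Lemma jac_swap f g h : jac f g h = - jac g f h.
Proof. by rewrite !jacE; ring. Qed.
Lemma jacDl f f' g h : jac (f + f') g h = jac f g h + jac f' g h.
Proof. by rewrite !jacE !ldD; ring. Qed.
Lemma jacZl (c : C) f g h : jac (c *: f) g h = c *: jac f g h.
Proof. by rewrite !jacE !ldZ -!mul_mpolyC; ring. Qed.
Lemma jacCl (c : C) g h : jac c%:MP g h = 0.
Proof. by rewrite !jacE !ldC; ring. Qed.
Lemma jac_ff f h : jac f f h = 0.
Proof. by rewrite !jacE; ring. Qed.
Lemma jacMl p f g h : jac (p * f) g h = p * jac f g h + f * jac p g h.
Proof. by rewrite !jacE !ldM; ring. Qed.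
Lemma jac_neq0 f g h : jac f g h != 0 ->
  [/\ wedge f g != 0, wedge f h != 0, wedge g h != 0 & 0 < deg (jac f g h)].
Proof.
have jw a b c : wedge b c = 0 -> jac a b c = 0.
  by move=> e; rewrite jac_def big1 // => k _; rewrite e mxE mulr0.
move=> j0; split.
- by apply: contraNneq j0 => e; rewrite -jac_rot jw.
- by apply: contraNneq j0 => e; rewrite jac_swap jw ?oppr0.
- by apply: contraNneq j0 => e; rewrite jw.
rewrite degE emb_gt0; apply: contraNneq j0 => e.
by rewrite -mleadc_eq0 e jacE !mcoeffD !(mcoeff0M (ld _ _)) !ld_coeff0 !mul0r !addr0.
Qed.
Lemma jac_deg_gt0 f g h : jac f g h != 0 -> [/\ 0 < deg f, 0 < deg g & 0 < deg h].
Proof.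
have k a b c : jac a b c != 0 -> 0 < deg a.
  move=> j; rewrite lt_neqAle deg_ge0 andbT; apply: contraNneq j => /esym/deg_const[z ->].
  by rewrite jacCl.
by move=> j; split; [apply: k j|apply: (k g h f); rewrite -jac_rot|
  apply: (k h f g); rewrite jac_rot].
Qed.

Lemma wedge_gt0 f g : wedge f g != 0 -> 0 < deg f /\ 0 < deg g.
Proof.
move=> w0; split; rewrite lt_neqAle deg_ge0 andbT; apply: contraNneq w0 => /esym/deg_const[z ->].
  by rewrite wedgeCl.
by rewrite wedgeCr.
Qed.

(* [e.u1 (u2 x u3) + e.u2 (u3 x u1) + e.u3 (u1 x u2) = det(u1,u2,u3) e], with [e = (1,1,1)]. *)
Lemma euler_wedge f g h k :
  euler f * wedge g h 0 k + euler g * wedge h f 0 k + euler h * wedge f g 0 k = jac f g h.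
Proof.
rewrite jacE /euler !big_ord_recl !big_ord0 !addr0.
have -> : lift ord0 ord0 = 1 :> 'I_3 by apply: val_inj.
have -> : lift ord0 (lift ord0 ord0) = 2 :> 'I_3 by apply: val_inj.
have -> : ord0 = 0 :> 'I_3 by apply: val_inj.
case: (ord3 k) => ->; rewrite !(mxE, wedgeE).
- have -> : 0 + 1 = 1 :> 'I_3 by apply: val_inj.
  have -> : 0 + 2 = 2 :> 'I_3 by apply: val_inj.
  by ring.
- have -> : 1 + 1 = 2 :> 'I_3 by apply: val_inj.
  have -> : 1 + 2 = 0 :> 'I_3 by apply: val_inj.
  by ring.
- have -> : 2 + 1 = 0 :> 'I_3 by apply: val_inj.
  have -> : 2 + 2 = 1 :> 'I_3 by apply: val_inj.
  by ring.
Qed.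

(** By [euler_wedge], none of [deg f + fdeg (wedge g h)] and its two analogues exceeds the maximum
    of the other two. The Jacobian in that identity is bounded by each of the three, by
    [deg_jac]. *)
Lemma two_max a f g h : 0 < deg f -> wedge g h != 0 ->
  deg g + fdeg (wedge f h) <= a -> deg h + fdeg (wedge f g) <= a ->
  deg f + fdeg (wedge g h) <= a.
Proof.
move=> f0 w0 hg hh; have [k k0 ->] := fdeg_attained w0.
rewrite -(deg_euler f0) -degM //; last first.
  by apply: deg_gt0_neq0; rewrite deg_euler.
have eu u : deg (euler u) <= deg u.
  by apply: deg_sum_le => [|i _]; [apply: deg_ge0|apply: deg_ld].
have -> : euler f * wedge g h 0 k =
   jac f g h - euler g * wedge h f 0 k - euler h * wedge f g 0 k.
  by rewrite -(euler_wedge f g h k); ring.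
apply: degB_le; first apply: degB_le.
- by rewrite -jac_rot; apply: le_trans (deg_jac _ _ _) hh.
- apply: le_trans hg; apply: le_trans (degM_le _ _) _; apply: lerD => //.
  by rewrite (wedgeC f) fdegN deg_le_fdeg.
- apply: le_trans hh; apply: le_trans (degM_le _ _) _; apply: lerD => //.
  exact: deg_le_fdeg.
Qed.
End Wedge.

(* [lra] diverges when it tries to read a hypothesis about polynomials. *)
Ltac dlra := repeat match goal with
  | x := _ |- _ => clearbody x
  | H : ?T |- _ => lazymatch T with
      | is_true (@Order.le _ ?G _ _) => lazymatch G with context [Gam] => fail | _ => clear H end
      | is_true (@Order.lt _ ?G _ _) => lazymatch G with context [Gam] => fail | _ => clear H end
      | @eq ?G _ _ => lazymatch G with context [Gam] => fail | _ => clear H end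
      | _ => lazymatch type of T with Prop => clear H end end
  end;
  repeat match goal with
  | H : context [@deg ?F ?x] |- _ => let v := fresh "dg" in set (v := @deg F x) in *; clearbody v
  | |- context [@deg ?F ?x] => let v := fresh "dg" in set (v := @deg F x) in *; clearbody v
  | H : context [@fdeg ?F ?x] |- _ => let v := fresh "dg" in set (v := @fdeg F x) in *; clearbody v
  | |- context [@fdeg ?F ?x] => let v := fresh "dg" in set (v := @fdeg F x) in *; clearbody v
  end; lra.

Lemma seq_argmax (d : Order.disp_t) (O : orderType d) (T : eqType) (F : T -> O) (s : seq T) :
  s != [::] -> exists2 m, m \in s & forall m', m' \in s -> (F m' <= F m)%O.
Proof.
elim: s => // m s IH _; have [->|/IH[m1 m1s h]] := eqVneq s [::].
  by exists m => [|m']; rewrite ?mem_seq1 // => /eqP ->.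
case: (leP (F m) (F m1)) => c; [exists m1|exists m]; rewrite ?inE ?eqxx ?m1s ?orbT //.
  by move=> m'; rewrite inE => /predU1P[->|/h].
by move=> m'; rewrite inE => /predU1P[->|/h h1] //; apply: le_trans h1 (ltW c).
Qed.

(** * Evaluation of bivariate polynomials and cancellation of leading terms *)

Section Evaluation.
Variable C : numFieldType.
Local Notation P := {mpoly C[3]}.
Implicit Types (f g h : P) (p : {mpoly C[2]}) (fs : 2.-tuple P) (i j : 'I_2).

Lemma ldXn n (i : 'I_n) (f : {mpoly C[n]}) k : ld i (f ^+ k) = f ^+ k.-1 *+ k * ld i f.
Proof.
elim: k => [|k IH]; first by rewrite expr0 mulr0n mul0r -mpolyC1 ldC.
rewrite exprS ldM IH mulrS mulrDl /= addrC; congr (_ + _).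
case: k {IH} => [|k]; first by rewrite !mulr0n !mul0r mulr0.
by rewrite /= mulrA mulrnAr -exprS.
Qed.

(** The two variables are kept as an unordered pair of distinct indices [i] and [j], so that later
    results can be reused with the two polynomials exchanged. *)
Lemma big_ord2 (R : Type) (idx : R) (op : Monoid.com_law idx) (F : 'I_2 -> R) i j :
  i != j -> \big[op/idx]_(k < 2) F k = op (F i) (F j).
Proof.
move=> ij; rewrite (bigD1 i) //=; congr (op _ _).
rewrite (big_pred1 j) // => k; move: ij.
by case: i j k => -[|[|//]] ? [[|[|//]] ?] [[|[|//]] ?].
Qed.

Lemma comp_mono fs i j (m : 'X_{1..2}) : i != j ->
  'X_[m] \mPo fs = tnth fs i ^+ m i * tnth fs j ^+ m j.
Proof. by move=> ij; rewrite comp_mpolyX (big_ord2 _ _ ij). Qed.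

Lemma ld_comp (a : 'I_3) fs i j p : i != j ->
  ld a (p \mPo fs) = (p^`M(i) \mPo fs) * ld a (tnth fs i) +
                     (p^`M(j) \mPo fs) * ld a (tnth fs j).
Proof.
move=> ij; elim/mpolyind: p => [|c m p _ _ IH].
  by rewrite !mderiv0 !comp_mpoly0 -mpolyC0 ldC !mul0r addr0.
rewrite comp_mpolyD ldD IH !mderivD !comp_mpolyD !mderivZ !comp_mpolyZ ldZ.
have e k l : k != l -> (('X_[m] : {mpoly C[2]})^`M(k) \mPo fs) =
     (tnth fs k ^+ (m k).-1 *+ m k) * tnth fs l ^+ m l.
  move=> kl; rewrite mderivX comp_mpolyZ (comp_mono _ _ kl) !mnmBE !mnm1E.
  rewrite eqxx (negPf kl) subn0 subn1 -mul_mpolyC mulrA.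
  by rewrite mpolyC_nat mulr_natl.
rewrite (e _ _ ij) (e j i) 1?eq_sym // (comp_mono _ _ ij) ldM !ldXn -!mul_mpolyC.
by ring.
Qed.

Lemma wedge_comp fs i j p h : i != j ->
  wedge (p \mPo fs) h = (p^`M(i) \mPo fs) *: wedge (tnth fs i) h +
                     (p^`M(j) \mPo fs) *: wedge (tnth fs j) h.
Proof.
by move=> ij; apply/rowP => k; rewrite !(mxE, wedgeE) !(ld_comp _ _ _ ij); ring.
Qed.

Lemma jac_comp fs i j p g h : i != j ->
  jac (p \mPo fs) g h = (p^`M(i) \mPo fs) * jac (tnth fs i) g h +
                     (p^`M(j) \mPo fs) * jac (tnth fs j) g h.
Proof.
move=> ij; rewrite !jac_def !mulr_sumr -big_split /=; apply: eq_bigr => k _.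
by rewrite (ld_comp _ _ _ ij); ring.
Qed.

Lemma ord2 i j k : i != j -> k = i \/ k = j.
Proof.
by case: i j k => -[|[|//]] ? [[|[|//]] ?] [[|[|//]] ?] // _;
  [left|right|right|left]; apply: val_inj.
Qed.

Section Cancellation.
Variables (fs : 2.-tuple P) (i j : 'I_2).
Hypothesis ij : i != j.
Local Notation f := (tnth fs i).
Local Notation g := (tnth fs j).
Hypotheses (f0 : 0 < deg f) (g0 : 0 < deg g).

Definition vmon (m : 'X_{1..2}) := (mlead f *+ m i + mlead g *+ m j)%MM.
Definition vdeg (m : 'X_{1..2}) : Gam := deg f *+ m i + deg g *+ m j.

Lemma mnm2P (m m' : 'X_{1..2}) : m i = m' i -> m j = m' j -> m = m'.
Proof. by move=> hi hj; apply/mnmP => k; case: (ord2 k ij) => ->. Qed.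
Lemma vdegE m : vdeg m = emb (vmon m).
Proof. by rewrite /vmon embD !embMn -!degE. Qed.
Lemma vdeg_ge0 m : 0 <= vdeg m.
Proof. by rewrite vdegE emb_ge0. Qed.
Lemma comp_mono_neq0 m : 'X_[m] \mPo fs != 0.
Proof. by rewrite (comp_mono _ _ ij) mulf_neq0 // expf_neq0 // deg_gt0_neq0. Qed.
Lemma mlead_mono m : mlead ('X_[m] \mPo fs) = vmon m.
Proof.
have := comp_mono_neq0 m; rewrite (comp_mono _ _ ij) mulf_eq0 negb_or => /andP[h1 h2].
by rewrite mleadM // !mleadX // deg_gt0_neq0.
Qed.
Lemma deg_mono m : deg ('X_[m] \mPo fs) = vdeg m.
Proof. by rewrite degE mlead_mono vdegE. Qed.

Lemma deg_comp_le a p : 0 <= a -> (forall m, p@_m != 0 -> vdeg m <= a) ->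
  deg (p \mPo fs) <= a.
Proof.
move=> a0 h; rewrite comp_mpolyEX big_seq_cond; apply: deg_sum_le => // m.
rewrite andbT mcoeff_msupp => /h hm.
by apply: le_trans (degZ_le _ _) _; rewrite deg_mono.
Qed.

Definition slead m : C := mleadc ('X_[m] \mPo fs).
Lemma slead_neq0 m : slead m != 0.
Proof. by rewrite mleadc_eq0 comp_mono_neq0. Qed.

(** The coefficient of [V] in the value of [p] when no monomial of [s] goes above [V]. The list [s]
    is separate from [p] so that one list serves [p] and all its derivatives. *)
Definition tsum (s : seq 'X_{1..2}) V p : C :=
  \sum_(m <- s | vmon m == V) p@_m * slead m.

Lemma coeff_comp p V s : uniq s -> {subset msupp p <= s} ->
  (forall m, m \in s -> vdeg m <= emb V) -> (p \mPo fs)@_V = tsum s V p.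
Proof.
move=> us ps h; have -> : p \mPo fs = \sum_(m <- s) p@_m *: ('X_[m] \mPo fs).
  rewrite comp_mpolyEX [RHS](bigID (mem (msupp p))) /= [X in _ = _ + X]big1 ?addr0.
    rewrite -[in RHS]big_filter; apply: perm_big; apply: uniq_perm => //.
    - exact: filter_uniq.
    - by move=> m; rewrite mem_filter; case: (boolP (m \in msupp p)) => // /ps ->.
  by move=> m hm; rewrite memN_msupp_eq0 // scale0r.
rewrite raddf_sum /tsum [RHS]big_mkcond big_seq [RHS]big_seq; apply: eq_bigr => m ms.
rewrite /= mcoeffZ; case: eqP => [<-|/eqP ne]; first by rewrite /slead mlead_mono.
rewrite coeff_deg ?mulr0 // deg_mono lt_neqAle h // andbT vdegE (inj_eq emb_inj).
exact: ne.
Qed.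

Lemma exists_vmax p : p != 0 -> exists2 m, m \in msupp p &
  forall m', m' \in msupp p -> vdeg m' <= vdeg m.
Proof. by rewrite -msupp_eq0; apply: seq_argmax. Qed.

Definition nocancel p := forall m, m \in msupp p -> vdeg m <= deg (p \mPo fs).

Lemma nocancel_attained p : p != 0 -> nocancel p ->
  exists2 m, m \in msupp p & vdeg m = deg (p \mPo fs).
Proof.
move=> /exists_vmax[m ms h] nc; exists m => //; apply/eqP.
rewrite eq_le nc //; apply: deg_comp_le; first exact: vdeg_ge0.
by move=> m'; rewrite -mcoeff_msupp => /h.
Qed.

Lemma ld_support k p : {subset msupp (ld k p) <= msupp p}.
Proof.
by move=> m; rewrite !mcoeff_msupp ld_coeff mulf_eq0 negb_or => /andP[].
Qed.
Lemma iter_ld_support k n p : {subset msupp (iter n (ld k) p) <= msupp p}.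
Proof. by elim: n => //= n IH m /ld_support/IH. Qed.
Lemma iter_ld_coeff k n p m : (iter n (ld k) p)@_m = (m k)%:R ^+ n * p@_m.
Proof. by elim: n => [|n IH] /=; rewrite ?expr0 ?mul1r // ld_coeff IH exprS mulrA. Qed.

(** Wedging the value of [p] with [g] isolates the partial derivative in [i] as the factor of
    [wedge f g], while [ld i p] evaluates to [f] times that derivative. *)
Lemma deg_ld_comp p : wedge f g != 0 ->
  deg (ld i p \mPo fs) + fdeg (wedge f g) <= deg (p \mPo fs) + deg f + deg g.
Proof.
move=> w0; have -> : ld i p \mPo fs = f * (p^`M(i) \mPo fs).
  by rewrite ldE rmorphM /= comp_mpolyXU (tnth_nth 0).
have [->|q0] := eqVneq (p^`M(i) \mPo fs) 0.
  by rewrite mulr0 deg0; have := fdeg_wedge f g; have := deg_ge0 (p \mPo fs); dlra.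
rewrite (degM (deg_gt0_neq0 f0) q0).
have := fdeg_wedge (p \mPo fs) g.
rewrite (wedge_comp _ _ _ ij) wedgeff scaler0 addr0 fdegZ //; dlra.
Qed.

Lemma deg_iter_ld_comp n p : wedge f g != 0 ->
  deg (iter n (ld i) p \mPo fs) + fdeg (wedge f g) *+ n <=
  deg (p \mPo fs) + (deg f + deg g) *+ n.
Proof.
move=> w0; elim: n => [|n IH] /=; first by rewrite !mulr0n !addr0.
by have := deg_ld_comp (iter n (ld i) p) w0; rewrite !mulrS; dlra.
Qed.

(** If the sum at the largest [vmon m0] were nonzero, that monomial would survive in the value and
    nothing would be cancelled. *)
Lemma cancel_top p : p != 0 -> ~ nocancel p -> exists2 m0, m0 \in msupp p &
  (forall m, m \in msupp p -> vdeg m <= emb (vmon m0)) /\ tsum (msupp p) (vmon m0) p = 0.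
Proof.
move=> /exists_vmax[m0 m0s h] nc; exists m0 => //.
rewrite -vdegE; split => //; apply/eqP; apply: contra_notT nc => S0.
have le : forall m, m \in msupp p -> vdeg m <= emb (vmon m0) by rewrite -vdegE.
have : (p \mPo fs)@_(vmon m0) != 0 by rewrite (coeff_comp (msupp_uniq p) _ le).
by move=> /deg_coeff; rewrite -vdegE => h1 m /h hm; apply: le_trans h1.
Qed.

(** A sum with a single nonzero term does not vanish. *)
Lemma tsum0_two p m0 : m0 \in msupp p -> tsum (msupp p) (vmon m0) p = 0 ->
  exists m1, vmon m1 = vmon m0 /\ m1 != m0.
Proof.
move=> m0s; rewrite /tsum big_mkcond (bigD1_seq m0) ?msupp_uniq //= eqxx.
have [/hasP[m1 _ /andP[/eqP e ne]] _|] := boolP (has [pred m | (vmon m == vmon m0) && (m != m0)] (msupp p)).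
  by exists m1.
rewrite -all_predC => /allP h /eqP; rewrite big_seq_cond big1 ?addr0.
  by rewrite mulf_eq0 (negPf (slead_neq0 _)) orbF mcoeff_eq0 m0s.
move=> m /andP[/h /=]; rewrite negb_and negbK; case: eqP => //= _.
by move/eqP->; rewrite eqxx.
Qed.

(** The exponents of the two monomials differ upwards in one variable and downwards in the other;
    dividing these differences by their gcd gives the ratio of the degrees. *)
Lemma vmon_collinear m0 m1 : vmon m1 = vmon m0 -> m1 != m0 ->
  exists a b, [/\ coprime a b, (0 < a)%N, (0 < b)%N & deg f *+ a = deg g *+ b].
Proof.
wlog lt : m0 m1 / (m0 i <= m1 i)%N => [W e ne|].
  have /orP[] := leq_total (m0 i) (m1 i); first by move=> l; apply: (W m0 m1).
  by move=> l; apply: (W m1 m0) => //; rewrite eq_sym.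
move=> e ne; have ev : vdeg m1 = vdeg m0 by rewrite !vdegE e.
have lt2 : (m0 i < m1 i)%N.
  rewrite ltn_neqAle lt andbT; apply: contra ne => /eqP ei; apply/eqP.
  apply: mnm2P => //; move: ev; rewrite /vdeg ei => /addrI.
  by apply: mulrIn; rewrite gt_eqF.
have lt3 : (m1 j < m0 j)%N.
  rewrite ltnNge; apply/negP => l; move: ev; apply/eqP; rewrite gt_eqF //.
  rewrite /vdeg; apply: ltr_leD; first by rewrite ltr_pMn2l.
  by rewrite ler_pMn2l.
have e3 : deg f *+ (m1 i - m0 i) = deg g *+ (m0 j - m1 j).
  rewrite !mulrnBr // 1?ltnW //; move: ev; rewrite /vdeg => ev.
  by apply/eqP; rewrite subr_eq addrAC eq_sym subr_eq addrC -ev.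
set x := (m1 i - m0 i)%N in e3; set y := (m0 j - m1 j)%N in e3.
have x0 : (0 < x)%N by rewrite subn_gt0.
have y0 : (0 < y)%N by rewrite subn_gt0.
have d0 : (0 < gcdn x y)%N by rewrite gcdn_gt0 x0.
exists (x %/ gcdn x y)%N, (y %/ gcdn x y)%N; split.
- rewrite /coprime -(eqn_pmul2r d0) muln_gcdl !divnK ?dvdn_gcdl ?dvdn_gcdr //.
  by rewrite mul1n.
- by rewrite divn_gt0 // dvdn_leq // dvdn_gcdl.
- by rewrite divn_gt0 // dvdn_leq // dvdn_gcdr.
apply/eqP; rewrite -[_ == _]/(false || _) -(gtn_eqF d0) -eqrMn2r.
by rewrite -!mulrnA !divnK ?dvdn_gcdl ?dvdn_gcdr // e3.
Qed.

(** Monomials with the same leading term have exponents of [i] congruent modulo [a], since [a] is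
    coprime to [b] and [Gam] has no torsion. *)
Lemma vmon_dvd a b m m' : coprime a b -> (0 < a)%N -> deg f *+ a = deg g *+ b ->
  vmon m = vmon m' -> (m i <= m' i)%N -> (a %| m' i - m i)%N.
Proof.
move=> cab a0 e ev le; have ed : vdeg m = vdeg m' by rewrite !vdegE ev.
have le2 : (m' j <= m j)%N.
  rewrite leqNgt; apply/negP => l; move: ed; apply/eqP; rewrite lt_eqF //.
  rewrite /vdeg; apply: ler_ltD; first by rewrite ler_pMn2l.
  by rewrite ltr_pMn2l.
have e3 : deg f *+ (m' i - m i) = deg g *+ (m j - m' j).
  rewrite !mulrnBr // ; move: ed; rewrite /vdeg => ed.
  by apply/eqP; rewrite subr_eq addrAC eq_sym subr_eq addrC -ed addrC.
have e4 : ((m j - m' j) * a = b * (m' i - m i))%N.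
  apply: (@mulrIn _ (deg g)); first by rewrite gt_eqF.
  by rewrite !mulrnA -e -e3 -!mulrnA mulnC.
by rewrite -(Gauss_dvdr _ cab) -e4 dvdn_mull.
Qed.

(* Let [theta] be the derivation [ld i] and [S k] the coefficient of the top monomial [V] in
   [iter k theta p] at [(f, g)]. Cancellation means [S 0 = 0]; a polynomial combination of the
   powers of [theta], isolating the largest exponent of [i] in the top part, shows that some
   [S k] with [k <= I] is nonzero, and by the chain rule each application of [theta] raises the
   degree at [(f, g)] by at most [deg f + deg g - fdeg (wedge f g)]. *)
Lemma cancel_deriv a b p : p != 0 -> ~ nocancel p -> wedge f g != 0 ->
  coprime a b -> (0 < a)%N -> deg f *+ a = deg g *+ b ->
  deg f + deg g <= deg f *+ a -> deg f *+ a <= deg f + deg (p^`M(i) \mPo fs).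
Proof.
move=> p0 nc w0 cab a0 eL hL.
have [m0 m0s [le S0]] := cancel_top p0 nc.
set V := vmon m0 in le S0; set s := [seq m <- msupp p | vmon m == V].
have m0s' : m0 \in s by rewrite mem_filter eqxx.
have sn : s != [::] by apply: contraTneq m0s' => ->.
have [mA mAs hA] := seq_argmax (fun m : 'X_{1..2} => m i) sn.
set A := mA i in hA; pose I := (A %/ a)%N.
have mAV : vmon mA = V by move: mAs; rewrite mem_filter => /andP[/eqP].
have mAp : mA \in msupp p by move: mAs; rewrite mem_filter => /andP[].
pose S k := tsum (msupp p) V (iter k (ld i) p).
have SE k : S k = (iter k (ld i) p \mPo fs)@_V.
  by rewrite (coeff_comp (msupp_uniq p) _ le) //; apply: iter_ld_support.
(* The roots [A - a], [A - 2 a], ... are the exponents of [i] that the top part may contain besides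
   [A], by [vmon_dvd]. As [a * k.+1 <= A] for [k < I], no subtraction is truncated. *)
pose W : {poly C} := \prod_(k < I) ('X - (A - a * k.+1)%:R%:P).
have WS : \sum_(m <- s) W.[(m i)%:R] * (p@_m * slead m) =
          \sum_(k < size W) W`_k * S k.
  under eq_bigr do rewrite horner_coef mulr_suml.
  rewrite exchange_big; apply: eq_bigr => k _.
  have -> : S k = \sum_(m <- s) (iter k (ld i) p)@_m * slead m by rewrite big_filter.
  by rewrite mulr_sumr; apply: eq_bigr => m _; rewrite iter_ld_coeff !mulrA.
have WA : \sum_(m <- s) W.[(m i)%:R] * (p@_m * slead m) != 0.
  rewrite (bigD1_seq mA) ?filter_uniq ?msupp_uniq //= big_seq_cond big1 ?addr0.
    rewrite !mulf_neq0 ?slead_neq0 -?mcoeff_msupp // horner_prod.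
    apply/prodf_neq0 => k _; rewrite !hornerE subr_eq0 eqr_nat.
    have : (a * k.+1 <= A)%N.
      by apply: leq_trans (leq_trunc_div A a); rewrite mulnC leq_mul2r ltn_ord orbT.
    move=> le'; rewrite -/A gtn_eqF // ltn_subrL muln_gt0 a0 /=.
    by apply: leq_trans le'; rewrite muln_gt0 a0.
  move=> m /andP[ms ne]; have := hA _ ms; rewrite leEnat => lA.
  have mV : vmon m = vmon mA by move: ms; rewrite mem_filter mAV => /andP[/eqP].
  have /dvdnP[k ek] := vmon_dvd cab a0 eL mV lA.
  have k0 : (0 < k)%N.
    rewrite lt0n; apply: contra ne => /eqP k0; apply/eqP.
    have e1 : m i = mA i.
      by apply/eqP; rewrite eqn_leq lA -subn_eq0 ek k0.
    apply: mnm2P => //; have : vdeg m = vdeg mA by rewrite !vdegE mV.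
    by rewrite /vdeg e1 => /addrI; apply: mulrIn; rewrite gt_eqF.
  have kI : (k.-1 < I)%N.
    by rewrite prednK // /I leq_divRL // -ek leq_subr.
  rewrite [W.[_]]horner_prod (bigD1 (Ordinal kI)) //= prednK // hornerXsubC.
  have -> : m i = (A - a * k)%N by rewrite mulnC -ek subKn.
  by rewrite subrr !mul0r.
have sW : size W = I.+1 by rewrite size_prod_XsubC -sum1_size sum1_card card_ord.
have [k [kI Sk]] : exists k, (k <= I)%N /\ S k != 0.
  have [/existsP[k hk]|/existsPn h] := boolP [exists k : 'I_(size W), S k != 0].
    by exists k; split => //; have := ltn_ord k; rewrite {2}sW.
  move: WA; rewrite WS big1 ?eqxx // => k _.
  by have := h k; rewrite negbK => /eqP ->; rewrite mulr0.
have [n Sn nmin] := ex_minnP (ex_intro (fun k => S k != 0) k Sk).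
have nI : (n <= I)%N by apply: leq_trans (nmin _ Sk) kI.
have n0 : (0 < n)%N.
  by rewrite lt0n; apply: contraNneq Sn => ->; rewrite /S /= S0.
have hV : (deg f *+ a) *+ n <= emb V.
  apply: (@le_trans _ _ (deg f *+ A)).
    rewrite -mulrnA ler_pMn2l //.
    by apply: leq_trans (leq_trunc_div A a); rewrite mulnC leq_mul2r nI orbT.
  by rewrite -mAV -vdegE /vdeg lerDl mulrn_wge0 ?ltW.
have h1 : emb V <= deg (iter n (ld i) p \mPo fs) by apply: deg_coeff; rewrite -SE.
(* The first derivation is kept as [ld i p]; each of the other [n - 1] raises the degree by at most
   [deg f *+ a], while the top degree is at least [n] times that. *)
have h2 := deg_iter_ld_comp n.-1 (ld i p) w0.
rewrite -iterSr prednK // in h2.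
have D0 := fdeg_ge0 (wedge f g).
have e5 : ld i p \mPo fs = f * (p^`M(i) \mPo fs).
  by rewrite ldE rmorphM /= comp_mpolyXU (tnth_nth 0).
have h3 : deg f *+ a <= deg (ld i p \mPo fs).
  have h4 : (deg f + deg g - fdeg (wedge f g)) *+ n.-1 <= (deg f *+ a) *+ n.-1.
    by rewrite lerMn2r; apply/orP; right; dlra.
  have h5 : (deg f *+ a) *+ n = deg f *+ a + (deg f *+ a) *+ n.-1.
    by rewrite -mulrS prednK.
  rewrite mulrnBl in h4; dlra.
by apply: le_trans h3 _; rewrite e5 degM_le.
Qed.
End Cancellation.
End Evaluation.

(** * Commensurable degrees *)

Section Resonance.
Implicit Types x y e L : Gam.

(* [x] and [y] are commensurable, neither is a multiple of the other, and [L] is their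
   least common multiple. *)
Definition nonres x y L := exists a b,
  [/\ coprime a b, (1 < a)%N, (1 < b)%N, x *+ a = L & y *+ b = L].

Definition resonant x y := exists N, x = y *+ N \/ y = x *+ N.

Lemma nonres_sym x y L : nonres x y L -> nonres y x L.
Proof. by move=> [a [b [ab a1 b1 xa yb]]]; exists b, a; rewrite coprime_sym. Qed.

Lemma nonres_gt0 x y L : 0 < x -> nonres x y L -> 0 < L.
Proof.
by move=> x0 [a [b [_ a1 _ <- _]]]; rewrite pmulrn_lgt0 // (ltn_trans _ a1).
Qed.

Lemma nonres_ratio x y L a b : 0 < x -> nonres x y L -> coprime a b ->
  x *+ a = y *+ b -> L = x *+ a.
Proof.
move=> x0 [p [q [pq p1 q1 xp yq]]] ab e.
have e2 : (p * b = a * q)%N.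
  apply: (@mulrIn _ x); first by rewrite gt_eqF.
  by rewrite mulrnA xp -yq -mulrnA mulnC mulrnA -e -mulrnA.
have h1 : (p %| a)%N by rewrite -(Gauss_dvdl _ pq) -e2 dvdn_mulr.
have h2 : (a %| p)%N by rewrite -(Gauss_dvdl _ ab) e2 dvdn_mulr.
by rewrite -xp; congr (_ *+ _); apply/eqP; rewrite eqn_dvd h1 h2.
Qed.

(** Divided by [L], the last bound reads [1/a + 1/b < 1]; for [a, b > 1] it fails only at [(2, 2)],
    which is not coprime. *)
Lemma nonres_bounds x y L : 0 < x -> 0 < y -> nonres x y L ->
  [/\ x *+ 2 <= L, y *+ 2 <= L & x + y < L].
Proof.
move=> x0 y0 [a [b [ab a1 b1 xa yb]]]; split.
- by rewrite -xa ler_pMn2l.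
- by rewrite -yb ler_pMn2l.
have L0 : 0 < L by apply: (@nonres_gt0 x y) => //; exists a, b.
have ab0 : (0 < a * b)%N by rewrite muln_gt0 (ltnW a1) (ltnW b1).
rewrite -(ltr_pMn2r ab0) mulrnDl {1}mulrnA xa mulnC mulrnA yb -mulrnDr ltr_pMn2l //.
have : ~~ ((a == 2) && (b == 2)) by apply: contraL ab => /andP[/eqP-> /eqP->].
by move: a1 b1; clear; nia.
Qed.

(** With [x = L / p] and [y = L / q], eliminating [e] gives [p q a + b p < q + (p + q) a]. This
    forces [p < 4]; then [p = 3] gives [q = 2] and [a = 1], while [p = 2] allows [a > 1] only for
    [q = 3] and [a = 2]. Hence the ratio 3 : 2. *)
Lemma nonres_num x y L e a b : 0 < x -> 0 < y -> nonres x y L -> L < e + x + y ->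
  (0 < a)%N -> e *+ a + y *+ b <= x ->
  b = 0%N /\ (a = 1%N \/ a = 2%N /\ x *+ 2 = y *+ 3).
Proof.
move=> x0 y0 [p [q [pq p1 q1 xp yq]]] hL a0 hx.
have L0 : 0 < L by apply: (@nonres_gt0 x y) => //; exists p, q.
have pq0 : (0 < p * q)%N by rewrite muln_gt0 (ltnW p1) (ltnW q1).
have h1 : L *+ (p * q * a) < e *+ (p * q * a) + L *+ ((p + q) * a).
  rewrite !(mulrnA _ _ a) -mulrnDl ltr_pMn2r //.
  move: hL; rewrite -(ltr_pMn2r pq0 L) !mulrnDl (mulrnA x p) xp (mulnC p q) (mulrnA y q) yq.
  by rewrite mulrnDr; dlra.
have h2 : e *+ (p * q * a) + L *+ (b * p) <= L *+ q.
  move: hx; rewrite -(ler_pMn2r pq0 _ x) mulrnDl (mulrnA x p) xp -mulrnA (mulnC a).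
  by rewrite -mulrnA (_ : b * (p * q) = q * (b * p))%N ?(mulrnA y) ?yq; last by clear; lia.
have h3 : (p * q * a + b * p < q + (p + q) * a)%N.
  by rewrite -(ltr_pMn2l L0) !mulrnDr; dlra.
have np : ~~ ((p == 2) && (q == 2)) by apply: contraL pq => /andP[/eqP-> /eqP->].
have p4 : (p < 4)%N by rewrite ltnNge; apply/negP; move: h3 q1 a0; clear; nia.
have : p = 2%N \/ p = 3%N by move: p1 p4; clear; lia.
case=> ep; subst p.
  have q2 : (2 < q)%N by move: np q1; clear; lia.
  have b0 : b = 0%N by move: h3 q2 a0; clear; nia.
  split=> //; subst b; case: (a =P 1%N) => [|a1]; [by left|right].
  have a2 : (1 < a)%N by move: a0 a1; clear; lia.
  have q3 : q = 3%N by move: h3 q2 a2; clear; nia.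
  by subst q; split; [move: h3 a2; clear; lia|rewrite xp yq].
have q2 : q = 2%N by move: h3 q1 a0; clear; nia.
by subst q; split; [|left]; move: h3 a0; clear; lia.
Qed.
End Resonance.

(** * Subalgebras with two generators *)

Section Algebra.
Variable C : numFieldType.
Local Notation P := {mpoly C[3]}.
Implicit Types (f g h u v w : P).

Definition ev f g (p : {mpoly C[2]}) : P := p \mPo [tuple f; g].

Definition alg f g v := exists p, v = ev f g p.

Lemma algC f g (c : C) : alg f g c%:MP.
Proof. by exists c%:MP; rewrite /ev comp_mpolyC. Qed.
Lemma alg0 f g : alg f g 0. Proof. exact: algC. Qed.
Lemma algl f g : alg f g f.
Proof. by exists 'X_ord0; rewrite /ev comp_mpolyXU. Qed.
Lemma algr f g : alg f g g.
Proof. by exists 'X_ord_max; rewrite /ev comp_mpolyXU. Qed.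
Lemma algD f g u v : alg f g u -> alg f g v -> alg f g (u + v).
Proof. by move=> [p ->] [q ->]; exists (p + q); rewrite /ev rmorphD. Qed.
Lemma algM f g u v : alg f g u -> alg f g v -> alg f g (u * v).
Proof. by move=> [p ->] [q ->]; exists (p * q); rewrite /ev rmorphM. Qed.
Lemma algN f g u : alg f g u -> alg f g (- u).
Proof. by move=> [p ->]; exists (- p); rewrite /ev rmorphN. Qed.
Lemma algB f g u v : alg f g u -> alg f g v -> alg f g (u - v).
Proof. by move=> hu hv; apply: algD => //; apply: algN. Qed.
Lemma algZ f g (c : C) u : alg f g u -> alg f g (c *: u).
Proof. by move=> [p ->]; exists (c *: p); rewrite /ev linearZ. Qed.
Lemma algX f g u n : alg f g u -> alg f g (u ^+ n).
Proof. by move=> [p ->]; exists (p ^+ n); rewrite /ev rmorphXn. Qed.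
Lemma alg_sub f g f' g' v : alg f' g' f -> alg f' g' g -> alg f g v -> alg f' g' v.
Proof.
move=> hf hg [p ->]; elim/mpolyind: p => [|c m p _ _ IH].
  by rewrite /ev comp_mpoly0; apply: alg0.
rewrite /ev comp_mpolyD comp_mpolyZ; apply: algD => //; apply: algZ.
by rewrite (comp_mono _ _ (isT : ord0 != ord_max :> 'I_2)); apply: algM; apply: algX.
Qed.
Lemma alg_sym f g v : alg f g v -> alg g f v.
Proof. by apply: alg_sub; [apply: algr|apply: algl]. Qed.

(* No cancellation: [v] is a combination of monomials in [f] and [g] of degree at most [deg v],
   and one of them has that degree. *)
Definition nc f g v :=
  (forall Q : P -> Prop, Q 0 -> (forall u w, Q u -> Q w -> Q (u + w)) ->
    (forall (c : C) a b, deg f *+ a + deg g *+ b <= deg v -> Q (c *: (f ^+ a * g ^+ b))) ->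
    Q v) /\
  (0 < deg v -> exists a b, deg f *+ a + deg g *+ b = deg v).

Lemma nc_sym f g v : nc f g v -> nc g f v.
Proof.
move=> [h1 h2]; split=> [Q Q0 QD h|/h2[a [b e]]].
  apply: h1 => // c a b hab; rewrite mulrC; apply: h; by rewrite addrC.
by exists b, a; rewrite addrC.
Qed.

(* The top terms cancel in the expression of [v] as a polynomial in [f] and [g]; [u] and [w] are
   its partial derivatives, whose degrees satisfy the inequality of Shestakov and Umirbaev. *)
Definition cancels L f g v := exists u w,
  [/\ nonres (deg f) (deg g) L, L <= deg f + deg u, L <= deg g + deg w,
   (forall h, wedge v h = u *: wedge f h + w *: wedge g h) &
   (forall h1 h2, jac v h1 h2 = u * jac f h1 h2 + w * jac g h1 h2)].

(** If a monomial of [p] exceeds the degree of the value, the top sum vanishes and two monomials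
    share a leading term. The degrees are then in a reduced ratio [b : a]: resonant if one of them
    is 1, and otherwise [cancel_deriv] applies to both partial derivatives. *)
Lemma alg_dich f g v : alg f g v -> 0 < deg f -> 0 < deg g -> wedge f g != 0 ->
  [\/ nc f g v, resonant (deg f) (deg g) | exists L, cancels L f g v].
Proof.
move=> [p ->] f0 g0 w0; rewrite /ev; set fs := [tuple f; g].
have n01 : ord0 != ord_max :> 'I_2 by [].
have n10 : ord_max != ord0 :> 'I_2 by [].
have f0' : 0 < deg (tnth fs ord0) := f0.
have g0' : 0 < deg (tnth fs ord_max) := g0.
have [-> |p0] := eqVneq p 0.
  by constructor 1; rewrite comp_mpoly0; split=> [Q //|]; rewrite deg0 ltxx.
have [/allP h|hn] := boolP (all (fun m => vdeg fs ord0 ord_max m <= deg (p \mPo fs)) (msupp p)).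
  constructor 1; split=> [Q Q0 QD hQ|_].
    rewrite comp_mpolyEX big_seq_cond.
    elim/big_rec: _ => // m u; rewrite andbT => ms Qu; apply: QD => //.
    by rewrite (comp_mono _ _ n01); apply: hQ; apply: h.
  have [m _ e] := nocancel_attained n01 f0' g0' p0 h.
  by exists (m ord0), (m ord_max).
have nc0 : ~ nocancel fs ord0 ord_max p.
  by move=> h; case/negP: hn; apply/allP.
have [m0 m0s [le S0]] := cancel_top n01 f0' g0' p0 nc0.
have [m1 [ev ne]] := tsum0_two n01 f0' g0' m0s S0.
have [a [b [cab a0 b0 eL]]] := vmon_collinear n01 f0' g0' ev ne.
rewrite /= in eL; have [a1|a1] := leqP a 1.
  have e1 : a = 1%N by apply/eqP; rewrite eqn_leq a1 a0.
  by constructor 2; exists b; left; rewrite -eL e1.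
have [b1|b1] := leqP b 1.
  have e1 : b = 1%N by apply/eqP; rewrite eqn_leq b1 b0.
  by constructor 2; exists a; right; rewrite eL e1.
constructor 3; exists (deg f *+ a), (p^`M(ord0) \mPo fs), (p^`M(ord_max) \mPo fs).
have nr : nonres (deg f) (deg g) (deg f *+ a) by exists a, b.
have [_ _ lt] := nonres_bounds f0 g0 nr.
split=> //.
- by apply: (cancel_deriv n01 f0' g0' p0 nc0 w0 cab a0 eL (ltW lt)).
- rewrite eL; apply: (cancel_deriv (i := ord_max) (j := ord0) n10 g0' f0' p0 _ _ (b := a)) => //.
  + move=> h; apply: nc0 => m /h; by rewrite /vdeg addrC.
  + by rewrite wedgeC oppr_eq0.
  + by rewrite coprime_sym.
  + by rewrite addrC -eL ltW.
- by move=> h; rewrite (wedge_comp _ _ _ n01).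
- by move=> h1 h2; rewrite (jac_comp _ _ _ _ n01).
Qed.

Lemma cancels_sym L f g v : cancels L f g v -> cancels L g f v.
Proof.
move=> [u [w [h1 h2 h3 h4 h5]]]; exists w, u.
split; [exact: nonres_sym|exact: h3|exact: h2|move=> h|move=> a b].
  by rewrite addrC h4.
by rewrite addrC h5.
Qed.
(** The inequality of Shestakov and Umirbaev: [wedge v g] equals [u *: wedge f g], and [deg u] is at
    least [L - deg f]. *)
Lemma cancels_deg L f g v : wedge f g != 0 -> cancels L f g v ->
  L + fdeg (wedge f g) <= deg v + deg f + deg g.
Proof.
move=> w0 [u [w [h1 h2 h3 h4 h5]]]; have := fdeg_wedge v g.
have [f0 g0] := wedge_gt0 w0; have [l1 _ _] := nonres_bounds f0 g0 h1.
have u0 : u != 0 by apply: contraTneq h2 => ->; rewrite deg0 -ltNge; dlra.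
by rewrite h4 wedgeff scaler0 addr0 fdegZ //; dlra.
Qed.
(** The hypothesis on [h] makes the term [u *: wedge f g] dominate in [wedge (h + v) g]. *)
Lemma cancels_wedge L f g v h : wedge f g != 0 -> cancels L f g v ->
  fdeg (wedge h g) + deg f < L + fdeg (wedge f g) ->
  L + fdeg (wedge f g) <= deg f + fdeg (wedge (h + v) g).
Proof.
move=> w0 [u [w [h1 h2 h3 h4 h5]]] hh.
have [f0 g0] := wedge_gt0 w0; have [l1 _ _] := nonres_bounds f0 g0 h1.
have u0 : u != 0 by apply: contraTneq h2 => ->; rewrite deg0 -ltNge; dlra.
by rewrite wedgeDl h4 wedgeff scaler0 addr0 fdegD_lt fdegZ //; dlra.
Qed.
Lemma alg_jac f g v : alg f g v -> jac v f g = 0.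
Proof.
move=> [p ->]; rewrite /ev (jac_comp _ _ _ _ (isT : ord0 != ord_max :> 'I_2)) /=.
by rewrite jac_ff (jac_rot g f g) (jac_rot f g g) jac_ff !mulr0 addr0.
Qed.

Definition minimal f g h := forall v, alg f g v -> deg h <= deg (h + v).

Lemma exists_minimal f g h : exists h', alg f g (h' - h) /\ minimal f g h'.
Proof.
elim/(emb_wf_ind (mu := @mlead 3 C)): h => h IH.
have [m|m] := classic (minimal f g h).
  by exists h; rewrite subrr; split => //; apply: alg0.
have [v nv] := not_all_ex_not _ _ m.
have [hv lt] := imply_to_and _ _ nv.
have [|h' [h1 h2]] := IH (h + v); first by rewrite -!degE ltNge; apply/negP.
exists h'; split => //; have -> : h' - h = h' - (h + v) + v by ring.
exact: algD.
Qed.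

(** A monomial of the same degree as [h] could be used to lower it. *)
Lemma minimal_nc f g h a b : minimal f g h -> 0 < deg f -> 0 < deg g -> 0 < deg h ->
  deg f *+ a + deg g *+ b != deg h.
Proof.
move=> m f0 g0 h0; apply/eqP => e; pose t := f ^+ a * g ^+ b.
have dt : deg t = deg h.
  by rewrite degM ?expf_neq0 ?deg_gt0_neq0 // !degXn ?deg_gt0_neq0.
have t0 : 0 < deg t by rewrite dt.
have [c c0 lt] := deg_sub_lt t0 (esym dt).
have /m : alg f g (- (c *: t)).
  by apply: algN; apply: algZ; apply: algM; apply: algX; [apply: algl|apply: algr].
by rewrite leNgt -dt lt.
Qed.
Lemma minimal_esp f g f' g' h h' (c : C) : (forall v, alg f' g' v -> alg f g v) ->
  minimal f g h -> c != 0 -> alg f g (h' - c *: h) -> deg h' <= deg h -> minimal f' g' h'.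
Proof.
move=> sub m c0 ha le v /sub av; apply: le_trans le _.
have -> : h' + v = c *: (h + c^-1 *: ((h' - c *: h) + v)).
  by rewrite scalerDr scalerA divff // scale1r addrA (addrC (c *: h)) subrK.
by rewrite degZ //; apply: m; apply: algZ; apply: algD.
Qed.
End Algebra.

(** * Affine changes of coordinates *)

Section Span.
Variable C : numFieldType.
Local Notation P := {mpoly C[3]}.
Implicit Types (f g h u v w : P) (a b c e : C).

(* Linear spans are taken modulo constants, so that affine changes of coordinates preserve them. *)
Definition sp2 f g v := exists a b e, v = a *: f + b *: g + e%:MP.
Definition sp3 f g h v := exists a b c e, v = a *: f + b *: g + c *: h + e%:MP.
Definition esp2 f g f' g' := [/\ sp2 f g f', sp2 f g g', sp2 f' g' f & sp2 f' g' g].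
Definition eqv f g h f' g' h' :=
  [/\ sp3 f g h f', sp3 f g h g' & sp3 f g h h'] /\
  [/\ sp3 f' g' h' f, sp3 f' g' h' g & sp3 f' g' h' h].

Lemma sp2l f g : sp2 f g f.
Proof. by exists 1, 0, 0; rewrite scale1r scale0r mpolyC0 !addr0. Qed.
Lemma sp2r f g : sp2 f g g.
Proof. by exists 0, 1, 0; rewrite scale1r scale0r mpolyC0 add0r addr0. Qed.
Lemma sp2C f g c : sp2 f g c%:MP.
Proof. by exists 0, 0, c; rewrite !scale0r !add0r. Qed.
Lemma sp2D f g u v : sp2 f g u -> sp2 f g v -> sp2 f g (u + v).
Proof.
move=> [a [b [e ->]]] [a' [b' [e' ->]]]; exists (a + a'), (b + b'), (e + e').
by rewrite !scalerDl mpolyCD; ring.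
Qed.
Lemma sp2Z f g c u : sp2 f g u -> sp2 f g (c *: u).
Proof.
move=> [a [b [e ->]]]; exists (c * a), (c * b), (c * e).
by rewrite !scalerDr !scalerA -[c *: e%:MP]mul_mpolyC -mpolyCM.
Qed.
Lemma sp2N f g u : sp2 f g u -> sp2 f g (- u).
Proof. by rewrite -scaleN1r; apply: sp2Z. Qed.
Lemma sp2B f g u v : sp2 f g u -> sp2 f g v -> sp2 f g (u - v).
Proof. by move=> hu hv; apply: sp2D => //; apply: sp2N. Qed.
Lemma sp2_trans f g f' g' v : sp2 f g f' -> sp2 f g g' -> sp2 f' g' v -> sp2 f g v.
Proof.
move=> hf hg [a [b [e ->]]].
by apply: sp2D; [apply: sp2D; apply: sp2Z|apply: sp2C].
Qed.

Lemma sp31 f g h : sp3 f g h f.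
Proof. by exists 1, 0, 0, 0; rewrite scale1r !scale0r mpolyC0 !addr0. Qed.
Lemma sp32 f g h : sp3 f g h g.
Proof. by exists 0, 1, 0, 0; rewrite scale1r !scale0r mpolyC0 add0r !addr0. Qed.
Lemma sp33 f g h : sp3 f g h h.
Proof. by exists 0, 0, 1, 0; rewrite scale1r !scale0r mpolyC0 !add0r !addr0. Qed.
Lemma sp3C f g h c : sp3 f g h c%:MP.
Proof. by exists 0, 0, 0, c; rewrite !scale0r !add0r. Qed.
Lemma sp3D f g h u v : sp3 f g h u -> sp3 f g h v -> sp3 f g h (u + v).
Proof.
move=> [a [b [c [e ->]]]] [a' [b' [c' [e' ->]]]].
exists (a + a'), (b + b'), (c + c'), (e + e').
by rewrite !scalerDl mpolyCD; ring.
Qed.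
Lemma sp3Z f g h c u : sp3 f g h u -> sp3 f g h (c *: u).
Proof.
move=> [a [b [d [e ->]]]]; exists (c * a), (c * b), (c * d), (c * e).
by rewrite !scalerDr !scalerA -[c *: e%:MP]mul_mpolyC -mpolyCM.
Qed.
Lemma sp3N f g h u : sp3 f g h u -> sp3 f g h (- u).
Proof. by rewrite -scaleN1r; apply: sp3Z. Qed.
Lemma sp3B f g h u v : sp3 f g h u -> sp3 f g h v -> sp3 f g h (u - v).
Proof. by move=> hu hv; apply: sp3D => //; apply: sp3N. Qed.
Lemma sp3_trans f g h f' g' h' v : sp3 f g h f' -> sp3 f g h g' -> sp3 f g h h' ->
  sp3 f' g' h' v -> sp3 f g h v.
Proof.
move=> hf hg hh [a [b [c [e ->]]]].
by apply: sp3D; [apply: sp3D; [apply: sp3D|]; apply: sp3Z|apply: sp3C].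
Qed.
Lemma sp2_sp3 f g h u v w : sp3 f g h u -> sp3 f g h v -> sp2 u v w -> sp3 f g h w.
Proof.
move=> hf hg [a [b [e ->]]].
by apply: sp3D; [apply: sp3D; apply: sp3Z|apply: sp3C].
Qed.

Lemma sp2_alg f g v : sp2 f g v -> alg f g v.
Proof.
move=> [a [b [e ->]]]; apply: algD; last exact: algC.
by apply: algD; apply: algZ; [apply: algl|apply: algr].
Qed.

Lemma esp2_sym f g f' g' : esp2 f g f' g' -> esp2 f' g' f g.
Proof. by case. Qed.
Lemma esp2_alg f g f' g' v : esp2 f g f' g' -> alg f g v <-> alg f' g' v.
Proof. by case=> h1 h2 h3 h4; split; apply: alg_sub; apply: sp2_alg. Qed.
Lemma eqv_sym f g h f' g' h' : eqv f g h f' g' h' -> eqv f' g' h' f g h.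
Proof. by case. Qed.
Lemma eqv_trans f g h f1 g1 h1 f2 g2 h2 :
  eqv f g h f1 g1 h1 -> eqv f1 g1 h1 f2 g2 h2 -> eqv f g h f2 g2 h2.
Proof.
move=> [[a1 a2 a3] [b1 b2 b3]] [[c1 c2 c3] [d1 d2 d3]].
by split; split; [apply: sp3_trans c1|apply: sp3_trans c2|apply: sp3_trans c3|
  apply: sp3_trans b1|apply: sp3_trans b2|apply: sp3_trans b3].
Qed.
Lemma eqv_refl f g h : eqv f g h f g h.
Proof. by split; split; [apply: sp31|apply: sp32|apply: sp33|apply: sp31|apply: sp32|apply: sp33]. Qed.
Lemma esp2_eqv f g f' g' h h' a : esp2 f g f' g' -> a != 0 -> sp2 f g (h' - a *: h) ->
  eqv f g h f' g' h'.
Proof.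
move=> [h1 h2 h3 h4] a0 h5.
have k1 : sp3 f g h f' by apply: sp2_sp3 h1; [apply: sp31|apply: sp32].
have k2 : sp3 f g h g' by apply: sp2_sp3 h2; [apply: sp31|apply: sp32].
have k4 : sp3 f' g' h' f by apply: sp2_sp3 h3; [apply: sp31|apply: sp32].
have k5 : sp3 f' g' h' g by apply: sp2_sp3 h4; [apply: sp31|apply: sp32].
split; split=> //.
- rewrite -[h'](subrK (a *: h)); apply: sp3D; last by apply: sp3Z; apply: sp33.
  by apply: sp2_sp3 h5; [apply: sp31|apply: sp32].
- have -> : h = a^-1 *: (h' - (h' - a *: h)).
    by rewrite opprB addrC subrK scalerA mulVf // scale1r.
  apply: sp3Z; apply: sp3B; first exact: sp33.
  exact: sp2_sp3 h5.
Qed.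

Lemma wedge_sp2 f g a b e a' b' e' :
  wedge (a *: f + b *: g + e%:MP) (a' *: f + b' *: g + e'%:MP) =
  (a * b' - a' * b)%:MP *: wedge f g.
Proof.
by apply/rowP => k; rewrite !(mxE, wedgeE) !(ldD, ldZ, ldC) -!mul_mpolyC; ring.
Qed.

Lemma wedge_sp3 f g h a b c e a' b' c' e' :
  wedge (a *: f + b *: g + c *: h + e%:MP) (a' *: f + b' *: g + c' *: h + e'%:MP) =
  (a * b' - a' * b)%:MP *: wedge f g + (a * c' - a' * c)%:MP *: wedge f h +
  (b * c' - b' * c)%:MP *: wedge g h.
Proof.
by apply/rowP => k; rewrite !(mxE, wedgeE) !(ldD, ldZ, ldC) -!mul_mpolyC; ring.
Qed.

(** A nonzero wedge means a nonzero determinant [d], and Cramer's rule inverts the change of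
    generators. *)
Lemma esp2_intro f g f' g' : sp2 f g f' -> sp2 f g g' -> wedge f' g' != 0 ->
  esp2 f g f' g' /\ exists2 c, c != 0 & wedge f' g' = c%:MP *: wedge f g.
Proof.
move=> hf hg; have [a [b [e ef]]] := hf; have [a' [b' [e' eg]]] := hg.
rewrite ef eg wedge_sp2 -ef -eg => w0; set d := a * b' - a' * b in w0 *.
have d0 : d != 0 by apply: contraNneq w0 => ->; rewrite mpolyC0 scale0r.
split; last by exists d.
split=> //.
- have -> : f = d^-1 *: (b' *: f' - b *: g' + (b * e' - b' * e)%:MP).
    apply: (canRL (scalerK d0)); rewrite ef eg /d -!mul_mpolyC.
    by rewrite !mpolyCB !mpolyCM; ring.
  by apply: sp2Z; apply: sp2D; [apply: sp2B; apply: sp2Z; [apply: sp2l|apply: sp2r]|apply: sp2C].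
- have -> : g = d^-1 *: (a *: g' - a' *: f' + (a' * e - a * e')%:MP).
    apply: (canRL (scalerK d0)); rewrite ef eg /d -!mul_mpolyC.
    by rewrite !mpolyCB !mpolyCM; ring.
  by apply: sp2Z; apply: sp2D; [apply: sp2B; apply: sp2Z; [apply: sp2r|apply: sp2l]|apply: sp2C].
Qed.

Lemma degDC f c : deg (f + c%:MP) = deg f.
Proof.
have [/deg_const[z ->]|f0] := eqVneq (deg f) 0; first by rewrite -mpolyCD !degC.
by rewrite addrC degD_lt // degC lt_neqAle eq_sym f0 deg_ge0.
Qed.
Lemma degD_max f g : [\/ deg f != deg g, f = 0 | g = 0] ->
  deg (f + g) = Num.max (deg f) (deg g).
Proof.
case=> [|->|->]; last 2 first.
- by rewrite add0r deg0 max_r ?deg_ge0.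
- by rewrite addr0 deg0 max_l ?deg_ge0.
by case: ltgtP => // h _; [rewrite degD_lt|rewrite degD_lt_l].
Qed.
Lemma degZ_if a f : deg (a *: f) = if a == 0 then 0 else deg f.
Proof. by case: eqP => [->|/eqP a0]; [rewrite scale0r deg0|rewrite degZ]. Qed.

Definition dist f g h := [/\ deg f != deg g, deg f != deg h & deg g != deg h].

(** Distinct degrees prevent leading terms from cancelling in a linear combination. *)
Lemma deg_sp2 f g a b e : 0 < deg f -> 0 < deg g -> deg f != deg g ->
  deg (a *: f + b *: g + e%:MP) =
  Num.max (if a == 0 then 0 else deg f) (if b == 0 then 0 else deg g).
Proof.
move=> f0 g0 fg; rewrite degDC degD_max ?degZ_if //.
have [->|a0] := eqVneq a 0; first by constructor 2; rewrite scale0r.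
have [->|b0] := eqVneq b 0; first by constructor 3; rewrite scale0r.
by constructor 1.
Qed.
Lemma deg_sp3 f g h a b c e : 0 < deg f -> 0 < deg g -> 0 < deg h -> dist f g h ->
  deg (a *: f + b *: g + c *: h + e%:MP) =
  Num.max (Num.max (if a == 0 then 0 else deg f) (if b == 0 then 0 else deg g))
          (if c == 0 then 0 else deg h).
Proof.
move=> f0 g0 h0 [fg fh gh]; have := deg_sp2 a b 0 f0 g0 fg; rewrite mpolyC0 addr0 => e1.
rewrite degDC degD_max ?e1 ?degZ_if //.
have [->|c0] := eqVneq c 0; first by constructor 3; rewrite scale0r.
constructor 1; rewrite /Num.max; case: ifP => _; case: ifP => _; rewrite ?(lt_eqF h0) //.
Qed.
End Span.

(** * Relative position of two planes in one affine class *)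

Section Centers.
Variable C : numFieldType.
Local Notation P := {mpoly C[3]}.
Implicit Types (f g h u v w k l j m : P) (a b c e : C).

Lemma deg_in2 f g v : 0 < deg f -> 0 < deg g -> deg f != deg g -> sp2 f g v ->
  0 < deg v -> deg v = deg f \/ deg v = deg g.
Proof.
move=> f0 g0 fg [a [b [e ->]]]; rewrite (deg_sp2 _ _ _ f0 g0 fg).
by rewrite /Num.max; case: ifP => _; case: ifP => _; rewrite ?ltxx; auto.
Qed.
Lemma deg_in3 f g h v : 0 < deg f -> 0 < deg g -> 0 < deg h -> dist f g h ->
  sp3 f g h v -> 0 < deg v -> [\/ deg v = deg f, deg v = deg g | deg v = deg h].
Proof.
move=> f0 g0 h0 d [a [b [c [e ->]]]]; rewrite (deg_sp3 _ _ _ _ f0 g0 h0 d).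
case: (a == 0); case: (b == 0); case: (c == 0); rewrite /Num.max;
  repeat (case: ifP => _); rewrite ?ltxx // => _;
  by [constructor 1|constructor 2|constructor 3].
Qed.

Lemma jacDr f g h h' : jac f g (h + h') = jac f g h + jac f g h'.
Proof. by rewrite !(jac_rot f) !(jac_rot g) jacDl. Qed.
Lemma jacZr a f g h : jac f g (a *: h) = a *: jac f g h.
Proof. by rewrite !(jac_rot f) !(jac_rot g) jacZl. Qed.
Lemma jac_sp2 f g a b e u : u = a *: f + b *: g + e%:MP -> jac u f g = 0.
Proof.
move=> ->; rewrite !jacDl !jacZl jacCl jac_ff (jac_rot g) (jac_rot f).
by rewrite jac_ff !scaler0 !addr0.
Qed.
Lemma jac_coset f g h h' a : sp2 f g (h' - a *: h) -> jac h' f g = a *: jac h f g.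
Proof.
move=> [b [c [e E]]]; rewrite -[h'](subrK (a *: h)) jacDl (jac_sp2 E) add0r.
by rewrite jacZl.
Qed.
Lemma jac_wedge c k j f g h : wedge k j = c%:MP *: wedge f g ->
  jac h k j = c%:MP * jac h f g.
Proof.
move=> e; rewrite !jac_def mulr_sumr; apply: eq_bigr => i _.
by rewrite e mxE mulrCA.
Qed.

Lemma jac_wedge3 a b c u v w f g h :
  wedge v w = a%:MP *: wedge f g + b%:MP *: wedge f h + c%:MP *: wedge g h ->
  jac u v w = a%:MP * jac u f g + b%:MP * jac u f h + c%:MP * jac u g h.
Proof.
rewrite !jac_def; move: (wedge v w) (wedge f g) (wedge f h) (wedge g h) => w0 w1 w2 w3 ->.
rewrite !mulr_sumr -!big_split /=; apply: eq_bigr => k _.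
by rewrite !mxE; ring.
Qed.

Lemma jac_sp3 f g h f' g' h' : sp3 f' g' h' f -> sp3 f' g' h' g -> sp3 f' g' h' h ->
  jac f' g' h' = 0 -> jac f g h = 0.
Proof.
move=> [a1 [b1 [c1 [e1 ->]]]] [a2 [b2 [c2 [e2 ->]]]] [a3 [b3 [c3 [e3 ->]]]] j0.
have z u : jac u f' g' = 0 -> jac u f' h' = 0 -> jac u g' h' = 0 ->
    jac u (a2 *: f' + b2 *: g' + c2 *: h' + e2%:MP)
          (a3 *: f' + b3 *: g' + c3 *: h' + e3%:MP) = 0.
  by move=> u1 u2 u3; rewrite (jac_wedge3 _ (wedge_sp3 _ _ _ _ _ _ _ _ _ _ _)) u1 u2 u3 !mulr0 !addr0.
have j1 : jac g' f' h' = 0 by rewrite jac_swap j0 oppr0.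
have j2 : jac h' f' g' = 0 by rewrite jac_rot.
apply: z; rewrite !jacDl !jacZl jacCl ?jac_ff ?j0 ?j1 ?j2.
- by rewrite (jac_rot g') (jac_rot f') jac_ff !scaler0 !addr0.
- by rewrite (jac_rot h') (jac_rot f') jac_ff !scaler0 !addr0.
- by rewrite (jac_rot h') (jac_rot g') jac_ff !scaler0 !addr0.
Qed.

Lemma eqv_jac f g h f' g' h' : eqv f g h f' g' h' -> jac f g h != 0 -> jac f' g' h' != 0.
Proof. by move=> [_ [h1 h2 h3]]; apply: contraNneq => /(jac_sp3 h1 h2 h3) ->. Qed.

Lemma make_dist k j : wedge k j != 0 -> exists t : C,
  deg (k - t *: j) != deg j /\ deg (k - t *: j) <= deg k.
Proof.
move=> w0; have j0 : 0 < deg j.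
  rewrite lt_neqAle deg_ge0 andbT; apply: contraNneq w0 => /esym/deg_const[z ->].
  by rewrite wedgeCr.
have [e|ne] := eqVneq (deg k) (deg j); last by exists 0; rewrite scale0r subr0.
by have [t _ h] := deg_sub_lt j0 e; exists t; rewrite (lt_eqF h) e (ltW h).
Qed.
Lemma wedge_sub k j t : wedge (k - t *: j) j = wedge k j.
Proof. by rewrite wedgeDl wedgeNl wedgeZl wedgeff scaler0 subr0. Qed.

Lemma pigeon3 (x y z r s t : Gam) :
  x != y -> x = r \/ x = s -> y = r \/ y = s ->
  [\/ z = r, z = s | z = t] -> z != x -> z != y -> z = t.
Proof.
move=> xy hx hy hz /eqP zx /eqP zy; move/eqP: xy.
by case: hx hy hz zx zy => -> [] -> [] ->.
Qed.

(* Two planes of the space spanned by the components share a line [j]: [CentersDiff1]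
   and [CentersDiff2] are the two possible positions of the degrees in bases adapted to the two planes. *)
Variant centers_spec f g h f0 g0 h0 : Prop :=
| CentersSame of esp2 f g f0 g0 & deg h0 = deg h &
    exists2 a, a != 0 & sp2 f g (h0 - a *: h)
| CentersDiff1 k l j of dist k l j & esp2 f g k j & esp2 f0 g0 l j &
    deg l = deg h & deg k = deg h0 &
    deg k + deg l + deg j = deg f + deg g + deg h &
    (exists2 a, a != 0 & sp2 k j (l - a *: h)) &
    (exists2 a, a != 0 & sp2 l j (k - a *: h0))
| CentersDiff2 k m j of dist k m j & deg m < deg k & esp2 f g k j & esp2 f0 g0 (k + m) j &
    deg m = deg h & deg m = deg h0 &
    deg k + deg m + deg j = deg f + deg g + deg h &
    (exists2 a, a != 0 & sp2 k j (m - a *: h)) &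
    (exists2 a, a != 0 & sp2 (k + m) j (m - a *: h0)).

Lemma coset_exists f g h v : sp3 f g h v -> jac v f g != 0 ->
  exists2 a, a != 0 & sp2 f g (v - a *: h).
Proof.
move=> [a [b [c [e E]]]] j0.
have s : sp2 f g (v - c *: h) by exists a, b, e; rewrite E; ring.
exists c => //; apply: contraNneq j0 => c0.
by rewrite (jac_coset s) c0 scale0r.
Qed.

Lemma coset_esp2 f g k j u : esp2 f g k j -> sp2 f g u <-> sp2 k j u.
Proof. by case=> h1 h2 h3 h4; split; apply: sp2_trans. Qed.

(** Three nonconstant elements of the span with distinct degrees exhaust its three possible
    degrees. *)
Lemma span_sum f g h x y z : jac f g h != 0 -> dist f g h ->
  sp3 f g h x -> sp3 f g h y -> sp3 f g h z -> dist x y z -> jac x y z != 0 ->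
  deg x + deg y + deg z = deg f + deg g + deg h.
Proof.
move=> J d hx hy hz [xy xz yz] Jx; have [f0 g0 h0] := jac_deg_gt0 J.
have [x0 y0 z0] := jac_deg_gt0 Jx.
have ix := deg_in3 f0 g0 h0 d hx x0; have iy := deg_in3 f0 g0 h0 d hy y0.
have iz := deg_in3 f0 g0 h0 d hz z0.
by move: xy xz yz; case: ix => ->; case: iy => ->; case: iz => ->;
  rewrite ?eqxx // => _ _ _; dlra.
Qed.

Lemma esp2_coset f g h f0 g0 h0 : jac f g h != 0 -> dist f g h -> dist f0 g0 h0 ->
  eqv f g h f0 g0 h0 -> esp2 f g f0 g0 ->
  deg h0 = deg h /\ exists2 a, a != 0 & sp2 f g (h0 - a *: h).
Proof.
move=> J d [fg0 fh0 gh0] E [s1 s2 _ _]; have J0 := eqv_jac E J.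
have [w_fg0 _ _ _] := jac_neq0 J0; have [_ _ ph0] := jac_deg_gt0 J0.
have [pf pg ph] := jac_deg_gt0 J; have [fg _ _] := d.
have [pf0 pg0 _] := jac_deg_gt0 J0; have [[_ _ S3] _] := E.
have [_ [t t0 ew]] := esp2_intro s1 s2 w_fg0.
split; last first.
  apply: coset_exists S3 _; move: J0; rewrite jac_rot jac_rot (jac_wedge _ ew).
  by rewrite mulf_eq0 negb_or => /andP[].
apply: (pigeon3 fg0); [exact: (deg_in2 pf pg fg s1)|exact: (deg_in2 pf pg fg s2)| |
   by rewrite eq_sym|by rewrite eq_sym].
exact: deg_in3.
Qed.

Lemma centers f g h f0 g0 h0 : jac f g h != 0 -> dist f g h -> dist f0 g0 h0 ->
  eqv f g h f0 g0 h0 -> centers_spec f g h f0 g0 h0.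
Proof.
move=> J d d0 E; have J0 := eqv_jac E J.
have [w_fg w_fh w_gh _] := jac_neq0 J; have [pf pg ph] := jac_deg_gt0 J.
have [w_fg0 w_fh0 w_gh0 _] := jac_neq0 J0; have [pf0 pg0 ph0] := jac_deg_gt0 J0.
have [[S1 S2 S3] [T1 T2 T3]] := E; have [fg fh gh] := d; have [fg0 fh0 gh0] := d0.
have in3 v : sp3 f g h v -> 0 < deg v -> [\/ deg v = deg f, deg v = deg g | deg v = deg h].
  exact: deg_in3.
have [a1 [b1 [c1 [e1 E1]]]] := S1; have [a2 [b2 [c2 [e2 E2]]]] := S2.
(* [c1] and [c2] are the coefficients of [h] in [f0] and [g0]; if both vanish, the two planes
   coincide. *)
have [/andP[/eqP c10 /eqP c20]|cn] := boolP ((c1 == 0) && (c2 == 0)).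
  have s1 : sp2 f g f0 by exists a1, b1, e1; rewrite E1 c10 scale0r addr0.
  have s2 : sp2 f g g0 by exists a2, b2, e2; rewrite E2 c20 scale0r addr0.
  have [es _] := esp2_intro s1 s2 w_fg0.
  by have [] := esp2_coset J d d0 E es; apply: CentersSame.
(* The combination in which [h] cancels, hence a generator of the common line. *)
pose j := c2 *: f0 - c1 *: g0.
have jP'' : sp2 f0 g0 j by apply: sp2B; apply: sp2Z; [apply: sp2l|apply: sp2r].
pose al := c2 * a1 - c1 * a2; pose be := c2 * b1 - c1 * b2.
have Ej : j = al *: f + be *: g + (c2 * e1 - c1 * e2)%:MP.
  by rewrite /j E1 E2 /al /be -!mul_mpolyC !mpolyCB !mpolyCM; ring.
have jP' : sp2 f g j by rewrite Ej; exists al, be, (c2 * e1 - c1 * e2).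
have [l0 [l0P l0w l0J]] : exists l0, [/\ sp2 f0 g0 l0, wedge l0 j != 0 & jac l0 f g != 0].
  have Jc c : c != 0 -> c *: jac h f g != 0.
    have Jh : jac h f g != 0 by rewrite (jac_rot h f g).
    by move=> c0; rewrite scaler_eq0 negb_or c0 Jh.
  have wf : wedge f0 j = - c1%:MP *: wedge f0 g0.
    by rewrite /j wedgeDr wedgeNr !wedgeZr wedgeff scaler0 add0r scaleNr.
  have wg : wedge g0 j = - c2%:MP *: wedge f0 g0.
    by rewrite /j wedgeDr wedgeNr !wedgeZr wedgeff scaler0 subr0 (wedgeC g0) scalerN scaleNr.
  have [c10|c10] := eqVneq c1 0.
    have c20 : c2 != 0 by move: cn; rewrite c10 eqxx.
    exists g0; split; first exact: sp2r.
      by rewrite wg ?oppr_eq0 formZ_eq0 negb_or ?oppr_eq0 mpolyC_eq0 c20.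
    rewrite (@jac_coset f g h g0 c2) ?Jc //.
    by exists a2, b2, e2; rewrite E2; ring.
  exists f0; split; first exact: sp2l.
    by rewrite wf ?oppr_eq0 formZ_eq0 negb_or ?oppr_eq0 mpolyC_eq0 c10.
  rewrite (@jac_coset f g h f0 c1) ?Jc //.
  by exists a1, b1, e1; rewrite E1; ring.
have [pl0 pj] := wedge_gt0 l0w.
have [k0 [k0P k0w]] : exists k0, sp2 f g k0 /\ wedge k0 j != 0.
  have [be0|be0] := eqVneq be 0.
    exists g; split; first exact: sp2r.
    have al0 : al != 0.
      apply: contraTneq pj => al0; rewrite Ej al0 be0 !scale0r !add0r degC ltxx.
      by [].
    rewrite Ej be0 scale0r addr0 wedgeDr wedgeCr addr0 wedgeZr formZ_eq0 negb_or.
    by rewrite mpolyC_eq0 al0 wedgeC oppr_eq0.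
  exists f; split; first exact: sp2l.
  rewrite Ej !wedgeDr wedgeCr addr0 !wedgeZr wedgeff scaler0 add0r formZ_eq0 negb_or.
  by rewrite mpolyC_eq0 be0.
(* Subtracting multiples of [j] stays in the planes and separates the degrees from that of [j]. *)
have [t [kj _]] := make_dist k0w; set k := k0 - t *: j in kj.
have [s [lj _]] := make_dist l0w; set l := l0 - s *: j in lj.
have kw : wedge k j != 0 by rewrite wedge_sub.
have lw : wedge l j != 0 by rewrite wedge_sub.
have kP : sp2 f g k by apply: sp2B => //; apply: sp2Z.
have lP : sp2 f0 g0 l by apply: sp2B => //; apply: sp2Z.
have [ek [ck ck0 wk]] := esp2_intro kP jP' kw.
have [el [cl cl0 wl]] := esp2_intro lP jP'' lw.
have lJ : jac l f g != 0.
  rewrite /l jacDl -scaleN1r !jacZl; have [x [y [z ez]]] := jP'.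
  by rewrite (jac_sp2 ez) !scaler0 addr0.
have Jlkj : jac l k j != 0 by rewrite (jac_wedge _ wk) mulf_neq0 ?mpolyC_eq0.
have s2f u : sp2 f g u -> sp3 f g h u by apply: sp2_sp3; [apply: sp31|apply: sp32].
have s20 u : sp2 f0 g0 u -> sp3 f0 g0 h0 u by apply: sp2_sp3; [apply: sp31|apply: sp32].
have s30 u : sp3 f0 g0 h0 u -> sp3 f g h u by apply: sp3_trans.
have s03 u : sp3 f g h u -> sp3 f0 g0 h0 u by apply: sp3_trans.
have [pk _] := wedge_gt0 kw; have [pl _] := wedge_gt0 lw.
have cos1 v : sp3 f g h v -> jac v k j != 0 -> exists2 a, a != 0 & sp2 k j (v - a *: h).
  move=> hv Jv; have [|a a0 ha] := @coset_exists f g h v hv.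
    by move: Jv; rewrite (jac_wedge _ wk) mulf_eq0 negb_or => /andP[].
  by exists a => //; apply/(coset_esp2 _ ek).
have cos2 v l' : sp3 f0 g0 h0 v -> esp2 f0 g0 l' j -> (exists c : C, wedge l' j = c%:MP *: wedge f0 g0) ->
    jac v l' j != 0 -> exists2 a, a != 0 & sp2 l' j (v - a *: h0).
  move=> hv el' [c wl'] Jv; have [|a a0 ha] := @coset_exists f0 g0 h0 v hv.
    by move: Jv; rewrite (jac_wedge _ wl') mulf_eq0 negb_or => /andP[].
  by exists a => //; apply/(coset_esp2 _ el').
have degs v : sp3 f g h v -> 0 < deg v -> deg v != deg k -> deg v != deg j -> deg v = deg h.
  move=> hv v0; apply: (pigeon3 kj); [exact: (deg_in2 pf pg fg kP)|exact: (deg_in2 pf pg fg jP')|].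
  exact: in3.
have degs0 v l' : sp2 f0 g0 l' -> 0 < deg l' -> deg l' != deg j ->
    sp3 f0 g0 h0 v -> 0 < deg v -> deg v != deg l' -> deg v != deg j -> deg v = deg h0.
  move=> hl' l0' lj' hv v0; apply: (pigeon3 lj');
   [exact: (deg_in2 pf0 pg0 fg0 hl')|exact: (deg_in2 pf0 pg0 fg0 jP'')|].
  exact: (deg_in3 pf0 pg0 ph0 d0).
have [kl|kl] := eqVneq (deg k) (deg l); last first.
  apply: (@CentersDiff1 f g h f0 g0 h0 k l j) => //.
  - by apply: degs => //; [apply/s30/s20|rewrite eq_sym].
  - by apply: (degs0 k l) => //; apply/s03/s2f.
  - apply: span_sum => //; [exact: s2f|by apply/s30/s20|exact: s2f|].
    by rewrite jac_swap oppr_eq0.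
  - by apply: cos1 => //; apply/s30/s20.
  - apply: cos2 => //; [by apply/s03/s2f|by exists cl|].
    by rewrite jac_swap oppr_eq0.
(* When [k] and [l] have equal degrees, the generator of the second plane is rewritten as [k1 + m],
   with [k1] proportional to [k] and [m] of lower degree, corrected by [j] so that its degree
   differs from [deg j]. *)
have [c c0 hc] := deg_sub_lt pk (esym kl).
have [s' [m0j lem0]] : exists s' : C, deg (l - c *: k - s' *: j) != deg j /\
    deg (l - c *: k - s' *: j) < deg k.
  have [e|ne] := eqVneq (deg (l - c *: k)) (deg j); last by exists 0; rewrite scale0r subr0.
  have [s' _ hs'] := deg_sub_lt pj e; exists s'; rewrite (lt_eqF hs'); split => //.
  by apply: lt_trans hs' _; rewrite -e.
set m := l - c *: k - s' *: j in m0j lem0.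
pose k1 := c *: k.
have dk1 : deg k1 = deg k by rewrite degZ.
have Elm : k1 + m = l - s' *: j by rewrite /k1 /m; ring.
have lm : sp2 f0 g0 (k1 + m) by rewrite Elm; apply: sp2B => //; apply: sp2Z.
have wlm : wedge (k1 + m) j = wedge l j by rewrite Elm wedge_sub.
have ek1 : esp2 f g k1 j.
  by apply: (esp2_intro _ jP' _).1; [apply: sp2Z|rewrite wedgeZl formZ_eq0 negb_or mpolyC_eq0 c0].
have ekk1 : esp2 k j k1 j.
  apply: (esp2_intro (sp2Z c (sp2l k j)) (sp2r k j) _).1.
  by rewrite wedgeZl formZ_eq0 negb_or mpolyC_eq0 c0.
have elm : esp2 f0 g0 (k1 + m) j by apply: (esp2_intro lm jP'' _).1; rewrite wlm.
have m3 : sp3 f g h m.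
  by apply: sp3B; [apply: sp3B; [apply/s30/s20|apply: sp3Z; apply: s2f]|apply: sp3Z; apply: s2f].
have Jm : jac m k j != 0.
  have -> : jac m k j = jac l k j; last by [].
  have em : sp2 k j (m - 1 *: l).
    exists (- c), (- s'), 0; rewrite /m scale1r mpolyC0 !scaleNr; ring.
  by rewrite (jac_coset em) scale1r.
have [pm _ _] := jac_deg_gt0 Jm.
have dlm : deg (k1 + m) = deg k by rewrite degD_lt_l dk1.
have mk : deg m != deg k by rewrite (lt_eqF lem0).
apply: (@CentersDiff2 f g h f0 g0 h0 k1 m j) => //.
- by split; rewrite ?dk1 // eq_sym.
- by rewrite dk1.
- exact: degs.
- by apply: (degs0 m (k1 + m)) => //; rewrite ?dlm //; apply: s03.
- apply: span_sum => //; [by apply: sp3Z; apply: s2f|exact: s2f| |].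
    by split; rewrite ?dk1 // eq_sym.
  by rewrite /k1 jacZl -mul_mpolyC mulf_neq0 ?mpolyC_eq0 // jac_swap oppr_eq0.
- by have [a a0 ha] := cos1 _ m3 Jm; exists a => //; apply/(coset_esp2 _ ekk1).
- apply: cos2 => //; [exact: s03|by exists cl; rewrite wlm|].
  rewrite jac_rot jacDl (jac_rot m j m) (jac_rot j m m) jac_ff addr0 /k1 jacZl.
  by rewrite -mul_mpolyC mulf_neq0 ?mpolyC_eq0 // (jac_rot k j m) (jac_rot j m k).
Qed.
End Centers.

(** * Triples reached from affine ones *)

Section Reach.
Variable C : numFieldType.
Local Notation P := {mpoly C[3]}.
Local Notation D f g := (fdeg (wedge f g)).
Implicit Types (f g h u v w k l j m x y z : P) (a b c e : C).

(* [x, y, z] is obtained from [x, y, u] by raising the degree of the last component through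
   a cancellation between [x ^+ 2] and [y ^+ 3]. *)
Definition kdata x y z u := [/\ alg x y (z - u), deg x *+ 2 = deg y *+ 3,
  deg z *+ 2 <= deg x, deg u < deg z & deg u + deg y < deg x + D x y].

Inductive reach : P -> P -> P -> Prop :=
| reach_base f g h of jac f g h != 0 & (msize f <= 2)%N & (msize g <= 2)%N & (msize h <= 2)%N :
    reach f g h
| reach_eqv f g h f' g' h' of reach f g h & eqv f g h f' g' h' : reach f' g' h'
| reach_elem f g h h' of reach f g h' & alg f g (h - h') & dist f g h & deg h' < deg h :
    reach f g h
| reach_K x y z u a of reach x y u & kdata x y z u : reach (x + a *: z ^+ 2) y z.

Lemma reach213 f g h : reach f g h -> reach g f h.
Proof.
by move=> H; apply: reach_eqv H _; split; split; first [apply: sp31|apply: sp32|apply: sp33].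
Qed.
Lemma reach132 f g h : reach f g h -> reach f h g.
Proof.
by move=> H; apply: reach_eqv H _; split; split; first [apply: sp31|apply: sp32|apply: sp33].
Qed.
Lemma reach231 f g h : reach f g h -> reach g h f.
Proof. by move/reach213/reach132. Qed.
Lemma reach312 f g h : reach f g h -> reach h f g.
Proof. by move/reach132/reach213. Qed.
Lemma reach321 f g h : reach f g h -> reach h g f.
Proof. by move/reach231/reach213. Qed.

Lemma jac_alg_coset f g h h' : alg f g (h - h') -> jac f g h = jac f g h'.
Proof.
move=> /alg_jac; rewrite jac_rot jacDr -scaleN1r jacZr scaleN1r => /eqP.
by rewrite subr_eq0 => /eqP.
Qed.

Lemma reach_jac f g h : reach f g h -> jac f g h != 0.
Proof.
elim=> {f g h} [//|f g h f' g' h' _ J /eqv_jac||x y z u a _ J [/jac_alg_coset e _ _ _ _]].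
- by apply.
- by move=> f g h h' _ J /jac_alg_coset ->.
rewrite jacDl jacZl expr2 jacMl (jac_rot z y z) (jac_rot y z z) jac_ff mulr0 addr0.
by rewrite scaler0 addr0 e.
Qed.

Variant step f g h : Prop :=
| StepBase of (msize f <= 2)%N & (msize g <= 2)%N & (msize h <= 2)%N
| StepElem h' of reach f g h' & alg f g (h - h') & dist f g h & deg h' < deg h
| StepK x u a of a != 0 & f = x + a *: h ^+ 2 & reach x g u & kdata x g h u.

Lemma reach_inv f g h : reach f g h -> exists f0 g0 h0, eqv f g h f0 g0 h0 /\ step f0 g0 h0.
Proof.
elim=> {f g h}.
- move=> f g h _ f2 g2 h2; exists f, g, h; split; first exact: eqv_refl.
  exact: StepBase.
- move=> f g h f' g' h' _ [f0 [g0 [h0 [E S]]]] E'; exists f0, g0, h0; split=> //.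
  exact: eqv_trans (eqv_sym E') E.
- move=> f g h h' r _ ha d lt; exists f, g, h; split; first exact: eqv_refl.
  exact: (StepElem r).
move=> x y z u a r _ K; exists (x + a *: z ^+ 2), y, z; split; first exact: eqv_refl.
(* For [a = 0] the exceptional step is the elementary step from [u] to [z]. *)
have [a0|a0] := eqVneq a 0; last exact: (StepK a0 (erefl _) r K).
have J := reach_jac r; have [x0 y0 _] := jac_deg_gt0 J.
case: K => h1 h2 h3 h4 h5; rewrite a0 scale0r addr0.
apply: (StepElem r h1 _ h4); split; apply/eqP => e; dlra.
Qed.

Section Kfacts.
Variables (x y z u : P).
Hypotheses (J : jac x y u != 0) (K : kdata x y z u).

(** The difference [z - u] has the degree of [z], below those of [x] and [y], and the ratio 3 : 2 is
    not resonant; so leading terms cancel, with [L] equal to [deg x *+ 2]. The bound on [deg u] is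
    what lets [cancels_wedge] transfer this to [z]. *)
Lemma kdata_facts :
  [/\ deg x + D x y <= D z y, deg y *+ 2 + D x y <= D z x,
      deg x + D x y <= deg z + deg y, deg y + D x z = deg x + D y z & 0 < D x y].
Proof.
have [h1 h2 h3 h4 h5] := K; have [x0 y0 u0] := jac_deg_gt0 J.
have [wxy wxu wyu _] := jac_neq0 J.
have D0 := fdeg_wedge_gt0 wxy.
set v := z - u in h1; have zE : z = u + v by rewrite /v addrC subrK.
have dv : deg v = deg z by rewrite /v addrC degD_lt // degN.
have [|[N []]|[L hc]] := alg_dich h1 x0 y0 wxy.
- move=> [_ ha]; have [|a [b]] := ha; first by rewrite dv; dlra.
  rewrite dv; case: a => [|a]; last first.
    rewrite mulrS; have : 0 <= deg x *+ a by rewrite mulrn_wge0 // ltW.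
    by have : 0 <= deg y *+ b; [rewrite mulrn_wge0 // ltW|dlra].
  case: b => [|b]; first by rewrite !mulr0n; dlra.
  by rewrite mulr0n mulrS; have : 0 <= deg y *+ b; [rewrite mulrn_wge0 // ltW|dlra].
- move=> e; move: h2; rewrite e -mulrnA; move/mulrIn; rewrite gt_eqF // => /(_ isT).
  by clear; lia.
- move=> e; move: h2; rewrite e -mulrnA; move/mulrIn; rewrite gt_eqF // => /(_ isT).
  by clear; lia.
have LE : L = deg x *+ 2 by apply: nonres_ratio h2 => //; case: hc => ? [? []].
have k1 : deg x + D x y <= D z y.
  have := @cancels_wedge _ L x y v u wxy hc; rewrite -zE LE.
  by have := fdeg_wedge u y; dlra.
have k2 : deg y *+ 2 + D x y <= D z x.
  have wyx : wedge y x != 0 by rewrite wedgeC oppr_eq0.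
  have Dyx : D y x = D x y by rewrite wedgeC fdegN.
  have := @cancels_wedge _ L y x v u wyx (cancels_sym hc); rewrite -zE LE Dyx.
  by have := fdeg_wedge u x; dlra.
have k3 : deg x + D x y <= deg z + deg y.
  by have := cancels_deg wxy hc; rewrite dv LE; dlra.
(* The equality is [two_max] used both ways, [deg z + D x y] being bounded by either side. *)
split=> //; apply/eqP; rewrite eq_le.
have wzy : wedge y z != 0 by apply: contraTneq k1 => e; rewrite (wedgeC z y) e oppr0 fdeg0 -ltNge; dlra.
have wzx : wedge x z != 0 by apply: contraTneq k2 => e; rewrite (wedgeC z x) e oppr0 fdeg0 -ltNge; dlra.
have Dzy : D z y = D y z by rewrite wedgeC fdegN.
have Dzx : D z x = D x z by rewrite wedgeC fdegN.
have Dyx : D y x = D x y by rewrite wedgeC fdegN.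
by apply/andP; split; apply: two_max => //; rewrite ?Dyx ?Dzx; dlra.
Qed.

Lemma wedge_sq v h : wedge (v ^+ 2) h = (v *+ 2) *: wedge v h.
Proof. by rewrite expr2 wedgeM -scalerDl mulr2n. Qed.

(** In units where [deg x = 6] and [deg y = 4], [deg z] is above 2 and at most 3. The shift does not
    change the 2-form with [z], dominates the one with [y] through [2 z dz /\ dy], and lowers [x]
    only if [z ^+ 2] has its degree. *)
Lemma kshift_facts a (x' := x + a *: z ^+ 2) : a != 0 ->
  [/\ D x' y = deg z + D z y, D x' z = D x z, deg x' <= deg x,
      D x z <= deg x' + deg z & deg x' < deg x -> deg z *+ 2 = deg x] /\
  [/\ deg y < deg x', deg z < deg y & dist x' y z].
Proof.
move=> a0; have [k1 k2 k3 k4 k5] := kdata_facts; have [h1 h2 h3 h4 h5] := K.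
have Dzx : D z x = D x z by rewrite wedgeC fdegN.
have Dzy : D z y = D y z by rewrite wedgeC fdegN.
have u0 := deg_ge0 u; have z0 : 0 < deg z by dlra.
have zn := deg_gt0_neq0 z0.
have [x0 y0 _] := jac_deg_gt0 J.
have e1 : D x' z = D x z.
  by rewrite /x' wedgeDl wedgeZl wedge_sq wedgeff !scaler0 addr0.
have e2 : D x' y = deg z + D z y.
  have az : deg (a *: (z *+ 2)) = deg z by rewrite degZ // -mulr_natl -mpolyC_nat mul_mpolyC degZ // pnatr_eq0.
  have azn : a *: (z *+ 2) != 0 by apply: deg_gt0_neq0; rewrite az.
  have wn : wedge z y != 0.
    by apply: contraTneq k1 => e; rewrite e fdeg0 -ltNge; dlra.
  have : fdeg (wedge (a *: z ^+ 2) y) = deg z + D z y.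
    by rewrite wedgeZl wedge_sq scalerA mul_mpolyC fdegZ // az.
  by rewrite /x' wedgeDl => e3; rewrite fdegD_lt e3 //; dlra.
have dz2 : deg (a *: z ^+ 2) = deg z *+ 2 by rewrite degZ // degXn.
have le : deg x' <= deg x by apply: degD_le => //; rewrite dz2.
have e4 : D x z <= deg x' + deg z by rewrite -e1 fdeg_wedge.
have yx' : deg y < deg x' by dlra.
have zy : deg z < deg y by dlra.
split; split => //; last by split; rewrite eq_sym lt_eqF //; apply: lt_trans yx'.
move=> lt; apply/eqP; rewrite eq_le h3 leNgt /=; apply/negP => lt2.
by move: lt; rewrite /x' degD_lt_l ?dz2 // ltxx.
Qed.
End Kfacts.

Lemma fdegZC_le c (w : 'rV[P]_3) : fdeg (c%:MP *: w) <= fdeg w.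
Proof.
have [->|c0] := eqVneq c 0; first by rewrite mpolyC0 scale0r fdeg0 fdeg_ge0.
by rewrite fdegZC.
Qed.
Lemma fdeg_comb a b c (w1 w2 w3 : 'rV[P]_3) : a != 0 -> fdeg w2 < fdeg w1 ->
  fdeg w3 < fdeg w1 -> fdeg (a%:MP *: w1 + b%:MP *: w2 + c%:MP *: w3) = fdeg w1.
Proof.
move=> a0 lt2 lt3; rewrite -addrA addrC.
have lt : fdeg (b%:MP *: w2 + c%:MP *: w3) < fdeg (a%:MP *: w1).
  rewrite (fdegZC _ a0); case: (leP (fdeg w2) (fdeg w3)) => h.
    apply: le_lt_trans lt3; apply: fdegD_le; last exact: fdegZC_le.
    by apply: le_trans (fdegZC_le _ _) h.
  apply: le_lt_trans lt2; apply: fdegD_le; first exact: fdegZC_le.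
  by apply: le_trans (fdegZC_le _ _) (ltW h).
by rewrite (fdegD_lt lt) fdegZC.
Qed.

(** The coordinates of [wedge u v] are the 2 by 2 minors. If both minors involving [f] vanish and
    the third does not, [f] occurs neither in [u] nor in [v]. *)
Lemma span_wedge f g h u v : D g h < D f h -> D f h < D f g -> sp3 f g h u -> sp3 f g h v ->
  wedge u v != 0 -> [\/ D u v = D f g, D u v = D f h | D u v = D g h /\ esp2 g h u v].
Proof.
move=> lt1 lt2 [a1 [b1 [c1 [e1 E1]]]] [a2 [b2 [c2 [e2 E2]]]] w0.
have E : wedge u v = (a1 * b2 - a2 * b1)%:MP *: wedge f g +
  (a1 * c2 - a2 * c1)%:MP *: wedge f h + (b1 * c2 - b2 * c1)%:MP *: wedge g h.
  by rewrite E1 E2 wedge_sp3.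
have [A0|A0] := eqVneq (a1 * b2 - a2 * b1) 0; last first.
  by constructor 1; rewrite E fdeg_comb //; apply: lt_trans lt2.
have [B0|B0] := eqVneq (a1 * c2 - a2 * c1) 0; last first.
  constructor 2; rewrite E A0 -(@fdeg_comb (a1 * c2 - a2 * c1) (b1 * c2 - b2 * c1) 0
     (wedge f h) (wedge g h) 0) ?fdeg0 //; last by apply: le_lt_trans lt1; apply: fdeg_ge0.
  by rewrite !mpolyC0 !scale0r add0r addr0.
rewrite A0 B0 mpolyC0 !scale0r !add0r in E.
have C0 : b1 * c2 - b2 * c1 != 0.
  by apply: contraNneq w0 => C0; rewrite E C0 mpolyC0 scale0r.
have a10 : a1 = 0.
  apply: (mulIf C0); rewrite mul0r.
  have -> : a1 * (b1 * c2 - b2 * c1) = b1 * (a1 * c2 - a2 * c1) - c1 * (a1 * b2 - a2 * b1) by ring.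
  by rewrite A0 B0 !mulr0 subr0.
have a20 : a2 = 0.
  apply: (mulIf C0); rewrite mul0r.
  have -> : a2 * (b1 * c2 - b2 * c1) = b2 * (a1 * c2 - a2 * c1) - c2 * (a1 * b2 - a2 * b1) by ring.
  by rewrite A0 B0 !mulr0 subr0.
constructor 3; split; first by rewrite E fdegZC.
apply: (esp2_intro _ _ w0).1.
  by exists b1, c1, e1; rewrite E1 a10 scale0r add0r.
by exists b2, c2, e2; rewrite E2 a20 scale0r add0r.
Qed.
End Reach.

(** * The exceptional ratio of degrees 6 : 4 : 3 *)

Section ExceptionalReduction.
Variable C : numFieldType.
Local Notation P := {mpoly C[3]}.
Local Notation D f g := (fdeg (wedge f g)).
Implicit Types (f g h u v w k l j m x y z : P) (a b c e : C).

(* The statement of [reach_closed] for small sums of degrees, serving as induction hypothesis. *)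
Definition closed (nu : Gam) := forall f g h h', reach f g h ->
  deg f + deg g + deg h < nu -> alg f g (h' - h) -> reach f g h'.

Lemma closed2 nu f g h g' : closed nu -> reach f g h -> deg f + deg g + deg h < nu ->
  alg f h (g' - g) -> reach f g' h.
Proof. by move=> cl /reach132 r lt ha; apply/reach132/(cl _ _ _ _ r _ ha); dlra. Qed.
Lemma closed1 nu f g h f' : closed nu -> reach f g h -> deg f + deg g + deg h < nu ->
  alg g h (f' - f) -> reach f' g h.
Proof. by move=> cl /reach231 r lt ha; apply/reach312/(cl _ _ _ _ r _ ha); dlra. Qed.

Lemma sp3_msize f g h v : (msize f <= 2)%N -> (msize g <= 2)%N -> (msize h <= 2)%N ->
  sp3 f g h v -> (msize v <= 2)%N.
Proof.
move=> f2 g2 h2 [a [b [c [e ->]]]].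
have Z d w : (msize w <= 2)%N -> (msize (d *: w) <= 2)%N.
  exact: leq_trans (mmeasureZ_le _ _ _).
apply: leq_trans (msizeD_le _ _) _; rewrite geq_max msizeC; apply/andP; split; last by case: eqP.
apply: leq_trans (msizeD_le _ _) _; rewrite geq_max Z // andbT.
by apply: leq_trans (msizeD_le _ _) _; rewrite geq_max !Z.
Qed.
(** Both polynomials have total degree 1, so the relation of degrees reduces to [p = q]. *)
Lemma msize_ratio u v p q : (msize u <= 2)%N -> (msize v <= 2)%N -> 0 < deg u -> 0 < deg v ->
  deg u *+ p = deg v *+ q -> p = q.
Proof.
have one w : (msize w <= 2)%N -> 0 < deg w -> mdeg (mlead w) = 1%N.
  move=> w2 w0; have := w2; rewrite -mlead_deg ?deg_gt0_neq0 // ltnS => le1.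
  by apply/eqP; rewrite eqn_leq le1 lt0n mdeg_eq0 -emb_gt0 -degE.
move=> u2 v2 u0 v0; rewrite !degE -!embMn => /emb_inj/(congr1 (@mdeg 3)).
by rewrite !mdegMn !one // !mul1n.
Qed.

Lemma deg_coef f g h v a b c e : 0 < deg f -> 0 < deg g -> 0 < deg h -> dist f g h ->
  v = a *: f + b *: g + c *: h + e%:MP ->
  [/\ a != 0 -> deg f <= deg v, b != 0 -> deg g <= deg v & c != 0 -> deg h <= deg v].
Proof.
move=> f0 g0 h0 d ->; rewrite (deg_sp3 _ _ _ _ f0 g0 h0 d).
by split=> /negPf ->; rewrite !le_max lexx ?orbT.
Qed.

(** In units where [dz = 3] and [dy = 4], the bounds read [dx > 2] and [p < 6]. So [p = 2 q] exceeds
    4 and can only be [dx], while [2 q] is [2 dx], 8 or 6. *)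
Lemma no_doubling (dx dy dz p q : Gam) : dy *+ 3 = dz *+ 4 -> dz *+ 2 < dx *+ 3 -> 0 < dx ->
  0 < dz -> p < dz *+ 2 -> [\/ p = dx, p = dy | p = dz] -> [\/ q = dx, q = dy | q = dz] ->
  p = q *+ 2 -> False.
Proof. by move=> h1 h2 h3 h4 h5 [] e1 [] e2 h6; lra. Qed.

Lemma no_sum (dz dy f g h : Gam) p q : dy *+ 3 = dz *+ 4 -> dz *+ 2 < f *+ 3 ->
  dz *+ 2 < g *+ 3 -> 0 < dz -> 0 < h -> h <= dy -> f != h -> g != h -> h = f *+ p + g *+ q -> False.
Proof.
move=> h1 h2 h3 h4 h5 h6 h7 h8.
have f0 : 0 < f by lra.
have g0 : 0 < g by lra.
have nf n : 0 <= f *+ n by rewrite mulrn_wge0 // ltW.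
have ng n : 0 <= g *+ n by rewrite mulrn_wge0 // ltW.
case: p => [|[|p]]; case: q => [|[|q]]; rewrite ?mulrS ?mulr0n ?addr0 ?add0r => epq.
- by move: h5; rewrite epq ltxx.
- by rewrite epq eqxx in h8.
- by have := ng q; lra.
- by rewrite epq eqxx in h7.
- by lra.
- by have := ng q; lra.
- by have := nf p; lra.
- by have := nf p; lra.
by have := nf p; have := ng q; lra.
Qed.
Lemma no_multiple (dx dy dz p q : Gam) N : dy *+ 3 = dz *+ 4 -> dz *+ 2 < dx *+ 3 -> 0 < dx ->
  0 < dz -> p < dz *+ 2 -> dz *+ 2 < q *+ 3 -> p != q -> 0 < p -> [\/ p = dx, p = dy | p = dz] ->
  [\/ q = dx, q = dy | q = dz] -> p = q *+ N -> False.
Proof.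
move=> h1 h2 h3 h4 h5 h6 h7 h8 h9 h10.
have nq n : 0 <= q *+ n by rewrite mulrn_wge0 //; lra.
case: N => [|[|[|N]]] e.
- by move: h8; rewrite e mulr0n ltxx.
- by rewrite e eqxx in h7.
- exact: no_doubling h1 h2 h3 h4 h5 h9 h10 e.
by have := nq N; move: e; rewrite !mulrS; lra.
Qed.

Lemma degree_order (dx dy dz p q r : Gam) : dz < dy -> r < q -> q < p ->
  [\/ p = dx, p = dy | p = dz] -> [\/ q = dx, q = dy | q = dz] ->
  [\/ r = dx, r = dy | r = dz] ->
  [\/ [/\ p = dx, q = dy & r = dz], [/\ p = dy, q = dx & r = dz] | [/\ p = dy, q = dz & r = dx]].
Proof.
move=> h1 h2 h3 [] e1 [] e2 [] e3;
  by [constructor 1|constructor 2|constructor 3|exfalso; lra].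
Qed.

Lemma wedge_affine f g h a b c e (s k : C) : wedge (a *: f + b *: g + c *: h + e%:MP) (s *: f + k%:MP) =
  (- (s * b))%:MP *: wedge f g + (- (s * c))%:MP *: wedge f h + 0%:MP *: wedge g h.
Proof. by apply/rowP => i; rewrite !(mxE, wedgeE) !(ldD, ldZ, ldC) -!mul_mpolyC; ring. Qed.
Lemma wedge_quadratic x y z a b c e (d b' c' e' : C) :
  wedge (a *: x + b *: y + c *: z + d *: z ^+ 2 + e%:MP) (b' *: y + c' *: z + e'%:MP) =
  (a * b')%:MP *: wedge x y + (a * c')%:MP *: wedge x z +
  ((b * c' - c * b')%:MP *: wedge y z + (d * b')%:MP *: ((z *+ 2) *: wedge z y)).
Proof. by apply/rowP => i; rewrite !(mxE, wedgeE) !(ldD, ldZ, ldC, ldM, expr2) -!mul_mpolyC; ring. Qed.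
Lemma shift_quadratic x y z a b c e (s k t p q r m : C) :
  a *: (x + - (p *: z ^+ 2) - q *: y - r *: z - m%:MP) + b *: y + c *: z + e%:MP
    - t *: (s *: z + k%:MP) ^+ 2 =
  a *: x + (b - a * q) *: y + (c - a * r - t * s * k *+ 2) *: z + (- a * p - t * s ^+ 2) *: z ^+ 2
    + (e - a * m - t * k ^+ 2)%:MP.
Proof. by rewrite -!mul_mpolyC; ring. Qed.

Lemma fdeg_comb4 (w1 w2 w3 w4 : 'rV[P]_3) a b c (d : C) : d != 0 -> fdeg w1 < fdeg w4 ->
  fdeg w2 < fdeg w4 -> fdeg w3 < fdeg w4 ->
  fdeg (a%:MP *: w1 + b%:MP *: w2 + (c%:MP *: w3 + d%:MP *: w4)) = fdeg w4.
Proof.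
move=> d0 l1 l2 l3.
have lt (w : 'rV[P]_3) (t : C) : fdeg w < fdeg w4 -> fdeg (t%:MP *: w) < fdeg (d%:MP *: w4).
  by move=> l; rewrite (fdegZC _ d0); apply: le_lt_trans (fdegZC_le _ _) l.
have ltD (w w' : 'rV[P]_3) : fdeg w < fdeg (d%:MP *: w4) -> fdeg w' < fdeg (d%:MP *: w4) ->
    fdeg (w + w') < fdeg (d%:MP *: w4).
  move=> l l'; case: (leP (fdeg w) (fdeg w')) => le.
    by apply: le_lt_trans l'; apply: fdegD_le.
  by apply: le_lt_trans l; apply: fdegD_le => //; apply: ltW.
rewrite addrA fdegD_lt; first exact: fdegZC.
exact: (ltD _ _ (ltD _ _ (lt _ a l1) (lt _ b l2)) (lt _ c l3)).
Qed.

Lemma fdeg_comb_mid a b c (w1 w2 w3 : 'rV[P]_3) : b != 0 -> fdeg w1 < fdeg w2 ->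
  fdeg w3 < fdeg w2 -> fdeg (a%:MP *: w1 + b%:MP *: w2 + c%:MP *: w3) = fdeg w2.
Proof. by move=> b0 l1 l3; rewrite [a%:MP *: _ + _]addrC fdeg_comb. Qed.
Lemma fdeg_double z y : 0 < deg z -> wedge y z != 0 ->
  fdeg ((z *+ 2) *: wedge z y) = deg z + D y z.
Proof.
move=> z0 w0; have z2 : deg (z *+ 2) = deg z.
  by rewrite -mulr_natl -mpolyC_nat mul_mpolyC degZ // pnatr_eq0.
rewrite wedgeC scalerN fdegN fdegZ ?z2 //.
by apply: deg_gt0_neq0; rewrite z2.
Qed.

Lemma coset_scale f g h h0 h1 a : a != 0 -> sp2 f g (h0 - a *: h) -> alg f g (h0 - h1) ->
  alg f g (a^-1 *: h1 - h).
Proof.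
move=> a0 s ha; have -> : a^-1 *: h1 - h = a^-1 *: ((h0 - a *: h) - (h0 - h1)).
  have -> : h0 - a *: h - (h0 - h1) = h1 - a *: h by ring.
  by rewrite scalerBr scalerA mulVf // scale1r.
by apply: algZ; apply: algB => //; apply: sp2_alg.
Qed.

Lemma same_center_step f g h f0 g0 h0 h1 a : esp2 f g f0 g0 -> a != 0 -> sp2 f g (h0 - a *: h) ->
  reach f0 g0 h1 -> alg f0 g0 (h0 - h1) -> exists h', [/\ reach f g h', alg f g (h' - h) &
  deg h' = deg h1].
Proof.
move=> es a0 s r ha; exists (a^-1 *: h1); split; last by rewrite degZ // invr_eq0.
  apply: reach_eqv r _; apply: (@esp2_eqv _ f0 g0 f g h1 (a^-1 *: h1) a^-1).
  - exact: esp2_sym.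
  - by rewrite invr_eq0.
  - by rewrite subrr -mpolyC0; apply: sp2C.
by apply: coset_scale s _ => //; apply/(esp2_alg _ es).
Qed.

(** Here [(x1, y, z)] comes from an exceptional step out of [(X, g0, u)]. Undoing it must lead back
    to the plane of [x] and [y], since in any other position [D X g0] would be at least [D y z]. So
    [u], rescaled, is the required reduction of [z]. *)
Lemma exceptional_step_K x y z x1 f0 g0 h0 X u a c c1 c2 e :
  deg x = deg z *+ 2 -> deg y *+ 3 = deg z *+ 4 -> deg x1 < deg x -> wedge x y != 0 ->
  jac x1 y z != 0 -> dist x1 y z ->
  x1 = x + - (c *: z ^+ 2) - c1 *: y - c2 *: z - e%:MP ->
  D x y < D y z -> deg z < D y z -> D y z < D x z -> D x1 z = D x z -> D x z < D x1 y ->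
  D x1 y = deg z + D y z -> eqv x1 y z f0 g0 h0 -> a != 0 -> f0 = X + a *: h0 ^+ 2 ->
  reach X g0 u -> kdata X g0 h0 u ->
  exists u, [/\ reach x y u, alg x y (u - z) & deg u + deg y < deg x + D x y].
Proof.
move=> e2 e34 lt1 wxy J1 dd x1E lxy lz lyz' D1z lxz' D1y E a0 EX rX kX.
have [px1 py pz] := jac_deg_gt0 J1.
have [w1y w1z wyz _] := jac_neq0 J1.
have lyz := ltW lyz'; have lxz := lt_trans lxy lyz'.
have Dzy : D z y = D y z by rewrite wedgeC fdegN.
have zy : deg z < deg y by dlra.
have l1 : D y z < D x1 z by rewrite D1z.
have l2 : D x1 z < D x1 y by rewrite D1z.
have J0 := eqv_jac E J1; have [pf0 pg0 ph0] := jac_deg_gt0 J0.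
have [wfg0 wfh0 wgh0 _] := jac_neq0 J0.
have [[s1 s2 s3] [t1 t2 t3]] := E.
have kf := kdata_facts (reach_jac rX) kX.
have ks := kshift_facts (reach_jac rX) kX a0; rewrite -EX in ks.
have [k1 k2 k3 k4 k5] := kf.
have [[q1 q2 q3 q4 q5] [hg hh _]] := ks; have [aXu eX hX uX uX2] := kX.
have inn v : sp3 x1 y z v -> 0 < deg v ->
    [\/ deg v = deg x1, deg v = deg y | deg v = deg z].
  exact: deg_in3.
have cs := degree_order zy hh hg (inn _ s1 pf0) (inn _ s2 pg0) (inn _ s3 ph0).
have [a1 [b1 [t1' [r1' E1]]]] := s1.
have [a2 [b2 [t2' [r2' E2]]]] := s2.
have [a3 [b3 [t3' [r3' E3]]]] := s3.
have [A1 B1 _] := deg_coef px1 py pz dd E1.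
have [A2 B2 C2] := deg_coef px1 py pz dd E2.
have [A3 B3 C3] := deg_coef px1 py pz dd E3.
have zero (t : C) (Q : Prop) : ~ Q -> (t != 0 -> Q) -> t = 0.
  by move=> nQ hQ; apply/eqP/negPn/negP => /hQ.
have nle (p q : Gam) : p < q -> ~ (q <= p) by move=> lt; rewrite leNgt lt.
case: cs => [[ef eg eh]|[ef eg eh]|[ef eg eh]]; last 2 first.
- exfalso; have [lt|le] := ltP (deg f0) (deg X).
    by have := q5 lt; dlra.
  by dlra.
- exfalso.
  have b30 : b3 = 0 by apply: zero B3; apply: nle; dlra.
  have t30 : t3' = 0 by apply: zero C3; apply: nle; dlra.
  have lefg : D f0 g0 <= D x1 y.
    by case: (span_wedge l1 l2 s1 s2 wfg0) => [->|->|[-> _]] //; dlra.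
  suff : D f0 h0 = D x1 y by dlra.
  have a30 : a3 != 0.
    apply: contraTneq ph0 => a30.
    by rewrite E3 a30 b30 t30 !scale0r !add0r degC ltxx.
  have b10 : b1 != 0.
    apply/eqP => b10; suff : deg f0 < deg f0 by rewrite ltxx.
    rewrite {1}E1 b10 scale0r addr0 degDC ef.
    apply: degD_ltr; first by apply: le_lt_trans (degZ_le _ _) _; dlra.
    by apply: le_lt_trans (degZ_le _ _) _; dlra.
  have E3' : h0 = a3 *: x1 + r3'%:MP by rewrite E3 b30 t30 !scale0r !addr0.
  have W : wedge f0 h0 = (- (a3 * b1))%:MP *: wedge x1 y + (- (a3 * t1'))%:MP *: wedge x1 z + 0%:MP *: wedge y z.
    by rewrite E1 E3' wedge_affine.
  by rewrite W fdeg_comb ?oppr_eq0 ?mulf_neq0 //; dlra.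
clear k1 k2 k4 q1 q2 q3 q4 q5 hX l1 l2 pf0 lt1.
have a20 : a2 = 0 by apply: zero A2; apply: nle; dlra.
have a30 : a3 = 0 by apply: zero A3; apply: nle; dlra.
have b30 : b3 = 0 by apply: zero B3; apply: nle; dlra.
have b20 : b2 != 0.
  apply/eqP => b20; suff : deg g0 < deg g0 by rewrite ltxx.
  rewrite {1}E2 a20 b20 !scale0r !add0r degDC eg.
  by apply: le_lt_trans (degZ_le _ _) _; dlra.
have s0 : t3' != 0.
  apply: contraTneq ph0 => s0.
  by rewrite E3 a30 b30 s0 !scale0r !add0r degC ltxx.
(* The coefficients of [y], [z], [z ^+ 2] and 1 in [f0 - a *: h0 ^+ 2], once [x1] is expressed
   through [x]. *)
pose be := b1 - a1 * c1; pose ga := t1' - a1 * c2 - a * t3' * r3' *+ 2.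
pose de := - a1 * c - a * t3' ^+ 2; pose ep := r1' - a1 * e - a * r3' ^+ 2.
have EX' : X = a1 *: x + be *: y + ga *: z + de *: z ^+ 2 + ep%:MP.
  have -> : X = f0 - a *: h0 ^+ 2 by rewrite EX addrK.
  have -> : h0 = t3' *: z + r3'%:MP by rewrite E3 a30 b30 !scale0r !add0r.
  by rewrite E1 {1}x1E; apply: shift_quadratic.
have Eg : g0 = b2 *: y + t2' *: z + r2'%:MP by rewrite E2 a20 scale0r add0r.
have W : wedge X g0 = (a1 * b2)%:MP *: wedge x y + (a1 * t2')%:MP *: wedge x z +
  ((be * t2' - ga * b2)%:MP *: wedge y z + (de * b2)%:MP *: ((z *+ 2) *: wedge z y)).
  rewrite Eg EX'; exact: wedge_quadratic.
clearbody be ga de ep.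
(* In units where [deg z = 3], one has [deg X = 6] and [deg g0 = 4], so [D X g0 <= 1]. This kills in
   turn [de], [t2'] and [ga], each of which would produce a larger 2-form. *)
have lfg : D X g0 < D y z by dlra.
have a10 : a1 != 0.
  apply/eqP => a10; suff : deg f0 < deg f0 by rewrite ltxx.
  rewrite {1}E1 a10 scale0r add0r degDC ef.
  apply: degD_ltr; first by apply: le_lt_trans (degZ_le _ _) _; dlra.
  by apply: le_lt_trans (degZ_le _ _) _; dlra.
have de0 : de = 0.
  apply/eqP/negPn/negP => de0; suff : deg z + D y z <= D X g0 by dlra.
  have E' := fdeg_double pz wyz.
  rewrite W -E' fdeg_comb4; [dlra|exact: mulf_neq0|dlra|dlra|dlra].
rewrite de0 mul0r mpolyC0 scale0r addr0 in W.
have t20 : t2' = 0.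
  apply/eqP/negPn/negP => t20; suff e' : D X g0 = D x z by move: lfg; rewrite e' ltNge lyz.
  rewrite W; apply: fdeg_comb_mid lxz lyz'; exact: mulf_neq0.
rewrite t20 !mulr0 sub0r mpolyC0 scale0r addr0 in W.
have ga0 : ga = 0.
  apply/eqP/negPn/negP => ga0; suff e' : D X g0 = D y z by move: lfg; rewrite e' ltxx.
  have gb : - (ga * b2) != 0 by rewrite oppr_eq0; exact: mulf_neq0.
  rewrite W fdegD_lt; rewrite (fdegZC _ gb) //.
  exact: le_lt_trans (fdegZC_le _ _) lxy.
rewrite ga0 mul0r oppr0 mpolyC0 scale0r addr0 in W.
have DX : D X g0 = D x y.
  by rewrite W fdegZC; [|exact: mulf_neq0].
have wXg : wedge X g0 != 0.
  by apply: contraTneq k5 => ->; rewrite fdeg0 ltxx.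
have es : esp2 x y X g0.
  apply: (esp2_intro _ _ wXg).1.
    by exists a1, be, ep; rewrite EX' de0 ga0 !scale0r !addr0.
  by exists 0, b2, r2'; rewrite Eg t20 !scale0r add0r addr0.
exists (t3'^-1 *: u); have s0V : t3'^-1 != 0 by rewrite invr_eq0.
have hz : sp2 x y (h0 - t3' *: z).
  by exists 0, 0, r3'; rewrite E3 a30 b30 !scale0r !add0r addrAC subrr add0r.
have ax : alg x y (h0 - u) by apply/(esp2_alg _ es).
split.
- apply: reach_eqv rX _; apply: (@esp2_eqv _ X g0 x y u (t3'^-1 *: u) t3'^-1) => //.
    exact: esp2_sym.
  by rewrite subrr -mpolyC0; apply: sp2C.
- exact: coset_scale s0 hz ax.
rewrite degZ // -DX; move: uX2; rewrite eg.
have -> : deg X = deg x by dlra.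
by [].
Qed.
(* The exceptional configuration of degrees [6 : 4 : 3]: a reduction of [x] by [z ^+ 2] forces
   a reduction of [z] by a cancellation between [x ^+ 2] and [y ^+ 3]. *)
Lemma exceptional_reduction nu x y z x' : closed nu -> reach x' y z -> alg y z (x' - x) ->
  deg x' < deg x -> deg x' + deg y + deg z < nu ->
  deg x *+ 2 = deg y *+ 3 -> deg x = deg z *+ 2 -> D x y *+ 6 <= deg x -> deg z < D y z ->
  exists u, [/\ reach x y u, alg x y (u - z) & deg u + deg y < deg x + D x y].
Proof.
move=> cl r' al' lt' lnu' e23 e2 Dle Dgt.
have [x1 [al1 m1]] := exists_minimal y z x'.
have le1 : deg x1 <= deg x'.
  have -> : x' = x1 + - (x1 - x') by ring.
  by apply: m1; apply: algN.
have r1 : reach x1 y z by apply: closed1 cl r' lnu' al1.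
have al : alg y z (x - x1).
  have -> : x - x1 = - ((x' - x) + (x1 - x')) by ring.
  by apply: algN; apply: algD.
have lt1 : deg x1 < deg x by dlra.
have J1 := reach_jac r1; have [px1 py pz] := jac_deg_gt0 J1.
have [w1y w1z wyz _] := jac_neq0 J1.
have J : jac x y z != 0.
  rewrite (jac_rot x y z) (jac_alg_coset (h' := x1)) //.
  by rewrite -(jac_rot x1 y z).
have [wxy wxz _ _] := jac_neq0 J.
have Dzy : D z y = D y z by rewrite wedgeC fdegN.
have Dyx : D y x = D x y by rewrite wedgeC fdegN.
have Dzx : D z x = D x z by rewrite wedgeC fdegN.
have Dxy0 := fdeg_wedge_gt0 wxy.
have dchi : deg (x - x1) = deg x by rewrite degD_lt_l ?degN.
have e34 : deg y *+ 3 = deg z *+ 4 by rewrite -e23 e2 -mulrnA.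
(* In units where [deg z = 3] and [deg y = 4], the difference has degree 6: without cancellation
   only 1, [z], [z ^+ 2] and [y] fit, and a cancellation would require [12 + D y z <= 6 + 4 + 3],
   against [D y z > 3]. *)
have [c [c1 [c2 [e Ex]]]] : exists c c1 c2 e,
    x = x1 + (c *: z ^+ 2 + c1 *: y + c2 *: z + e%:MP).
  have [[hQ _]|[N []]|[L hc]] := alg_dich al py pz wyz.
  - have [|||c [c1 [c2 [e E]]]] := hQ (fun v => exists c c1 c2 e,
       v = c *: z ^+ 2 + c1 *: y + c2 *: z + e%:MP).
    + by exists 0, 0, 0, 0; rewrite !scale0r mpolyC0 !addr0.
    + move=> u w [c [c1 [c2 [e ->]]]] [d [d1 [d2 [d3 ->]]]].
      exists (c + d), (c1 + d1), (c2 + d2), (e + d3).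
      by rewrite !scalerDl mpolyCD; ring.
    + move=> t [|[|p]] [|[|[|q]]]; rewrite dchi => le.
      * by exists 0, 0, 0, t; rewrite !scale0r !add0r !expr0 mulr1 alg_mpolyC.
      * by exists 0, 0, t, 0; rewrite !scale0r mpolyC0 !add0r addr0 expr0 expr1 mul1r.
      * by exists t, 0, 0, 0; rewrite !scale0r mpolyC0 !addr0 expr0 mul1r.
      * exfalso; move: le; rewrite !mulrS.
        by have : 0 <= deg z *+ q; [rewrite mulrn_wge0 // ltW|dlra].
      * by exists 0, t, 0, 0; rewrite !scale0r mpolyC0 !addr0 add0r expr0 expr1 mulr1.
      * by exfalso; dlra.
      * by exfalso; dlra.
      * exfalso; move: le; rewrite !mulrS.
        by have : 0 <= deg z *+ q; [rewrite mulrn_wge0 // ltW|dlra].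
      * exfalso; move: le; rewrite !mulrS.
        by have : 0 <= deg y *+ p; [rewrite mulrn_wge0 // ltW|dlra].
      * exfalso; move: le; rewrite !mulrS.
        by have : 0 <= deg y *+ p; [rewrite mulrn_wge0 // ltW|dlra].
      * exfalso; move: le; rewrite !mulrS.
        by have : 0 <= deg y *+ p; [rewrite mulrn_wge0 // ltW|dlra].
      * exfalso; move: le; rewrite !mulrS.
        have : 0 <= deg y *+ p by rewrite mulrn_wge0 // ltW.
        by have : 0 <= deg z *+ q; [rewrite mulrn_wge0 // ltW|dlra].
    by exists c, c1, c2, e; rewrite -E addrC subrK.
  - move=> E; move: e34; rewrite E -mulrnA => /mulrIn; rewrite gt_eqF // => /(_ isT).
    by clear; lia.
  - move=> E; move: e34; rewrite E -mulrnA => /mulrIn; rewrite gt_eqF // => /(_ isT).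
    by clear; lia.
  exfalso; have LE : L = deg y *+ 3.
    by apply: nonres_ratio e34 => //; case: hc => ? [? []].
  by have := cancels_deg wyz hc; rewrite dchi LE; dlra.
have yx : deg y < deg x by dlra.
have zx : deg z < deg x by dlra.
have zy : deg z < deg y by dlra.
have c0 : c != 0.
  apply/eqP => c0; suff : deg x < deg x by rewrite ltxx.
  rewrite {1}Ex c0 scale0r add0r addrA degDC.
  apply: degD_ltr => //; apply: degD_ltr.
    by apply: le_lt_trans (degZ_le _ _) _.
  by apply: le_lt_trans (degZ_le _ _) _.
have Dxz0 := fdeg_ge0 (wedge x z).
have Dxz : D x z = D y z + deg x - deg y.
  apply/eqP; rewrite eq_le; apply/andP; split.
    have : deg y + D x z <= deg x + D y z; last by dlra.
    by apply: two_max => //; rewrite ?Dyx ?Dzx; dlra.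
  have : deg x + D y z <= deg y + D x z; last by dlra.
  by apply: two_max => //; rewrite ?Dyx ?Dzx; dlra.
have lyz' : D y z < D x z by dlra.
have lyz : D y z <= D x z := ltW lyz'.
have lxy : D x y < D y z by dlra.
have lxz : D x y < D x z := lt_le_trans lxy lyz.
have x1E : x1 = x + - (c *: z ^+ 2) - c1 *: y - c2 *: z - e%:MP by rewrite Ex; ring.
have D1z : D x1 z = D x z.
  have -> : wedge x1 z = (- c1)%:MP *: wedge y z + wedge x z.
    rewrite x1E !wedgeDl !wedgeNl !wedgeZl wedge_sq wedgeff wedgeCl !scaler0 !oppr0 !addr0.
    by rewrite mpolyCN scaleNr addrC.
  by rewrite fdegD_lt //; apply: le_lt_trans (fdegZC_le _ _) _; dlra.
have D1y : D x1 y = deg z + D y z.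
  have E : wedge x1 y = (wedge x y + (- c2)%:MP *: wedge z y) + (- c)%:MP *: ((z *+ 2) *: wedge z y).
    rewrite x1E !wedgeDl !wedgeNl !wedgeZl wedge_sq wedgeff wedgeCl !scaler0 !oppr0 !addr0.
    by rewrite !mpolyCN !scaleNr addrAC.
  have z2 : deg (z *+ 2) = deg z.
    by rewrite -mulr_natl -mpolyC_nat mul_mpolyC degZ // pnatr_eq0.
  have E2 : fdeg ((- c)%:MP *: ((z *+ 2) *: wedge z y)) = deg z + D y z.
    rewrite fdegZC ?oppr_eq0 // fdegZ ?z2 ?Dzy //; last by rewrite wedgeC oppr_eq0.
    by apply: deg_gt0_neq0; rewrite z2.
  rewrite E fdegD_lt E2 //.
  apply: (@le_lt_trans _ _ (Num.max (D x y) (D y z))).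
    apply: fdegD_le; rewrite le_max ?lexx //.
    by rewrite -Dzy fdegZC_le orbT.
  by rewrite gt_max; apply/andP; split; dlra.
have d2 : deg z *+ 2 < deg x1 *+ 3.
  by have := fdeg_wedge x1 z; rewrite D1z; dlra.
have mnc p q : deg y *+ p + deg z *+ q != deg x1 by apply: minimal_nc.
have dz : deg x1 != deg z by have := mnc 0%N 1%N; rewrite mulr0n add0r eq_sym.
have dy : deg x1 != deg y by have := mnc 1%N 0%N; rewrite mulr0n addr0 eq_sym.
have dd : dist x1 y z by split => //; rewrite eq_sym lt_eqF.
(* The ratio 4 : 3 of [deg y] and [deg z] rules out an affine triple, and an elementary last step
   contradicts the degrees; so the last step is exceptional. *)
have [f0 [g0 [h0 [E S]]]] := reach_inv r1.
have J0 := eqv_jac E J1; have [pf0 pg0 ph0] := jac_deg_gt0 J0.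
have [wfg0 wfh0 wgh0 _] := jac_neq0 J0.
have [[s1 s2 s3] [t1 t2 t3]] := E.
case: S => [mf mg mh|h1 rh ah dh lth|X u a a0 EX rX kX].
- exfalso; have y2 : (msize y <= 2)%N by apply: sp3_msize t2.
  have z2 : (msize z <= 2)%N by apply: sp3_msize t3.
  by have := msize_ratio y2 z2 py pz e34.
- clear lnu' lt' le1 Dzy Dyx Dzx Dxy0 dchi e23 Dxz0 lyz lxy lxz Dle.
  exfalso; have inn v : sp3 x1 y z v -> 0 < deg v ->
      [\/ deg v = deg x1, deg v = deg y | deg v = deg z].
    exact: deg_in3.
  have [fg0 fh0 gh0] := dh.
  have dv : deg (h0 - h1) = deg h0 by rewrite degD_lt_l ?degN.
  have bd v : sp3 x1 y z v -> 0 < deg v -> deg z *+ 2 < deg v *+ 3 /\ deg v < deg z *+ 2.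
    have d3 : deg x1 < deg z *+ 2 by rewrite -e2.
    by move=> /inn hv /hv {hv} hv; move: e34 d2 d3 pz hv; clear; move=> ? ? ? ? [] ->; split; lra.
  have [bf1 bf2] := bd _ s1 pf0; have [bg1 bg2] := bd _ s2 pg0; have [bh1 bh2] := bd _ s3 ph0.
  (* Otherwise undoing the step would lower [x1] over [y] and [z], where it is minimal. *)
  have same : ~ esp2 y z f0 g0.
    move=> es; have Jy : jac y z x1 != 0 by rewrite -(jac_rot x1 y z).
    have dy' : dist y z x1 by case: dd => *; split; rewrite eq_sym // eq_sym.
    have Ey : eqv y z x1 f0 g0 h0.
      apply: eqv_trans E; split; split;
        first [apply: sp31|apply: sp32|apply: sp33].
    have [dh0 [t t0 st]] := esp2_coset Jy dy' dh Ey es.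
    have [h' [_ ah' dh']] := same_center_step es t0 st rh ah.
    by have := m1 _ ah'; rewrite addrC subrK dh'; dlra.
  have Dbig : D x1 z <= D f0 g0.
    have l1 : D y z < D x1 z by dlra.
    have l2 : D x1 z < D x1 y by dlra.
    by case: (span_wedge l1 l2 s1 s2 wfg0) => [->|->|[_ /same//]] //; dlra.
  have key : deg h0 <= deg y \/ (deg h0 = deg x1 /\
      (deg f0 = deg y /\ deg g0 = deg z \/ deg f0 = deg z /\ deg g0 = deg y)).
    case: (inn _ s3 ph0) => eh; [right|left; rewrite eh|left; rewrite eh; dlra]; last by [].
    split=> //; move: fg0 fh0 gh0; rewrite eh.
    case: (inn _ s1 pf0) => ->; case: (inn _ s2 pg0) => ->; rewrite ?eqxx //; by [left|right].
  have [[_ [|p [q]]]|[N []]|[L hc]] := alg_dich ah pf0 pg0 wfg0.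
  + by rewrite dv.
  + rewrite dv => epq; case: key => [ly|[eh [[ef eg]|[ef eg]]]]; last 2 first.
    * by have := mnc p q; rewrite -ef -eg epq eh eqxx.
    * by have := mnc q p; rewrite -ef -eg addrC epq eh eqxx.
    exact: no_sum e34 bf1 bg1 pz ph0 ly fh0 gh0 (esym epq).
  + by move=> eN; apply: no_multiple e34 d2 px1 pz bf2 bg1 fg0 pf0 (inn _ s1 pf0) (inn _ s2 pg0) eN.
  + move=> eN; apply: no_multiple e34 d2 px1 pz bg2 bf1 _ pg0 (inn _ s2 pg0) (inn _ s1 pf0) eN.
    by rewrite eq_sym.
  have [_ [_ [nr _ _ _ _]]] := hc; have [b1 b2 b3] := nonres_bounds pf0 pg0 nr.
  have cd := cancels_deg wfg0 hc; rewrite dv in cd.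
  by case: key => [ly|[eh [[ef eg]|[ef eg]]]]; dlra.
apply: (exceptional_step_K e2 e34 lt1 wxy J1 dd x1E lxy Dgt lyz' D1z _ D1y E a0 EX rX kX).
by dlra.
Qed.
End ExceptionalReduction.

(** * The last step seen from one component, and lower bounds for minimal ones *)

Section Views.
Variable C : numFieldType.
Local Notation P := {mpoly C[3]}.
Local Notation D f g := (fdeg (wedge f g)).
Implicit Types (f g h u v w k l j m x y z : P) (a b c e : C).

(* How [(k, l, j)] was reached, in terms of the line [k] modulo the plane [l, j]. *)
Variant view k l j : Prop :=
| ViewBase of (msize k <= 2)%N & (msize l <= 2)%N & (msize j <= 2)%N
| ViewK f g h x u a of eqv k l j f g h & a != 0 & f = x + a *: h ^+ 2 &
    reach x g u & kdata x g h u
| ViewSame k' of reach k' l j & alg l j (k' - k) & deg k' < deg k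
| ViewSide k1 l1 j1 l2 t of dist k1 l1 j1 & reach k1 l1 j1 & esp2 l j l1 j1 &
    deg k1 = deg k & t != 0 & sp2 l1 j1 (k1 - t *: k) & deg l1 + deg j1 = deg l + deg j &
    reach k1 l2 j1 & alg k1 j1 (l2 - l1) & deg l2 < deg l1
| ViewSum k1 l1 j1 k2 t of dist k1 l1 j1 & deg k1 < deg l1 & reach k1 l1 j1 &
    esp2 l j l1 j1 & deg k1 = deg k & t != 0 & sp2 l1 j1 (k1 - t *: k) &
    deg l1 + deg j1 = deg l + deg j &
    reach k2 (l1 + k1) j1 & alg (l1 + k1) j1 (k2 - k1) & deg k2 < deg k1.

Lemma coset_inv f g h k a : a != 0 -> sp2 f g (h - a *: k) -> sp2 f g (k - a^-1 *: h).
Proof.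
move=> a0 s; have -> : k - a^-1 *: h = (- a^-1) *: (h - a *: k); last exact: sp2Z.
by rewrite scalerBr scalerA mulNr mulVf // scaleNr scaleN1r opprK addrC.
Qed.

Lemma reach_view k l j : reach k l j -> dist k l j -> view k l j.
Proof.
move=> r [kl kj lj]; have J := reach_jac (reach231 r).
have dlj : dist l j k by split; rewrite // eq_sym.
have [f [g [h [E S]]]] := reach_inv r.
have E' : eqv l j k f g h.
  by apply: eqv_trans E; split; split; first [apply: sp31|apply: sp32|apply: sp33].
case: S => [mf mg mh|h1 rh ah dh lth|X u a a0 EX rX kX]; last exact: ViewK E a0 EX rX kX.
  by have [_ [t1 t2 t3]] := E; apply: ViewBase; [apply: sp3_msize t1|apply: sp3_msize t2|apply: sp3_msize t3].
have [es ekh [a a0 s]|K L Jj d es1 es2 [eL eK] es [a a0 s] [b b0 s']|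
      K m Jj d lt es1 es2 [em em'] es [a a0 s] [b b0 s']] := centers J dlj dh E'.
- have [h' [rk ak dk]] := same_center_step es a0 s rh ah.
  apply: (@ViewSame _ _ _ h') => //; first exact: reach312.
  by rewrite dk -ekh.
- have [h' [rk ak dk]] := same_center_step (esp2_sym es2) (invr_neq0 b0) (coset_inv b0 s') rh ah.
  have [d1 d2 d3] := d.
  apply: (@ViewSide _ _ _ L K Jj h' a) => //.
  + by split; rewrite // eq_sym.
  + by apply: reach312; apply: reach_eqv (reach231 r) _; apply: (esp2_eqv es1 a0 ((coset_esp2 _ es1).2 s)).
  + by move: es eL; clear; move=> ? ?; lra.
  + exact: reach132.
  by rewrite dk eK.
have [h' [rk ak dk]] := same_center_step (esp2_sym es2) (invr_neq0 b0) (coset_inv b0 s') rh ah.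
have [d1 d2 d3] := d.
apply: (@ViewSum _ _ _ m K Jj h' a) => //.
- by split; rewrite // eq_sym.
- by apply: reach312; apply: reach_eqv (reach231 r) _; apply: (esp2_eqv es1 a0 ((coset_esp2 _ es1).2 s)).
- by move: es em; clear; move=> ? ?; lra.
- exact: reach312.
by rewrite dk em'.
Qed.

(** Since [z ^+ 2] has the degree of [x], [x] can be lowered over [y] and [z]. If the bound failed,
    [exceptional_reduction] would then lower [z] over [x] and [y]. *)
Lemma exceptional_minimal nu x y z : closed C nu -> reach x y z -> deg x + deg y + deg z < nu ->
  deg x *+ 2 = deg y *+ 3 -> deg x = deg z *+ 2 -> D x y *+ 6 <= deg x -> minimal x y z ->
  D y z <= deg z.
Proof.
move=> cl r lt e23 e2 Dle m; rewrite leNgt; apply/negP => Dgt.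
have [x0 y0 z0] := jac_deg_gt0 (reach_jac r).
have [x1 [al1 m1]] := exists_minimal y z x.
have le1 : deg x1 <= deg x.
  have -> : x = x1 + - (x1 - x) by ring.
  by apply: m1; apply: algN.
have r1 : reach x1 y z by apply: closed1 cl r lt al1.
have lt1 : deg x1 < deg x.
  rewrite lt_neqAle le1 andbT; apply/eqP => e.
  have [p1 _ _] := jac_deg_gt0 (reach_jac r1).
  by have := minimal_nc 0 2 m1 y0 z0 p1; rewrite mulr0n add0r -e2 e eqxx.
have [|u [ru au du]] := exceptional_reduction cl r1 al1 lt1 _ e23 e2 Dle Dgt; first by dlra.
have := m _ au; rewrite addrC subrK.
by dlra.
Qed.

(** The ratio 3 : 6 : 4. *)
Definition exceptional (dk dl dj : Gam) := dl *+ 2 = dj *+ 3 /\ dk *+ 2 = dl.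

(** The conclusion is the hypothesis of [cancels_wedge] for a minimal [k]. If it failed,
    [D k j <= deg k + deg j] would give the premise of the last hypothesis, and in an exceptional
    ratio [exceptional_minimal] makes the 2-form too small. *)
Lemma wedge_bound nu k l j L : closed C nu -> reach k l j -> deg k + deg l + deg j < nu ->
  nonres (deg l) (deg j) L -> minimal l j k ->
  (L + D l j <= deg k + deg l + deg j ->
    exceptional (deg k) (deg l) (deg j) \/ exceptional (deg k) (deg j) (deg l)) ->
  D k j + deg l < L + D l j.
Proof.
move=> cl r lt nr m exc; rewrite ltNge; apply/negP => Dge.
have J := reach_jac r; have [k0 l0 j0] := jac_deg_gt0 J.
have [wkl wkj wlj _] := jac_neq0 J; have Dlj := fdeg_wedge_gt0 wlj.
have bk := fdeg_wedge k j.
have [|[e1 e2]|[e1 e2]] := exc.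
- by dlra.
- have LE : L = deg l *+ 2 by apply: nonres_ratio nr _ e1.
  have rk : reach l j k by apply: reach231.
  have Dc : D j k = D k j by rewrite wedgeC fdegN.
  have := exceptional_minimal cl rk _ e1 (esym e2) _ m; rewrite Dc => H.
  have : D k j <= deg k by apply: H; dlra.
  by dlra.
have LE : L = deg j *+ 2 by apply: nonres_ratio (nonres_sym nr) _ e1.
have rk : reach j l k by apply: reach321.
have Dc : D l k = D k l by rewrite wedgeC fdegN.
have Djl : D j l = D l j by rewrite wedgeC fdegN.
have mk : minimal j l k by move=> v /alg_sym; apply: m.
have := exceptional_minimal cl rk _ e1 (esym e2) _ mk; rewrite Dc Djl => H.
have {}H : D k l <= deg k by apply: H; dlra.
suff : deg l + D k j <= deg j + deg k by dlra.
apply: two_max => //; last by rewrite Dc; dlra.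
by dlra.
Qed.

(** The sum of the degrees is the degree of the product of the leading monomials, so induction on
    monomials applies. *)
Lemma sigma_ind (Q : P -> P -> P -> Prop) :
  (forall k l j, (forall k' l' j', deg k' + deg l' + deg j' < deg k + deg l + deg j -> Q k' l' j') ->
     Q k l j) -> forall k l j, Q k l j.
Proof.
move=> IH k l j; pose T := (P * P * P)%type.
pose mu (t : T) := (mlead t.1.1 + mlead t.1.2 + mlead t.2)%MM.
have E t : emb (mu t) = deg t.1.1 + deg t.1.2 + deg t.2 by rewrite !embD !degE.
suff H t : Q t.1.1 t.1.2 t.2 by exact: (H (k, l, j)).
elim/(emb_wf_ind (mu := mu)): t => t IHt; apply: IH => k' l' j' lt.
by apply: (IHt (k', l', j')); rewrite !E.
Qed.

Lemma esp2_wedge f g f' g' : esp2 f g f' g' -> wedge f' g' != 0 -> D f' g' = D f g.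
Proof. by case=> s1 s2 _ _ w0; have [_ [c c0 ->]] := esp2_intro s1 s2 w0; rewrite fdegZC. Qed.

Lemma esp2_degs f g f' g' : esp2 f g f' g' -> wedge f g != 0 -> wedge f' g' != 0 ->
  deg f != deg g -> deg f' + deg g' = deg f + deg g ->
  deg f' = deg f /\ deg g' = deg g \/ deg f' = deg g /\ deg g' = deg f.
Proof.
move=> [s1 _ _ _] w w' ne e; have [f0 g0] := wedge_gt0 w; have [f0' g0'] := wedge_gt0 w'.
by case: (deg_in2 f0 g0 ne s1 f0') => e'; [left|right]; split=> //; move: e e'; clear; move=> ? ?; lra.
Qed.

Lemma minimal_basis k l j k1 l1 j1 t : esp2 l j l1 j1 -> t != 0 -> sp2 l1 j1 (k1 - t *: k) ->
  deg k1 = deg k -> minimal l j k -> minimal l1 j1 k1.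
Proof.
move=> es t0 s e m; apply: (@minimal_esp _ l j l1 j1 k k1 t) => //.
- by move=> v /(esp2_alg _ es).
- by apply/(esp2_alg _ es)/sp2_alg.
by rewrite e.
Qed.

Lemma minimal_dist k l j : minimal l j k -> 0 < deg k -> 0 < deg l -> 0 < deg j ->
  deg k != deg l /\ deg k != deg j.
Proof.
move=> m k0 l0 j0; have := minimal_nc 1 0 m l0 j0 k0; have := minimal_nc 0 1 m l0 j0 k0.
by rewrite !mulr0n add0r addr0 !mulr1n ![_ == deg k]eq_sym.
Qed.

Lemma nonres_neq (x y L : Gam) : 0 < x -> nonres x y L -> x != y.
Proof.
move=> x0 [p [q [pq p1 _ xp yq]]]; apply/eqP => e; move: xp; rewrite -yq -e => /mulrIn.
rewrite gt_eqF // => /(_ isT) epq.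
by move: pq p1; rewrite epq /coprime gcdnn => /eqP ->.
Qed.

Lemma nonres_resonant (x y L : Gam) : 0 < x -> 0 < y -> nonres x y L -> ~ resonant x y.
Proof.
have aux (x' y' : Gam) N : 0 < y' -> nonres x' y' L -> x' <> y' *+ N.
  move=> y0 [p [q [pq p1 q1 xp yq]]] e; move: xp; rewrite e -yq -mulrnA => /mulrIn.
  rewrite gt_eqF // => /(_ isT) epq.
  by move: pq p1; rewrite -epq coprimeMr /coprime gcdnn => /andP[_ /eqP ->].
move=> x0 y0 nr [N [e|e]]; first exact: aux y0 nr e.
exact: aux x0 (nonres_sym nr) e.
Qed.

(** The last hypothesis of [wedge_bound], isolated as a property of triples to be proved by
    induction on the sum of the degrees. *)
Definition large_exceptional nu k l j := forall L, reach k l j -> deg k + deg l + deg j < nu ->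
  nonres (deg l) (deg j) L -> minimal l j k -> L + D l j <= deg k + deg l + deg j ->
  exceptional (deg k) (deg l) (deg j) \/ exceptional (deg k) (deg j) (deg l).

(** Compare [l] with a minimal [l3] over [k] and [j]. Without cancellation, or in a resonant case,
    [nonres_num] and the minimality of [k] leave only exceptional ratios; with a cancellation, the
    induction hypothesis at [l3] makes [D l j] too large. *)
Lemma large_exceptional_side nu k l j l2 L : closed C nu ->
  (forall k' l' j', deg k' + deg l' + deg j' < deg k + deg l + deg j -> large_exceptional nu k' l' j') ->
  reach k l j -> deg k + deg l + deg j < nu -> nonres (deg l) (deg j) L -> minimal l j k ->
  L + D l j <= deg k + deg l + deg j -> reach k l2 j -> alg k j (l2 - l) -> deg l2 < deg l ->
  exceptional (deg k) (deg l) (deg j) \/ exceptional (deg k) (deg j) (deg l).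
Proof.
move=> cl IH r lt nr m big r2 al2 lt2.
have [k0 l0 j0] := jac_deg_gt0 (reach_jac r).
have [wkl wkj wlj _] := jac_neq0 (reach_jac r); have Dlj := fdeg_wedge_gt0 wlj.
have [kl kj] := minimal_dist m k0 l0 j0.
have [l3 [al3 m3]] := exists_minimal k j l2.
have le3 : deg l3 <= deg l2.
  have -> : l2 = l3 + - (l3 - l2) by ring.
  by apply: m3; apply: algN.
have r3 : reach k l3 j by apply: closed2 cl r2 _ al3; dlra.
have dphi : deg (l - l3) = deg l by rewrite degD_lt_l ?degN //; dlra.
have ap : alg k j (l - l3).
  have -> : l - l3 = - ((l2 - l) + (l3 - l2)) by ring.
  by apply: algN; apply: algD.
have [b1 b2 b3] := nonres_bounds l0 j0 nr.
have [[_ [|a [b]]]|[N [e|e]]|[L' hc]] := alg_dich ap k0 j0 wkj.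
- by rewrite dphi.
- rewrite dphi => e; case: a e => [|a] e.
    case: (nonres_resonant l0 j0 nr); exists b; left; by rewrite -e mulr0n add0r.
  have lL : L < deg k + deg l + deg j by dlra.
  have le : deg k *+ a.+1 + deg j *+ b <= deg l by rewrite e.
  have [b0 [a1|[a2 e32]]] := nonres_num l0 j0 nr lL (ltn0Sn _) le.
  + by move: kl; rewrite -e b0 a1 mulr0n addr0 eqxx.
  by left; split=> //; rewrite -e b0 a2 mulr0n addr0.
- by have := minimal_nc 0 N m l0 j0 k0; rewrite mulr0n add0r -e eqxx.
- case: N e => [|N] e; first by move: j0; rewrite e mulr0n ltxx.
  have lL : L < deg k + deg j + deg l by dlra.
  have le : deg k *+ N.+1 + deg l *+ 0 <= deg j by rewrite e mulr0n addr0.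
  have [_ [a1|[a2 e32]]] := nonres_num j0 l0 (nonres_sym nr) lL (ltn0Sn _) le.
  + by move: kj; rewrite e a1 eqxx.
  by right; split=> //; rewrite e a2.
exfalso; have nr' : nonres (deg k) (deg j) L' by case: hc => ? [? []].
have [c1 c2 c3] := nonres_bounds k0 j0 nr'.
have lt3 : deg l3 + deg k + deg j < deg k + deg l + deg j by dlra.
have r3' := reach213 r3.
have H : D l3 j + deg k < L' + D k j.
  apply: (wedge_bound cl r3' _ nr' m3); first by dlra.
  by apply: (IH l3 k j) => //; dlra.
have := cancels_wedge wkj hc H; rewrite [l3 + _]addrC subrK => H2.
by have := fdeg_ge0 (wedge k j); dlra.
Qed.

(** As [l + k] has the degree of [l], minimality of [k] and [nonres] leave only a cancellation. It
    makes [D k j] large, and [D l j] equals it, against the bound. *)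
Lemma large_exceptional_sum nu k l j k2 L : closed C nu ->
  (forall k' l' j', deg k' + deg l' + deg j' < deg k + deg l + deg j -> large_exceptional nu k' l' j') ->
  reach k l j -> deg k + deg l + deg j < nu -> nonres (deg l) (deg j) L -> minimal l j k ->
  L + D l j <= deg k + deg l + deg j -> deg k < deg l ->
  reach k2 (l + k) j -> alg (l + k) j (k2 - k) -> deg k2 < deg k -> False.
Proof.
move=> cl IH r lt nr m big lkl r2 al2 lt2.
have [k0 l0 j0] := jac_deg_gt0 (reach_jac r).
have [wkl wkj wlj _] := jac_neq0 (reach_jac r); have Dlj := fdeg_wedge_gt0 wlj.
have [_ _ wsj _] := jac_neq0 (reach_jac r2).
have ds : deg (l + k) = deg l by rewrite degD_lt_l.
have s0 : 0 < deg (l + k) by rewrite ds.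
have [k3 [al3 m3]] := exists_minimal (l + k) j k2.
have le3 : deg k3 <= deg k2.
  have -> : k2 = k3 + - (k3 - k2) by ring.
  by apply: m3; apply: algN.
have r3 : reach k3 (l + k) j by apply: closed1 cl r2 _ al3; rewrite ds; dlra.
have dphi : deg (k - k3) = deg k by rewrite degD_lt_l ?degN //; dlra.
have ap : alg (l + k) j (k - k3).
  have -> : k - k3 = - ((k2 - k) + (k3 - k2)) by ring.
  by apply: algN; apply: algD.
have [b1 b2 b3] := nonres_bounds l0 j0 nr.
have [[_ [|a [b]]]|rs|[L' hc]] := alg_dich ap s0 j0 wsj.
- by rewrite dphi.
- rewrite dphi ds => /eqP; apply/negP; exact: minimal_nc.
- by rewrite ds in rs; apply: nonres_resonant nr rs.
have nr' : nonres (deg (l + k)) (deg j) L' by case: hc => ? [? []].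
have [c1 c2 c3] := nonres_bounds s0 j0 nr'; rewrite ds in c1.
have H : D k3 j + deg (l + k) < L' + D (l + k) j.
  apply: (wedge_bound cl r3 _ nr' m3); first by rewrite ds; dlra.
  by apply: (IH k3 (l + k) j) => //; rewrite ds; dlra.
have := cancels_wedge wsj hc H; rewrite [k3 + _]addrC subrK ds => H2.
have s1 := fdeg_wedge_gt0 wsj.
suff : D l j = D k j by dlra.
have E : wedge l j = wedge (l + k) j + - wedge k j by rewrite wedgeDl addrK.
by rewrite E fdegD_lt fdegN //; dlra.
Qed.

Lemma kshift_wedges f g h x u a : a != 0 -> f = x + a *: h ^+ 2 -> reach x g u -> kdata x g h u ->
  [/\ D g h < D f h, D f h < D f g, deg x + D x g <= D g h, 0 < D x g & deg f <= deg x] /\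
  [/\ deg g < deg f, deg h < deg g & dist f g h].
Proof.
move=> a0 e r kX; have [k1 k2 k3 k4 k5] := kdata_facts (reach_jac r) kX.
have [] := kshift_facts (reach_jac r) kX a0; rewrite -e => [[q1 q2 q3 q4 q5]] [q6 q7 q8].
have [x0 g0 _] := jac_deg_gt0 (reach_jac r).
have [_ exy _ _ _] := kX; have Dgh : D g h = D h g by rewrite wedgeC fdegN.
by split; split=> //; dlra.
Qed.

Lemma kshift_plane f g h x u a v w : a != 0 -> f = x + a *: h ^+ 2 -> reach x g u ->
  kdata x g h u -> sp3 f g h v -> sp3 f g h w -> wedge v w != 0 -> deg x + D x g <= D v w.
Proof.
move=> a0 e r kX hv hw w0; have [[q1 q2 q3 q4 q5] _] := kshift_wedges a0 e r kX.
by have [->|->|[-> _]] := span_wedge q1 q2 hv hw w0; dlra.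
Qed.

Lemma kshift_deg f g h x u a v : a != 0 -> f = x + a *: h ^+ 2 -> reach x g u ->
  kdata x g h u -> sp3 f g h v -> 0 < deg v -> deg v <= deg x.
Proof.
move=> a0 e r kX hv v0; have [[q1 q2 q3 q4 q5] [p1 p2 d]] := kshift_wedges a0 e r kX.
have J : jac f g h != 0 by rewrite e; apply: reach_jac; apply: reach_K r kX.
have [f0 g0 h0] := jac_deg_gt0 J.
by have [->|->|->] := deg_in3 f0 g0 h0 d hv v0; dlra.
Qed.

(** By the view of [k]: affine triples have degrees in no ratio but 1, and after an exceptional step
    all 2-forms of the span are too large. The same center contradicts minimality, and the two other
    positions are [large_exceptional_side] and [large_exceptional_sum]. *)
Lemma large_is_exceptional nu k l j : closed C nu -> large_exceptional nu k l j.
Proof.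
move=> cl; move: k l j; apply: sigma_ind => k l j IH L r lt nr m big.
have [k0 l0 j0] := jac_deg_gt0 (reach_jac r).
have [wkl wkj wlj _] := jac_neq0 (reach_jac r); have Dlj := fdeg_wedge_gt0 wlj.
have [kl kj] := minimal_dist m k0 l0 j0; have lj := nonres_neq l0 nr.
have [_ _ b3] := nonres_bounds l0 j0 nr.
have [k2 l2 j2|f g h x u a E a0 e rx kx|k' _ ak lt'|k1 l1 j1 l2 t [k1l1 k1j1 _] r1 es ek t0 s esum r2 al2 lt2
     |k1 l1 j1 k2 t d ltk r1 es ek t0 s esum r2 ak2 lt2] := reach_view r (And3 kl kj lj).
- have [p [q [pq p1 _ xp yq]]] := nr; rewrite -yq in xp.
  have epq := msize_ratio l2 j2 l0 j0 xp.
  by move: pq p1; rewrite epq /coprime gcdnn => /eqP ->.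
- have [_ [t1 t2 t3]] := E.
  have := kshift_plane a0 e rx kx t2 t3 wlj; have := kshift_deg a0 e rx kx t1 k0.
  by have := fdeg_ge0 (wedge x g); dlra.
- by have := m _ ak; rewrite addrC subrK; dlra.
- have [_ _ w1 _] := jac_neq0 (reach_jac r1).
  have IH' k' l' j' : deg k' + deg l' + deg j' < deg k1 + deg l1 + deg j1 ->
      large_exceptional nu k' l' j' by move=> lt'; apply: IH; dlra.
  have m1 := minimal_basis es t0 s ek m; have eD := esp2_wedge es w1.
  have dd := esp2_degs es wlj w1 lj esum.
  have nr1 : nonres (deg l1) (deg j1) L.
    by case: dd => -[-> ->] //; apply: nonres_sym.
  have lt1 : deg k1 + deg l1 + deg j1 < nu by dlra.
  have big1 : L + D l1 j1 <= deg k1 + deg l1 + deg j1 by dlra.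
  have := large_exceptional_side cl IH' r1 lt1 nr1 m1 big1 r2 al2 lt2.
  by rewrite ek; case: dd => -[-> ->] // [h|h]; [right|left].
have [_ _ w1 _] := jac_neq0 (reach_jac r1).
have IH' k' l' j' : deg k' + deg l' + deg j' < deg k1 + deg l1 + deg j1 ->
    large_exceptional nu k' l' j' by move=> lt'; apply: IH; dlra.
have m1 := minimal_basis es t0 s ek m; have eD := esp2_wedge es w1.
have dd := esp2_degs es wlj w1 lj esum.
have nr1 : nonres (deg l1) (deg j1) L.
  by case: dd => -[-> ->] //; apply: nonres_sym.
have lt1 : deg k1 + deg l1 + deg j1 < nu by dlra.
have big1 : L + D l1 j1 <= deg k1 + deg l1 + deg j1 by dlra.
by case: (large_exceptional_sum cl IH' r1 lt1 nr1 m1 big1 ltk r2 ak2 lt2).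
Qed.

Lemma wedge_min nu k l j L : closed C nu -> reach k l j -> deg k + deg l + deg j < nu ->
  nonres (deg l) (deg j) L -> minimal l j k -> D k j + deg l < L + D l j.
Proof.
move=> cl r lt nr m; apply: (wedge_bound cl r lt nr m) => big.
exact: large_is_exceptional cl L r lt nr m big.
Qed.
End Views.

(** * Closure under elementary changes *)

Section Peaks.
Variable C : numFieldType.
Local Notation P := {mpoly C[3]}.
Local Notation D f g := (fdeg (wedge f g)).
Implicit Types (f g h u v w k l j m x y z : P) (a b c e : C).

Lemma alg_selfr k j v : alg j j v -> alg k j v.
Proof. by apply: alg_sub; apply: algr. Qed.
Lemma alg_selfl k j v : alg j j v -> alg j k v.
Proof. by apply: alg_sub; apply: algl. Qed.
Lemma alg_subC f g u v : alg f g (u - v) -> alg f g (v - u).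
Proof. by move/algN; rewrite opprB. Qed.
Lemma alg_trans f g u v w : alg f g (u - v) -> alg f g (v - w) -> alg f g (u - w).
Proof. by move=> h1 h2; have := algD h1 h2; rewrite addrA subrK. Qed.
(** Shifting [j] by a polynomial in [k] does not change the subalgebra; this is how two changes are
    commuted below. *)
Lemma alg_baser k j v w : alg k k v -> alg k j w -> alg k (j + v) w.
Proof.
move=> hv; apply: alg_sub; first exact: algl.
have := algB (algr k (j + v)) (alg_selfl (j + v) hv); by rewrite addrK.
Qed.
Lemma alg_basel k j v w : alg j j v -> alg k j w -> alg (k + v) j w.
Proof. by move=> hv /alg_sym h; apply/alg_sym/alg_baser. Qed.

Lemma pow_cancel k j N : 0 < deg k -> 0 < deg j -> deg j = deg k *+ N ->
  exists2 c : C, c != 0 & deg (j - c *: k ^+ N) < deg j.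
Proof.
move=> k0 j0 e; have E : deg j = deg (k ^+ N) by rewrite degXn ?deg_gt0_neq0.
have [|c c0 lt] := @deg_sub_lt _ j (k ^+ N) _ E; first by rewrite -E.
by exists c; rewrite // E.
Qed.

Lemma alg_pow k c N : alg k k (- (c *: k ^+ N)).
Proof. by apply: algN; apply: algZ; apply: algX; apply: algl. Qed.

(* A peak of the sum of degrees, to be bypassed on the way from [(k2, l, j)] to [(k, l', j)]. *)
Definition side_peak nu k l j k2 l' :=
  [/\ closed C nu, reach k l j, reach k2 l j, alg l j (k2 - k) & deg k2 < deg k] /\
  [/\ alg k j (l' - l), deg l' <= deg l & deg k + deg l + deg j = nu].

(** A change by a polynomial in [j] alone commutes with the other one, and the fourth corner
    [(k2, l', j)] of the square lies below the peak. *)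
Lemma side_peak_square nu k l j k2 l' : side_peak nu k l j k2 l' ->
  alg j j (k - k2) \/ alg j j (l' - l) -> reach k l' j.
Proof.
move=> [[cl r r2 a2 lt2] [al le' enu]] [] h; have h' := alg_subC h; last first.
  have r3 : reach k2 l' j by apply: closed2 cl r2 _ _; [dlra|exact: alg_selfr].
  apply: closed1 cl r3 _ _; first by dlra.
  have -> : l' = l + (l' - l) by ring.
  by apply: alg_basel; [|apply: alg_subC].
have r3 : reach k2 l' j.
  apply: closed2 cl r2 _ _; first by dlra.
  have -> : k2 = k + (k2 - k) by ring.
  exact: alg_basel.
apply: closed1 cl r3 _ _; first by dlra.
exact: alg_selfr.
Qed.

(** A power of [j] lowers [k] to some [y], and [(y, l, j)], [(y, l', j)] lead around the peak. *)
Lemma side_peak_multiple_kj nu k l j k2 l' N : side_peak nu k l j k2 l' -> deg k = deg j *+ N -> reach k l' j.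
Proof.
move=> [[cl r r2 a2 lt2] [al le' enu]] e; have [k0 l0 j0] := jac_deg_gt0 (reach_jac r).
have [c c0 lt] := pow_cancel j0 k0 e; set y := k - _ in lt.
have aj : alg j j (y - k) by rewrite /y addrAC subrr add0r; apply: alg_pow.
have ry : reach y l j.
  apply: closed1 cl r2 _ _; first by dlra.
  by apply: alg_trans (alg_selfr l aj) _; apply: alg_subC.
have ry' : reach y l' j.
  apply: closed2 cl ry _ _; first by dlra.
  have -> : y = k + (y - k) by ring.
  exact: alg_basel.
apply: closed1 cl ry' _ _; first by dlra.
by apply/alg_selfr/alg_subC.
Qed.

Lemma side_peak_multiple_lj nu k l j k2 l' N : side_peak nu k l j k2 l' -> deg l = deg j *+ N ->
  reach k l' j.
Proof.
move=> [[cl r r2 a2 lt2] [al le' enu]] e; have [k0 l0 j0] := jac_deg_gt0 (reach_jac r).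
have [c c0 lt] := pow_cancel j0 l0 e; set y := l - _ in lt.
have aj : alg j j (y - l) by rewrite /y addrAC subrr add0r; apply: alg_pow.
have ry : reach k y j.
  apply: (@side_peak_square nu k l j k2); last by right.
  by split; split=> //; [exact: alg_selfr|exact: ltW].
apply: closed2 cl ry _ _; first by dlra.
by apply: alg_trans al _; apply/alg_selfr/alg_subC.
Qed.

(* The Jacobian of [(v, l, j)] is the multiple [u * jac k l j] of that of [(k, l, j)], with
   [deg k <= deg u]. *)
Lemma cancels_jac L k j l v : cancels L k j v -> 0 < deg k -> 0 < deg j -> jac k l j != 0 ->
  deg k < D l j + deg v.
Proof.
move=> [u [w [nr hu hw _ hJ]]] k0 j0 J.
have [b1 _ _] := nonres_bounds k0 j0 nr.
have [_ _ _ J0] := jac_neq0 J.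
have u0 : u != 0 by apply: contraTneq hu => ->; rewrite deg0 -ltNge; dlra.
have := deg_jac v l j; rewrite hJ (jac_rot j l j) (jac_rot l j j) jac_ff mulr0 addr0.
by rewrite degM //; dlra.
Qed.

(** A power of [k] lowers [j] to some [y]. As [k - k2] is a polynomial in [l], this is also a change
    over [k2] and [l], so it can be made first, below the peak. *)
Lemma side_peak_multiple_jk nu k l j k2 l' N : side_peak nu k l j k2 l' -> deg j = deg k *+ N ->
  alg l l (k - k2) -> reach k l' j.
Proof.
move=> [[cl r r2 a2 lt2] [al le' enu]] e sl; have [k0 l0 j0] := jac_deg_gt0 (reach_jac r).
have [c c0 lt] := pow_cancel k0 j0 e; set y := j - _ in lt.
have aj : alg k k (y - j) by rewrite /y addrAC subrr add0r; apply: alg_pow.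
have r3 : reach k2 l y.
  apply: (cl _ _ _ _ r2); first by dlra.
  have -> : k2 = k + (k2 - k) by ring.
  by apply: alg_basel; [exact: alg_subC|exact: alg_selfl].
have r4 : reach k l y.
  apply: (closed1 cl r3); first by dlra.
  exact: alg_selfl.
have r5 : reach k l' y.
  apply: (closed2 cl r4); first by dlra.
  have -> : y = j + (y - j) by ring.
  exact: alg_baser.
apply: (cl _ _ _ _ r5); first by dlra.
by apply/alg_selfl/alg_subC.
Qed.

Lemma nc_self f g v : nc f g v -> deg v < deg f -> alg g g v.
Proof.
move=> [h _] lt; apply: h => [|u w|t [|a] b le]; first exact: alg0.
- exact: algD.
- by apply: algZ; rewrite expr0 mul1r; apply/algX/algl.
have : 0 <= deg g *+ b by rewrite mulrn_wge0 // deg_ge0.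
have : 0 <= deg f *+ a by rewrite mulrn_wge0 // deg_ge0.
by move: le; rewrite mulrS => *; exfalso; dlra.
Qed.

Lemma resonant_ge2 (x y : Gam) N : 0 < x -> x != y -> x = y *+ N -> (1 < N)%N.
Proof. by case: N => [|[|N]] // x0 ne e; [rewrite e mulr0n ltxx in x0|rewrite e eqxx in ne]. Qed.

Lemma resonant_lt (x y : Gam) N : 0 < x -> 0 < y -> x != y -> x = y *+ N -> y < x.
Proof.
move=> x0 y0 ne e; have := resonant_ge2 x0 ne e; case: N e => [|[|N]] // -> _.
by rewrite !mulrS; have : 0 <= y *+ N; [rewrite mulrn_wge0 // ltW|lra].
Qed.

(** Now [deg k] is the degree of a monomial in [l] and [j]. If the change of [l] involves a
    cancellation, [nonres_num] forces [deg k : deg j : deg l = 6 : 4 : 3], and the way around goes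
    through the triple of [exceptional_reduction]. Otherwise the changes commute or a power lowers a
    component. *)
Lemma side_peak_nc nu k l j k2 l' : side_peak nu k l j k2 l' -> dist k l j ->
  nc l j (k - k2) -> reach k l' j.
Proof.
move=> H [kl kj lj] hn; have [[cl r r2 a2 lt2] [al le' enu]] := H.
have [k0 l0 j0] := jac_deg_gt0 (reach_jac r); have [_ wkj _ _] := jac_neq0 (reach_jac r).
have dphi : deg (k - k2) = deg k by rewrite degD_lt_l ?degN.
have dpsi : deg (l' - l) <= deg l by apply: degB_le.
have [lkl|llk] := ltP (deg k) (deg l).
  by apply: (side_peak_square H); left; apply: nc_self hn _; rewrite dphi.
have {}llk : deg l < deg k by rewrite lt_neqAle eq_sym kl.
have [hp|[N [e|e]]|[L hc]] := alg_dich al k0 j0 wkj.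
- by apply: (side_peak_square H); right; apply: nc_self hp _; apply: le_lt_trans dpsi _.
- exact: (side_peak_multiple_kj H e).
- apply: (side_peak_multiple_jk H e); apply: (nc_self (nc_sym hn)); rewrite dphi.
  by apply: resonant_lt e; rewrite // eq_sym.
have cd := cancels_deg wkj hc; have D0 := fdeg_wedge_gt0 wkj.
have nr : nonres (deg k) (deg j) L by case: hc => ? [? []].
have [_ [|a [b e]]] := hn; first by rewrite dphi.
case: a e => [|a]; rewrite dphi => e.
  case: (nonres_resonant k0 j0 nr); exists b; left; by rewrite -e mulr0n add0r.
have lL : L < deg l + deg k + deg j by dlra.
have le : deg l *+ a.+1 + deg j *+ b <= deg k by rewrite e.
have [b0 [a1|[a2' e32]]] := nonres_num k0 j0 nr lL (ltn0Sn _) le.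
  by move: kl; rewrite -e b0 a1 mulr0n addr0 eqxx.
have e2 : deg k = deg l *+ 2 by rewrite -e b0 a2' mulr0n addr0.
have LE : L = deg k *+ 2 by apply: nonres_ratio nr _ e32.
have r2' : reach k2 j l := reach132 r2.
have Djl : D j l = D l j by rewrite wedgeC fdegN.
have H1 := cancels_jac hc k0 j0 (reach_jac r).
have s1 : deg k2 + deg j + deg l < nu by dlra.
(* In units where [deg k = 6], the cancellation gives [12 + D k j <= 3 + 6 + 4]. *)
have s2 : D k j *+ 6 <= deg k by dlra.
have s3 : deg l < D j l by dlra.
have [u [ru au du]] := exceptional_reduction cl r2' (alg_sym a2) lt2 s1 e32 e2 s2 s3.
apply: (closed2 cl (reach132 ru)); first by dlra.
by apply: alg_trans al _; apply: alg_subC.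
Qed.

(** A power of [l] lowers [j] without disturbing the change of [k], which leads to [(k, l, y)] below
    the peak. Only a cancellation in the change of [l] obstructs the rest, and it again leads to the
    exceptional ratio. *)
Lemma side_peak_multiple_jl nu k l j k2 l' N : side_peak nu k l j k2 l' -> dist k l j ->
  deg j = deg l *+ N -> reach k l' j.
Proof.
move=> H [kl kj lj] e; have [[cl r r2 a2 lt2] [al le' enu]] := H.
have [k0 l0 j0] := jac_deg_gt0 (reach_jac r); have [_ wkj _ _] := jac_neq0 (reach_jac r).
have dpsi : deg (l' - l) <= deg l by apply: degB_le.
have jl : deg l < deg j by apply: resonant_lt e; rewrite // eq_sym.
have [c c0 lt] := pow_cancel l0 j0 e; set y := j - _ in lt.
have aj : alg l l (y - j) by rewrite /y addrAC subrr add0r; apply: alg_pow.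
have r3 : reach k2 l y.
  apply: (cl _ _ _ _ r2); first by dlra.
  exact: alg_selfr.
have r4 : reach k l y.
  apply: (closed1 cl r3); first by dlra.
  have -> : y = j + (y - j) by ring.
  by apply: alg_baser aj _; apply: alg_subC.
have [hp|[N' [e'|e']]|[L hc]] := alg_dich al k0 j0 wkj.
- have hk : alg k k (l' - l).
    by apply: nc_self (nc_sym hp) _; apply: le_lt_trans dpsi _.
  have r5 : reach k l' y.
    by apply: (closed2 cl r4); [dlra|exact: alg_selfl].
  apply: (cl _ _ _ _ r5); first by dlra.
  have -> : l' = l + (l' - l) by ring.
  by apply: alg_baser hk _; apply/alg_selfr/alg_subC.
- exact: (side_peak_multiple_kj H e').
- have [c' c0' ltz] := pow_cancel k0 j0 e'; set z := j - _ in ltz.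
  have az : alg k k (z - j) by rewrite /z addrAC subrr add0r; apply: alg_pow.
  have r5 : reach k l z.
    apply: (cl _ _ _ _ r4); first by dlra.
    apply: alg_trans (alg_selfl l az) _; apply: alg_selfr; exact: alg_subC.
  have r6 : reach k l' z.
    apply: (closed2 cl r5); first by dlra.
    have -> : z = j + (z - j) by ring.
    exact: alg_baser.
  apply: (cl _ _ _ _ r6); first by dlra.
  by apply/alg_selfl/alg_subC.
have cd := cancels_deg wkj hc; have D0 := fdeg_wedge_gt0 wkj.
have nr : nonres (deg k) (deg j) L by case: hc => ? [? []].
have N2 : (1 < N)%N by apply: resonant_ge2 e; rewrite // eq_sym.
have lL : L < deg l + deg j + deg k by dlra.
have le : deg l *+ N + deg k *+ 0 <= deg j by rewrite e mulr0n addr0.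
have [_ [a1|[a2' e32]]] := nonres_num j0 k0 (nonres_sym nr) lL (ltnW N2) le.
  by rewrite a1 in N2.
have e2 : deg j = deg l *+ 2 by rewrite e a2'.
have LE : L = deg j *+ 2 by apply: nonres_ratio (nonres_sym nr) _ e32.
have H1 := cancels_jac (cancels_sym hc) j0 k0 (reach_jac (reach321 r)).
have Dlk : D l k = D k l by rewrite wedgeC fdegN.
have Djk : D j k = D k j by rewrite wedgeC fdegN.
have ay : alg k l (y - j) by apply: alg_selfr.
have s1 : deg y + deg k + deg l < nu by dlra.
have s2 : D j k *+ 6 <= deg j by dlra.
have s3 : deg l < D k l by dlra.
have [u [ru au du]] := exceptional_reduction cl (reach312 r4) ay lt s1 e32 e2 s2 s3.
apply: (closed2 cl (reach231 ru)); first by dlra.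
by apply: alg_trans al _; apply: alg_subC; apply: alg_sym.
Qed.

Lemma reach_sp2 f g h h' : reach f g h -> sp2 f g (h' - h) -> reach f g h'.
Proof.
move=> r s; apply: (reach_eqv r); apply: (@esp2_eqv _ f g f g h h' 1); last by rewrite scale1r.
  by split; first [apply: sp2l|apply: sp2r].
exact: oner_neq0.
Qed.

(** This is the last condition of [kdata l j k k2]. If it failed, the degrees of [k2], [l], [j]
    would be exceptional, which the ratio 3 : 2 and [deg k2 < deg k <= deg l / 2] exclude. *)
Lemma minimal_small nu k k2 l j L : closed C nu -> reach k2 l j -> deg k2 + deg l + deg j < nu ->
  minimal l j k2 -> nonres (deg l) (deg j) L -> deg l *+ 2 = deg j *+ 3 ->
  deg k *+ 2 <= deg l -> deg k2 < deg k -> deg k2 + deg j < deg l + D l j.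
Proof.
move=> cl r lt m nr e le lt2; have [k0 l0 j0] := jac_deg_gt0 (reach_jac r).
have LE : L = deg l *+ 2 by apply: nonres_ratio nr _ e.
rewrite ltNge; apply/negP => ge.
have big : L + D l j <= deg k2 + deg l + deg j by dlra.
by have [[e1 e2]|[e1 e2]] := large_is_exceptional cl r lt nr m big; dlra.
Qed.

(** By [nonres_num], the change of [l] involves [k] linearly, or through [k ^+ 2] when
    [2 deg l = 3 deg j]; the square is supplied by [reach_K], as it is for [j] when [deg j] is a
    multiple of [deg k]. A cancellation in [k] and [j] is excluded by the size of [D k j] given by
    [wedge_min]. *)
Lemma side_peak_cancels nu k l j k2 l' L : side_peak nu k l j k2 l' -> dist k l j ->
  minimal l j k2 -> cancels L l j (k - k2) -> reach k l' j.
Proof.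
move=> H [kl kj lj] m hn; have [[cl r r2 a2 lt2] [al le' enu]] := H.
have [k0 l0 j0] := jac_deg_gt0 (reach_jac r); have [_ wkj wlj _] := jac_neq0 (reach_jac r).
have dphi : deg (k - k2) = deg k by rewrite degD_lt_l ?degN.
have dpsi : deg (l' - l) <= deg l by apply: degB_le.
have nr : nonres (deg l) (deg j) L by case: hn => ? [? []].
have [b1 b2 b3] := nonres_bounds l0 j0 nr.
have cd := cancels_deg wlj hn; rewrite dphi in cd; have D0 := fdeg_wedge_gt0 wlj.
have lt : deg k2 + deg l + deg j < nu by dlra.
have wm := wedge_min cl r2 lt nr m.
have Dkj := cancels_wedge wlj hn wm; rewrite [k2 + _]addrC subrK in Dkj.
have lL : L < deg k + deg l + deg j by dlra.
have [hp|[N [e|e]]|[L' hc]] := alg_dich al k0 j0 wkj.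
- have mono (a b : nat) : deg k *+ a.+1 + deg j *+ b <= deg (l' - l) ->
      b = 0%N /\ (a.+1 = 1%N \/ a.+1 = 2%N /\ deg l *+ 2 = deg j *+ 3).
    by move=> le; apply: (nonres_num l0 j0 nr lL (ltn0Sn a)); apply: le_trans le dpsi.
  have [/andP[/eqP e32 kl2]|ne] := boolP ((deg l *+ 2 == deg j *+ 3) && (deg k *+ 2 <= deg l)).
    have [a [be [ga [de E]]]] : exists (a be ga de : C),
        l' - l = a *: k ^+ 2 + be *: k + ga *: j + de%:MP.
      have [h _] := hp; apply: (h (fun v => exists (a be ga de : C), 
        v = a *: k ^+ 2 + be *: k + ga *: j + de%:MP)).
      + by exists 0, 0, 0, 0; rewrite !scale0r mpolyC0 !addr0.
      + move=> u w [a [b [c [d ->]]]] [a' [b' [c' [d' ->]]]].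
        by exists (a + a'), (b + b'), (c + c'), (d + d'); rewrite !scalerDl mpolyCD; ring.
      move=> t [|a] b le; last first.
        case: (mono _ _ le) => -> []; last case; move=> -> *.
          by exists 0, t, 0, 0; rewrite !scale0r mpolyC0 add0r !addr0 expr0 expr1 mulr1.
        by exists t, 0, 0, 0; rewrite !scale0r mpolyC0 !addr0 expr0 mulr1.
      case: b le => [|[|b]] le.
      * by exists 0, 0, 0, t; rewrite !scale0r !add0r !expr0 mulr1 alg_mpolyC.
      * by exists 0, 0, t, 0; rewrite !scale0r mpolyC0 !add0r addr0 expr0 expr1 mul1r.
      exfalso; move: le; rewrite !mulrS.
      by have : 0 <= deg j *+ b; [rewrite mulrn_wge0 // ltW|dlra].
    have ms := minimal_small cl r2 lt m nr e32 kl2 lt2.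
    have K : kdata l j k k2 by split=> //; apply: alg_subC.
    have rK := reach_K a (reach231 r2) K.
    apply: reach231; apply: (reach_sp2 (reach231 rK)); exists ga, be, de.
    by rewrite opprD addrA E; ring.
  have [lkl|llk] := ltP (deg k) (deg l); last first.
    apply: (side_peak_square H); right; apply: (nc_self hp).
    by apply: le_lt_trans dpsi _; rewrite lt_neqAle eq_sym kl.
  have [be [chi [E hchi]]] : exists (be : C) chi, l' - l = be *: k + chi /\ alg j j chi.
    have [h _] := hp; apply: (h (fun v => exists (be : C) chi, v = be *: k + chi /\ alg j j chi)).
    + by exists 0, 0; rewrite scale0r addr0; split=> //; apply: alg0.
    + move=> u w [a [x [-> hx]]] [a' [x' [-> hx']]]; exists (a + a'), (x + x').
      by split; [rewrite scalerDl addrACA|apply: algD].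
    move=> t [|a] b le; last first.
      case: (mono _ _ le) => b0 []; last case; move=> a1 *.
        by exists t, 0; rewrite b0 a1 expr0 expr1 mulr1 addr0; split=> //; apply: alg0.
      move: ne le; rewrite b0 a1 mulr0n addr0 => ne le; case/andP: ne; split; first exact/eqP.
      exact: le_trans le dpsi.
    exists 0, (t *: j ^+ b); rewrite scale0r add0r expr0 mul1r; split=> //.
    by apply/algZ/algX/algl.
  have E2 : l' - be *: k - l = chi by rewrite addrAC E addrC addKr.
  have r3 : reach k (l' - be *: k) j.
    apply: (@side_peak_square nu k l j k2); last by right; rewrite E2.
    split; split=> //; first by rewrite E2; apply: alg_selfr.
    by apply: degB_le => //; apply: le_trans (degZ_le _ _) (ltW lkl).
  apply: reach132; apply: (reach_sp2 (reach132 r3)).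
  by exists be, 0, 0; rewrite opprB addrC subrK scale0r mpolyC0 !addr0.
- exact: (side_peak_multiple_kj H e).
- have N2 : (1 < N)%N by apply: resonant_ge2 e; rewrite // eq_sym.
  have lL' : L < deg k + deg j + deg l by dlra.
  have le : deg k *+ N + deg l *+ 0 <= deg j by rewrite e mulr0n addr0.
  have [_ [a1|[a2' e32]]] := nonres_num j0 l0 (nonres_sym nr) lL' (ltnW N2) le.
    by rewrite a1 in N2.
  rewrite a2' in e.
  have [c c0 ltj] := pow_cancel k0 j0 e; set y := j - _ in ltj.
  have aj : alg k k (y - j) by rewrite /y addrAC subrr add0r; apply: alg_pow.
  have m' : minimal j l k2 by move=> v /alg_sym; apply: m.
  have lt' : deg k2 + deg j + deg l < nu by dlra.
  have le2 : deg k *+ 2 <= deg j by rewrite e.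
  have ms := minimal_small cl (reach132 r2) lt' m' (nonres_sym nr) e32 le2 lt2.
  have K : kdata j l k k2 by split=> //; apply/alg_sym/alg_subC.
  have rK := reach_K (- c) (reach321 r2) K.
  have ry : reach k l y by apply: reach321; rewrite /y -scaleNr.
  have ry' : reach k l' y.
    apply: (closed2 cl ry); first by dlra.
    have -> : y = j + (y - j) by ring.
    exact: alg_baser.
  apply: (cl _ _ _ _ ry'); first by dlra.
  by apply/alg_selfl/alg_subC.
have cd' := cancels_deg wkj hc.
have nr' : nonres (deg k) (deg j) L' by case: hc => ? [? []].
by have [_ _ b3'] := nonres_bounds k0 j0 nr'; dlra.
Qed.

Lemma reduce_minimal nu f g h h2 : closed C nu -> reach f g h2 -> deg f + deg g + deg h <= nu ->
  alg f g (h2 - h) -> deg h2 < deg h ->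
  exists h3, [/\ reach f g h3, alg f g (h3 - h), deg h3 < deg h, minimal f g h3 &
    deg (h - h3) = deg h].
Proof.
move=> cl r le a2 lt; have [h3 [a3 m3]] := exists_minimal f g h2.
have le3 : deg h3 <= deg h2.
  have -> : h2 = h3 + - (h3 - h2) by ring.
  by apply: m3; apply: algN.
have lt3 : deg h3 < deg h by apply: le_lt_trans lt.
exists h3; split=> //; last by rewrite degD_lt_l ?degN.
  by apply: (cl _ _ _ _ r) => //; dlra.
exact: alg_trans a3 a2.
Qed.

Lemma side_peak_closed nu k l j k2 l' : side_peak nu k l j k2 l' -> dist k l j -> reach k l' j.
Proof.
move=> [[cl r r2 a2 lt2] [al le' enu]] d.
have [k0 l0 j0] := jac_deg_gt0 (reach_jac r); have [_ _ wlj _] := jac_neq0 (reach_jac r).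
have le : deg l + deg j + deg k <= nu by dlra.
have [k3 [r3 a3 lt3 m3 dphi]] := reduce_minimal cl (reach231 r2) le a2 lt2.
have H : side_peak nu k l j k3 l' by split; split=> //; apply: reach312.
have [hn|[N [e|e]]|[L hc]] := alg_dich (alg_subC a3) l0 j0 wlj.
- exact: side_peak_nc H d hn.
- exact: side_peak_multiple_lj H e.
- exact: side_peak_multiple_jl H d e.
exact: side_peak_cancels H d m3 hc.
Qed.

(** Changes in [j] alone commute with the passage from [k + g] to [k], and resonances are lowered by
    powers. If leading terms cancel in [g - h], then [D g j], and with it [D k j], is so large that
    the change to [g'] has no cancellation and is in [j] alone. *)
Lemma sum_peak_closed nu k g j g2 g' : closed C nu -> reach g k j -> reach g2 (k + g) j ->
  alg (k + g) j (g2 - g) -> deg g2 < deg g -> dist k g j -> deg g < deg k ->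
  alg k j (g' - g) -> deg g' <= deg g -> deg k + deg g + deg j = nu -> reach g' k j.
Proof.
move=> cl r rb ab ltb [kg kj gj] gk al le' enu.
have [g0 k0 j0] := jac_deg_gt0 (reach_jac r); have [wgk wgj wkj _] := jac_neq0 (reach_jac r).
have [_ _ wsj _] := jac_neq0 (reach_jac rb).
pose s := k + g; have ds : deg s = deg k by rewrite degD_lt_l.
have s0 : 0 < deg s by rewrite ds.
have le : deg s + deg j + deg g <= nu by rewrite ds; dlra.
have [h [rh ah lth mh dphi]] := reduce_minimal cl (reach231 rb) le ab ltb.
have {}rh : reach h s j by apply: reach312.
have dpsi : deg (g' - g) <= deg g by apply: degB_le.
have kE : k = s - g by rewrite /s addrK.
have lt1 : deg h + deg s + deg j < nu by rewrite ds; dlra.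
have [hn|[N [e|e]]|[L hc]] := alg_dich (alg_subC ah) s0 j0 wsj.
- have hj : alg j j (g - h) by apply: nc_self hn _; rewrite dphi ds.
  have rk : reach h k j.
    apply: (closed2 cl rh lt1).
    have -> : k - s = - ((g - h) + h) by rewrite kE; ring.
    by apply: algN; apply: algD; [exact: alg_selfr|exact: algl].
  apply: (closed1 cl rk); first by dlra.
  by apply: alg_trans al _; apply: alg_selfr.
- have [c c0 lt2] := pow_cancel j0 s0 e; set y := s - _ in lt2; rewrite ds in lt2.
  have aj : alg j j (y - s) by rewrite /y addrAC subrr add0r; apply: alg_pow.
  have r1 : reach h y j by apply: (closed2 cl rh lt1); apply: alg_selfr.
  have r2 : reach g y j.
    apply: (closed1 cl r1); first by dlra.
    have -> : y = s + (y - s) by ring.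
    by apply: alg_basel; [|apply: alg_subC].
  pose z := y - g; have dz : deg z < deg k by rewrite /z; apply: degD_ltr; rewrite ?degN.
  have r3 : reach g z j.
    apply: (closed2 cl r2); first by dlra.
    by rewrite /z addrAC subrr add0r; apply/algN/algl.
  have zk : z - k = y - s by rewrite /z kE; ring.
  have r4 : reach g' z j.
    apply: (closed1 cl r3); first by dlra.
    have -> : z = k + (y - s) by rewrite -zk; ring.
    exact: alg_basel.
  apply: (closed2 cl r4); first by dlra.
  by apply/alg_selfr/alg_subC; rewrite zk.
- have [c c0 lt2] := pow_cancel s0 j0 e; set y := j - _ in lt2.
  have as' : alg s s (y - j) by rewrite /y addrAC subrr add0r; apply: alg_pow.
  have [|c' c0' lt3] := @pow_cancel k j N k0 j0; first by rewrite e ds.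
  set z := j - _ in lt3.
  have ak : alg k k (z - j) by rewrite /z addrAC subrr add0r; apply: alg_pow.
  have r1 : reach h s y.
    by apply: (cl _ _ _ _ rh lt1); apply: alg_selfr.
  have r2 : reach g s y.
    apply: (closed1 cl r1); first by dlra.
    have -> : y = j + (y - j) by ring.
    by apply: alg_baser; [|apply: alg_subC].
  have r3 : reach g k y.
    apply: (closed2 cl r2); first by dlra.
    have -> : k - s = - g by rewrite kE; ring.
    by apply/algN/algl.
  have r4 : reach g k z.
    apply: (cl _ _ _ _ r3); first by dlra.
    apply: alg_trans (alg_selfr g ak) _; apply: alg_subC.
    apply: (@alg_sub _ s s); last exact: as'.
      by rewrite /s; apply: algD; [apply: algr|apply: algl].
    by rewrite /s; apply: algD; [apply: algr|apply: algl].
  have r5 : reach g' k z.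
    apply: (closed1 cl r4); first by dlra.
    have -> : z = j + (z - j) by ring.
    exact: alg_baser.
  apply: (cl _ _ _ _ r5); first by dlra.
  by apply/alg_selfr/alg_subC.
have nr : nonres (deg s) (deg j) L by case: hc => ? [? []].
have wm := wedge_min cl rh lt1 nr mh.
have Dgj := cancels_wedge wsj hc wm; rewrite [h + _]addrC subrK in Dgj.
have [b1 b2 b3] := nonres_bounds s0 j0 nr; rewrite ds in b1 b2 b3 Dgj.
have D0 := fdeg_wedge_gt0 wsj; rewrite -/s in D0 Dgj.
have Dkj : D k j = D g j.
  have -> : wedge k j = wedge s j + - wedge g j by rewrite wedgeDl addrK.
  by rewrite fdegD_lt fdegN //; dlra.
have [hp|rs|[L' hc']] := alg_dich al k0 j0 wkj.
- have hj : alg j j (g' - g) by apply: nc_self hp _; apply: le_lt_trans dpsi _.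
  pose s' := k + g'; have ds' : deg s' = deg k.
    by rewrite degD_lt_l //; apply: le_lt_trans gk.
  have s's : s' - s = g' - g by rewrite /s' /s; ring.
  have r1 : reach h s' j.
    by apply: (closed2 cl rh lt1); rewrite s's; apply: alg_selfr.
  have r2 : reach g' s' j.
    apply: (closed1 cl r1); first by rewrite ds'; dlra.
    apply: (alg_trans (alg_selfr s' hj)).
    have -> : s' = s + (g' - g) by rewrite -s's; ring.
    by apply: alg_basel; [|apply: alg_subC].
  apply: reach132; apply: (reach_sp2 (reach132 r2)).
  have -> : k - s' = - g' by rewrite /s'; ring.
  by apply/sp2N/sp2l.
- by rewrite -ds in rs; case: (nonres_resonant s0 j0 nr).
have cd := cancels_deg wkj hc'.
have nr' : nonres (deg k) (deg j) L' by case: hc' => ? [? []].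
by have [_ _ b3'] := nonres_bounds k0 j0 nr'; dlra.
Qed.
End Peaks.

(** * Changes after an exceptional step, and the main induction *)

Section Closure.
Variable C : numFieldType.
Local Notation P := {mpoly C[3]}.
Local Notation D f g := (fdeg (wedge f g)).
Implicit Types (f g h u v w k l j m x y z : P) (a b c e : C).

Lemma reach_unit f g h h' a : reach f g h -> a != 0 -> sp2 f g (h' - a *: h) -> reach f g h'.
Proof.
move=> r a0 s; apply: (reach_eqv r); apply: (esp2_eqv _ a0 s).
by split; first [apply: sp2l|apply: sp2r].
Qed.

Lemma reach_triangular f g h a b c e b' c' e' (c'' e'' : C) : reach f g h ->
  a != 0 -> b' != 0 -> c'' != 0 ->
  reach (a *: f + b *: g + c *: h + e%:MP) (b' *: g + c' *: h + e'%:MP) (c'' *: h + e''%:MP).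
Proof.
move=> r a0 b0 c0; set A := a *: f + _ + _ + _; set B := b' *: g + _ + _; set H := c'' *: h + _.
have r1 : reach f g H.
  by apply: (reach_unit r c0); exists 0, 0, e''; rewrite !scale0r !add0r addrC addKr.
have r2 : reach f H B.
  apply: (reach_unit (reach132 r1) b0); exists 0, (c' / c''), (e' - c' / c'' * e'').
  rewrite scale0r add0r scalerDr scalerA divfK // -!mul_mpolyC !mpolyCB !mpolyCM /B -!mul_mpolyC; ring.
have r3 : reach B H A.
  apply: (reach_unit (reach321 r2) a0).
  exists (b / b'), ((c - b / b' * c') / c''), (e - b / b' * e' - (c - b / b' * c') / c'' * e'').
  rewrite /A /B /H !scalerDr !scalerA !divfK // scalerBl -!mul_mpolyC !mpolyCB !mpolyCM; ring.
exact: reach312.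
Qed.

Lemma adjust1 h f : 0 < deg f -> exists t : C,
  [/\ deg (h - t *: f) != deg f, deg (h - t *: f) <= deg h & deg h != deg f -> t = 0].
Proof.
move=> f0; have [e|ne] := eqVneq (deg h) (deg f); last by exists 0; rewrite scale0r subr0.
by have [t _ lt] := deg_sub_lt f0 e; exists t; rewrite (lt_eqF lt) e (ltW lt).
Qed.

Lemma adjust_lt h f g : 0 < deg g -> deg g < deg f -> exists h',
  [/\ sp2 f g (h - h'), deg h' <= deg h, deg h' != deg f & deg h' != deg g].
Proof.
move=> g0 lt; have f0 : 0 < deg f by apply: lt_trans lt.
have [t [n1 l1 z1]] := adjust1 h f0; set h1 := h - _ in n1 l1 z1.
have [s [n2 l2 z2]] := adjust1 h1 g0; exists (h1 - s *: g); split=> //.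
- exists t, s, 0; rewrite /h1 mpolyC0; ring.
- exact: le_trans l1.
have [e|ne] := eqVneq (deg h1) (deg g); last by rewrite (z2 ne) scale0r subr0.
by apply/eqP => e'; move: l2; rewrite e' e leNgt lt.
Qed.

Lemma adjust h f g : 0 < deg f -> 0 < deg g -> deg f != deg g -> exists h',
  [/\ sp2 f g (h - h'), deg h' <= deg h, deg h' != deg f & deg h' != deg g].
Proof.
move=> f0 g0; rewrite neq_lt => /orP[lt|lt]; last exact: adjust_lt.
have [h' [s l n1 n2]] := adjust_lt h f0 lt; exists h'; split=> //.
by apply: sp2_trans s; [apply: sp2r|apply: sp2l].
Qed.

Lemma kshift_nums f g h x u a : a != 0 -> f = x + a *: h ^+ 2 -> reach x g u -> kdata x g h u ->
  [/\ 0 < D x g, deg x *+ 2 = deg g *+ 3, deg x + D x g <= deg h + deg g, deg h *+ 2 <= deg x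
    & deg f <= deg x] /\ deg g *+ 2 + D x g <= deg f + deg h.
Proof.
move=> a0 e r kX; have [k1 k2 k3 k4 k5] := kdata_facts (reach_jac r) kX.
have [] := kshift_facts (reach_jac r) kX a0; rewrite -e => [[q1 q2 q3 q4 q5] _].
have [_ exy le _ _] := kX; have Dgh : D x h = D h x by rewrite wedgeC fdegN.
by split; [split|dlra].
Qed.

(* Which monomials in two components fit below the third one, in units where
   [deg x = 6] and [deg g = 4]. *)
Lemma kshift_monomials_top (d X g h f : Gam) (a b : nat) : 0 < d -> X *+ 2 = g *+ 3 -> X + d <= h + g ->
  h *+ 2 <= X -> f <= X -> g *+ a + h *+ b <= f ->
  [\/ a = 0%N /\ b = 0%N, a = 0%N /\ b = 1%N, a = 0%N /\ b = 2%N | a = 1%N /\ b = 0%N].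
Proof.
move=> h1 h2 h3 h4 h5 le.
have g0 n : 0 <= g *+ n by rewrite mulrn_wge0 //; lra.
have h0 n : 0 <= h *+ n by rewrite mulrn_wge0 //; lra.
case: a le => [|[|a]]; case: b => [|[|[|b]]]; rewrite ?mulrS ?mulr0n => le;
  first [by constructor 1 | by constructor 2 | by constructor 3 | by constructor 4 | exfalso];
  try (have := h0 b); try (have := g0 a); lra.
Qed.
Lemma kshift_nonresonant (d X g h : Gam) : 0 < d -> X *+ 2 = g *+ 3 -> X + d <= h + g ->
  h *+ 2 <= X -> ~ resonant g h.
Proof.
move=> h1 h2 h3 h4.
have g0 n : 0 <= g *+ n by rewrite mulrn_wge0 //; lra.
have h0 n : 0 <= h *+ n by rewrite mulrn_wge0 //; lra.
case=> [[|[|N]]] []; rewrite ?mulrS ?mulr0n => e; try lra; first by have := h0 N; lra.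
by have := g0 N; lra.
Qed.
Lemma kshift_monomials_mid (d X g h f : Gam) (a b : nat) : 0 < d -> X *+ 2 = g *+ 3 -> X + d <= h + g ->
  h *+ 2 <= X -> g *+ 2 + d <= f + h -> f *+ a + h *+ b <= g -> a = 0%N /\ (b <= 1)%N.
Proof.
move=> h1 h2 h3 h4 h5 le.
have g0 n : 0 <= f *+ n by rewrite mulrn_wge0 //; lra.
have h0 n : 0 <= h *+ n by rewrite mulrn_wge0 //; lra.
case: a le => [|a]; case: b => [|[|b]]; rewrite ?mulrS ?mulr0n => le //; exfalso;
  try (have := h0 b); try (have := g0 a); lra.
Qed.
Lemma kshift_resonant_mid (d X g h f : Gam) N : 0 < d -> X *+ 2 = g *+ 3 -> X + d <= h + g ->
  h *+ 2 <= X -> f <= X -> g *+ 2 + d <= f + h -> f = h *+ N -> N = 2%N.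
Proof.
move=> h1 h2 h3 h4 h5 h6.
have h0 n : 0 <= h *+ n by rewrite mulrn_wge0 //; lra.
case: N => [|[|[|N]]] //; rewrite ?mulrS ?mulr0n => e; exfalso; try lra.
by have := h0 N; lra.
Qed.
Lemma multiple_gt (f g h : Gam) N : h < g -> g < f -> 0 < h -> h = f *+ N -> False.
Proof.
move=> h1 h2 h3; have h0 n : 0 <= f *+ n by rewrite mulrn_wge0 //; lra.
case: N => [|N]; rewrite ?mulrS ?mulr0n => e; first by lra.
by have := h0 N; lra.
Qed.
Lemma kshift_monomials_low (d X g h f : Gam) (a b : nat) : 0 < d -> X *+ 2 = g *+ 3 -> X + d <= h + g ->
  h *+ 2 <= X -> g *+ 2 + d <= f + h -> f *+ a + g *+ b <= h -> a = 0%N /\ b = 0%N.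
Proof.
move=> h1 h2 h3 h4 h5 le.
have g0 n : 0 <= f *+ n by rewrite mulrn_wge0 //; lra.
have h0 n : 0 <= g *+ n by rewrite mulrn_wge0 //; lra.
case: a le => [|a]; case: b => [|b]; rewrite ?mulrS ?mulr0n => le //; exfalso;
  try (have := h0 b); try (have := g0 a); lra.
Qed.
Lemma kshift_nonresonant_low (d X g h f : Gam) : 0 < d -> X *+ 2 = g *+ 3 -> X + d <= h + g ->
  h *+ 2 <= X -> g *+ 2 + d <= f + h -> f <= X -> g < f -> ~ resonant f g.
Proof.
move=> h1 h2 h3 h4 h5 h6 h7.
have g0 n : 0 <= f *+ n by rewrite mulrn_wge0 //; lra.
have h0 n : 0 <= g *+ n by rewrite mulrn_wge0 //; lra.
case=> [[|[|N]]] []; rewrite ?mulrS ?mulr0n => e; try lra; first by have := h0 N; lra.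
by have := g0 N; lra.
Qed.
Lemma cancels_large L k j v (a : Gam) : cancels L k j v -> wedge k j != 0 -> deg v <= a -> a < D k j -> False.
Proof.
move=> hc w le lt; have cd := cancels_deg w hc; have [k0 j0] := wedge_gt0 w.
have nr : nonres (deg k) (deg j) L by case: hc => ? [? []].
by have [_ _ b3] := nonres_bounds k0 j0 nr; dlra.
Qed.

Lemma sp20 f g : sp2 f g 0.
Proof. by rewrite -mpolyC0; apply: sp2C. Qed.

Lemma order_max3 (p q r : Gam) (b1 b2 b3 : bool) (m : Gam) : 0 < r -> r < q -> q < p ->
  m = Num.max (Num.max (if b1 then 0 else p) (if b2 then 0 else q)) (if b3 then 0 else r) ->
  [/\ m = p -> ~~ b1, m = q -> b1 /\ ~~ b2 & m = r -> [/\ b1, b2 & ~~ b3]].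
Proof.
move=> r0 rq qp; have q0 := lt_trans r0 rq; have p0 := lt_trans q0 qp.
have rp := lt_trans rq qp.
by case: b1; case: b2; case: b3 => ->; do 3 rewrite ?maxxx ?(max_r (ltW q0)) ?(max_r (ltW r0))
    ?(max_l (ltW p0)) ?(max_l (ltW qp)) ?(max_l (ltW rq)) ?(max_l (ltW rp)) ?(max_l (ltW q0));
  split=> // e; exfalso; lra.
Qed.
Lemma degree_perm (f g h l k j : Gam) : h < g -> g < f -> j < k -> l != k -> l != j ->
  [\/ l = f, l = g | l = h] -> [\/ k = f, k = g | k = h] -> [\/ j = f, j = g | j = h] ->
  [\/ [/\ l = f, k = g & j = h], [/\ l = g, k = f & j = h] | [/\ l = h, k = f & j = g]].
Proof.
move=> h1 h2 h3 /eqP n1 /eqP n2 [] el [] ek [] ej;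
  first [by constructor 1|by constructor 2|by constructor 3|exfalso];
  first [by apply: n1; rewrite el ek|by apply: n2; rewrite el ej|lra].
Qed.

Section Kshift.
Variables (f g h x u : P) (a : C).
Hypotheses (a0 : a != 0) (fE : f = x + a *: h ^+ 2) (rx : reach x g u) (kx : kdata x g h u).

Lemma kshift_reach t : reach (f + t *: h ^+ 2) g h.
Proof. by rewrite fE -addrA -scalerDl; apply: reach_K rx kx. Qed.

(** The only nonlinear monomial in [k] and [j] that fits is [j ^+ 2], and it is absorbed into the
    parameter of the exceptional step. *)
Lemma kshift_top al b c d b' c' d' s d'' l l' k j :
  l = al *: f + b *: g + c *: h + d%:MP -> k = b' *: g + c' *: h + d'%:MP ->
  j = s *: h + d''%:MP -> al != 0 -> b' != 0 -> s != 0 -> deg k = deg g -> deg j = deg h ->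
  wedge k j != 0 -> alg k j (l' - l) -> deg (l' - l) <= deg f -> deg x < D k j -> reach l' k j.
Proof.
move=> lE kE jE al0 b0 s0 dk dj wkj ha le lt; have [k0 j0] := wedge_gt0 wkj.
have [[n1 n2 n3 n4 n5] n6] := kshift_nums a0 fE rx kx.
have [[hQ _]|rs|[L hc]] := alg_dich ha k0 j0 wkj; last 2 first.
- by rewrite dk dj in rs; case: (kshift_nonresonant n1 n2 n3 n4 rs).
- by case: (cancels_large hc wkj le (le_lt_trans n5 lt)).
have [t [v [E [q [q' [q'' hv]]]]]] : exists t v, l' - l = t *: j ^+ 2 + v /\ sp2 k j v.
  apply: (hQ (fun w => exists t v, w = t *: j ^+ 2 + v /\ sp2 k j v)).
  - by exists 0, 0; rewrite scale0r addr0; split; [|apply: sp20].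
  - move=> w w' [t [v [-> hv]]] [t' [v' [-> hv']]]; exists (t + t'), (v + v').
    by split; [rewrite scalerDl addrACA|apply: sp2D].
  move=> t p q; rewrite dk dj => le'.
  case: (kshift_monomials_top n1 n2 n3 n4 n5 (le_trans le' le)) => -[-> ->]; rewrite ?expr0 ?expr1 ?mul1r ?mulr1.
  - by exists 0, t%:MP; rewrite scale0r add0r alg_mpolyC; split; [|apply: sp2C].
  - by exists 0, (t *: j); rewrite scale0r add0r; split; [|apply/sp2Z/sp2r].
  - by exists t, 0; rewrite addr0; split; [|apply: sp20].
  by exists 0, (t *: k); rewrite scale0r add0r; split; [|apply/sp2Z/sp2l].
(* [t *: j ^+ 2] contains [t * s ^+ 2] times [h ^+ 2], and [f] enters [l] with coefficient [al]. *)
have r := reach_triangular b c d c' d' d'' (kshift_reach (t * s ^+ 2 / al)) al0 b0 s0.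
rewrite -kE -jE scalerDr scalerA mulrCA divff // mulr1 in r.
apply: reach312; apply: (reach_sp2 (reach231 r)).
exists q, (q' + t * d'' + t * d''), (q'' - t * d'' ^+ 2).
have -> : l' = l + (t *: j ^+ 2 + v) by rewrite -E addrC subrK.
rewrite lE hv jE !scalerDr !scalerA.
rewrite -!mul_mpolyC !(mpolyCD, mpolyCB, mpolyCM, expr2); ring.
Qed.

(** Without cancellation only affine terms in [j] fit. If [deg f] is a multiple of [deg h], it is
    the double, and another parameter of the exceptional step lowers [k], so that the change can be
    made where closure is known. *)
Lemma kshift_mid nu al b c d b' c' d' s d'' l l' k j :
  closed C nu -> reach l k j -> deg k + deg l + deg j = nu ->
  k = al *: f + b *: g + c *: h + d%:MP -> l = b' *: g + c' *: h + d'%:MP ->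
  j = s *: h + d''%:MP -> al != 0 -> b' != 0 -> s != 0 -> deg k = deg f -> deg l = deg g ->
  deg j = deg h -> alg k j (l' - l) -> deg l' <= deg l -> deg x < D k j -> reach l' k j.
Proof.
move=> cl r enu kE lE jE al0 b0 s0 dk dl dj ha le' lt.
have [l0 k0 j0] := jac_deg_gt0 (reach_jac r); have [_ _ wkj _] := jac_neq0 (reach_jac r).
have [[n1 n2 n3 n4 n5] n6] := kshift_nums a0 fE rx kx.
have [_ [n7 n8 _]] := kshift_wedges a0 fE rx kx.
have le : deg (l' - l) <= deg l by apply: degB_le.
have [[hQ _]|[N [e|e]]|[L hc]] := alg_dich ha k0 j0 wkj; last 1 first.
- by case: (cancels_large hc wkj le _); apply: le_lt_trans lt; rewrite dl; dlra.
- have hv : sp2 k j (l' - l).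
    apply: hQ; [exact: sp20|by move=> w w'; apply: sp2D|move=> t p q; rewrite dk dj => le2].
    have le3 : deg f *+ p + deg h *+ q <= deg g by rewrite -dl; apply: le_trans le2 le.
    have [-> q1] := kshift_monomials_mid n1 n2 n3 n4 n6 le3; rewrite expr0 mul1r; apply: sp2Z.
    by case: q q1 {le2 le3} => [|[|]] // _; [rewrite expr0 -mpolyC1; apply: sp2C|apply: sp2r].
  by apply: reach312; apply: (reach_sp2 (reach231 r)).
- have N2 : N = 2%N by apply: kshift_resonant_mid n1 n2 n3 n4 n5 n6 _; rewrite -dk -dj.
  rewrite N2 in e; have [t t0 ltk] := pow_cancel j0 k0 e; set y := k - _ in ltk.
  have aj : alg j j (y - k) by rewrite /y addrAC subrr add0r; apply: alg_pow.
  have ry : reach y l j.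
    have r1 := reach_triangular b c d c' d' d'' (kshift_reach (- (t * s ^+ 2 / al))) al0 b0 s0.
    rewrite -lE -jE scalerDr scalerA mulrN mulrCA divff // mulr1 in r1.
    apply: reach312; apply: (reach_sp2 (reach231 r1)).
    exists 0, (- (t * d'' + t * d'')), (t * d'' ^+ 2).
    rewrite /y kE jE !scalerDr !scalerA.
    rewrite -!mul_mpolyC !(mpolyCD, mpolyCN, mpolyCM, expr2); ring.
  have ry' : reach y l' j.
    apply: (closed2 cl ry); first by dlra.
    have -> : y = k + (y - k) by ring.
    exact: alg_basel.
  apply: reach213; apply: (closed1 cl ry'); first by dlra.
  by apply/alg_selfr/alg_subC.
by rewrite dk dj in e j0; case: (multiple_gt n8 n7 j0 e).
Qed.

(** Below the lowest degree only constants fit. *)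
Lemma kshift_low s d'' l l' k j :
  reach l k j -> l = s *: h + d''%:MP -> deg k = deg f -> deg j = deg g -> deg l = deg h ->
  alg k j (l' - l) -> deg l' <= deg l -> deg x < D k j -> reach l' k j.
Proof.
move=> r lE dk dj dl ha le' lt.
have [l0 k0 j0] := jac_deg_gt0 (reach_jac r); have [_ _ wkj _] := jac_neq0 (reach_jac r).
have [[n1 n2 n3 n4 n5] n6] := kshift_nums a0 fE rx kx.
have [_ [n7 n8 _]] := kshift_wedges a0 fE rx kx.
have le : deg (l' - l) <= deg l by apply: degB_le.
have [[hQ _]|rs|[L hc]] := alg_dich ha k0 j0 wkj; last 2 first.
- by rewrite dk dj in rs; case: (kshift_nonresonant_low n1 n2 n3 n4 n6 n5 n7 rs).
- by case: (cancels_large hc wkj le _); apply: le_lt_trans lt; rewrite dl; dlra.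
apply: reach312; apply: (reach_sp2 (reach231 r)).
apply: hQ; [exact: sp20|by move=> w w'; apply: sp2D|move=> t p q; rewrite dk dj => le2].
have le3 : deg f *+ p + deg g *+ q <= deg h by rewrite -dl; apply: le_trans le2 le.
have [-> ->] := kshift_monomials_low n1 n2 n3 n4 n6 le3; rewrite !expr0 mulr1; apply: sp2Z.
by rewrite -mpolyC1; apply: sp2C.
Qed.

Lemma kshift_coefs v al b c d : v = al *: f + b *: g + c *: h + d%:MP ->
  [/\ deg v = deg f -> al != 0, deg v = deg g -> al = 0 /\ b != 0 &
      deg v = deg h -> [/\ al = 0, b = 0 & c != 0]].
Proof.
move=> vE; have [_ [gf hg dd]] := kshift_wedges a0 fE rx kx.
have J : jac f g h != 0 by rewrite fE; apply: reach_jac; apply: reach_K rx kx.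
have [f0 g0 h0] := jac_deg_gt0 J.
have := deg_sp3 al b c d f0 g0 h0 dd; rewrite -vE => /(order_max3 h0 hg gf) [h1 h2 h3].
by split=> [/h1|/h2 [/eqP -> ?]|/h3 [/eqP -> /eqP -> ?]].
Qed.

Lemma kshift_closure_lt nu l l' k j : closed C nu -> reach l k j -> deg k + deg l + deg j = nu ->
  dist l k j -> deg j < deg k -> sp3 f g h l -> sp3 f g h k -> sp3 f g h j ->
  alg k j (l' - l) -> deg l' <= deg l -> reach l' k j.
Proof.
move=> cl r enu [lk lj kj] jk sl sk sj ha le.
have [l0 k0 j0] := jac_deg_gt0 (reach_jac r); have [_ _ wkj _] := jac_neq0 (reach_jac r).
have [_ [gf hg dd]] := kshift_wedges a0 fE rx kx.
have [[D0 _ _ _ _] _] := kshift_nums a0 fE rx kx.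
have pl := kshift_plane a0 fE rx kx sk sj wkj; have {pl}lt : deg x < D k j by dlra.
have J : jac f g h != 0 by rewrite fE; apply: reach_jac; apply: reach_K rx kx.
have [f0 g0 h0] := jac_deg_gt0 J.
have [al1 [b1 [c1 [d1 lE]]]] := sl; have [al2 [b2 [c2 [d2 kE]]]] := sk.
have [al3 [b3 [c3 [d3 jE]]]] := sj.
have [l1 l2 l3] := kshift_coefs lE; have [k1 k2 k3] := kshift_coefs kE.
have [j1 j2 j3] := kshift_coefs jE.
have [[el ek ej]|[el ek ej]|[el ek ej]] := degree_perm hg gf jk lk lj
    (deg_in3 f0 g0 h0 dd sl l0) (deg_in3 f0 g0 h0 dd sk k0) (deg_in3 f0 g0 h0 dd sj j0).
- have [z1 z2] := k2 ek; have [z3 z4 z5] := j3 ej.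
  rewrite z1 scale0r add0r in kE; rewrite z3 z4 !scale0r !add0r in jE.
  have le' : deg (l' - l) <= deg f by rewrite -el; apply: degB_le.
  exact: kshift_top lE kE jE (l1 el) z2 z5 ek ej wkj ha le' lt.
- have [z1 z2] := l2 el; have [z3 z4 z5] := j3 ej.
  rewrite z1 scale0r add0r in lE; rewrite z3 z4 !scale0r !add0r in jE.
  exact: kshift_mid cl r enu kE lE jE (k1 ek) z2 z5 ek el ej ha le lt.
have [z3 z4 z5] := l3 el; rewrite z3 z4 !scale0r !add0r in lE.
exact: kshift_low r lE ek ej el ha le lt.
Qed.

Lemma kshift_closure nu l l' k j : closed C nu -> reach l k j -> deg k + deg l + deg j = nu ->
  dist l k j -> sp3 f g h l -> sp3 f g h k -> sp3 f g h j ->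
  alg k j (l' - l) -> deg l' <= deg l -> reach l' k j.
Proof.
move=> cl r enu d sl sk sj ha le; have [lk lj kj] := d.
have [lt|] := ltP (deg j) (deg k).
  exact: kshift_closure_lt cl r enu d lt sl sk sj ha le.
rewrite le_eqVlt (negPf kj) /= => lt; apply: reach132.
apply: (kshift_closure_lt cl (reach132 r) _ _ lt sl sj sk (alg_sym ha) le); first by dlra.
by split=> //; rewrite eq_sym.
Qed.
End Kshift.

Lemma closed_le nu nu' : nu' <= nu -> closed C nu -> closed C nu'.
Proof. by move=> le cl f g h h' r lt; apply: cl => //; apply: lt_le_trans le. Qed.

Lemma msize_le2 v w : deg v <= deg w -> (msize w <= 2)%N -> (msize v <= 2)%N.
Proof.
have [->|v0] := eqVneq v 0; first by rewrite msize0.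
move=> le w2; have [ew|w0] := eqVneq w 0.
  by move: le; rewrite ew deg0 => le; have /deg_const[z ->] : deg v = 0; [apply/eqP; rewrite eq_le le deg_ge0|rewrite msizeC; case: eqP].
move: le; rewrite !degE => /emb_mdeg; move: w2.
by rewrite -(mlead_deg v0) -(mlead_deg w0) !ltnS => h1 h2; apply: leq_trans h1.
Qed.

Lemma reach_rescale k j k1 j1 l t : esp2 k j k1 j1 -> t != 0 -> reach k1 j1 (t *: l) -> reach l k j.
Proof.
move=> es t0 r; apply: reach312; apply: (reach_eqv r).
apply: (esp2_eqv (esp2_sym es) (_ : t^-1 != 0)); first by rewrite invr_eq0.
by rewrite scalerA mulVf // scale1r subrr; apply: sp20.
Qed.

(** By the view of [l]; the two positions with distinct planes give the two kinds of peak. An affine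
    triple stays affine because [deg l'] does not exceed [deg l]. *)
Lemma closure_low nu l l' k j : closed C nu -> reach l k j -> deg k + deg l + deg j = nu ->
  dist l k j -> alg k j (l' - l) -> deg l' <= deg l -> reach l' k j.
Proof.
move=> cl r enu d ha le; have [lk lj kj] := d.
have J := reach_jac r; have [l0 k0 j0] := jac_deg_gt0 J; have [wlk wlj wkj _] := jac_neq0 J.
have [l2 k2 j2|f g h x u a [_ [t1 t2 t3]] a0 e rx kx|k' r1 ak lt'|
      l1 k1 j1 k2 t d1 r1 es el t0 s esum r2 al2 lt2|
      l1 k1 j1 l2 t d1 lt1 r1 es el t0 s esum r2 al2 lt2] := reach_view r d.
- apply: reach_base => //; last exact: msize_le2 le l2.
  by rewrite jac_rot (jac_alg_coset ha) -jac_rot.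
- exact: (kshift_closure a0 e rx kx cl r enu d t1 t2 t3 ha le).
- apply: (closed1 cl r1); first by dlra.
  by apply: alg_trans ha _; apply: alg_subC.
- have at' : alg k1 j1 (t *: l' - l1).
    have -> : t *: l' - l1 = t *: (l' - l) - (l1 - t *: l) by rewrite scalerBr; ring.
    by apply: algB; [apply: algZ; apply/(esp2_alg _ es)|apply: sp2_alg].
  have le1 : deg (t *: l') <= deg l1 by rewrite degZ // el.
  have H : side_peak nu k1 l1 j1 k2 (t *: l').
    split; split=> //; [exact: reach213|exact: reach213|move: esum el enu; clear => ? ? ?; dlra].
  have d1' : dist k1 l1 j1 by case: d1 => *; split; rewrite // eq_sym.
  exact: reach_rescale es t0 (reach132 (side_peak_closed H d1')).
have at' : alg k1 j1 (t *: l' - l1).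
  have -> : t *: l' - l1 = t *: (l' - l) - (l1 - t *: l) by rewrite scalerBr; ring.
  by apply: algB; [apply: algZ; apply/(esp2_alg _ es)|apply: sp2_alg].
have le1 : deg (t *: l') <= deg l1 by rewrite degZ // el.
have d1' : dist k1 l1 j1 by case: d1 => *; split; rewrite // eq_sym.
have enu' : deg k1 + deg l1 + deg j1 = nu by dlra.
exact: reach_rescale es t0 (reach231 (sum_peak_closed cl r1 r2 al2 lt2 d1' lt1 at' le1 enu')).
Qed.

(** After a linear correction of [l'] that makes the degrees distinct, a change that raises the
    degree is itself a step [reach_elem]. *)
Lemma closure_dist nu l l' k j : closed C nu -> reach l k j -> deg k + deg l + deg j = nu ->
  dist l k j -> alg k j (l' - l) -> reach l' k j.
Proof.
move=> cl r enu d ha; have [lk lj kj] := d.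
have [l0 k0 j0] := jac_deg_gt0 (reach_jac r).
have [v [sv _ nk nj]] := adjust l' k0 j0 kj.
have hv : alg k j (v - l) by apply: alg_trans ha; apply/alg_subC/sp2_alg.
apply: reach312; apply: (@reach_sp2 _ k j v) => //.
have [le|lt] := leP (deg v) (deg l); first exact/reach231/(closure_low cl r enu d hv le).
apply: (reach_elem (reach231 r) hv _ lt).
by split=> //; rewrite eq_sym.
Qed.

(** Linear changes first make the degrees distinct without increasing their sum, so the induction
    hypothesis still applies below it. *)
Theorem reach_closed f g h h' : reach f g h -> alg f g (h' - h) -> reach f g h'.
Proof.
move: f g h h'; apply: (sigma_ind (Q := fun f g h => forall h', reach f g h ->
  alg f g (h' - h) -> reach f g h')) => f g h IH h' r ha.
have J := reach_jac r; have [f0 g0 h0] := jac_deg_gt0 J; have [wfg _ _ _] := jac_neq0 J.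
have cl : closed C (deg f + deg g + deg h) by move=> x y z z' rz lt; apply: IH.
have [t [n1 le1]] := make_dist wfg; set f1 := f - _ in n1 le1.
have es : esp2 f g f1 g.
  split; [|exact: sp2r| |exact: sp2r].
    by apply: sp2B; [apply: sp2l|apply/sp2Z/sp2r].
  have -> : f = f1 + t *: g by rewrite subrK.
  by apply: sp2D; [apply: sp2l|apply/sp2Z/sp2r].
have f10 : 0 < deg f1.
  suff /wedge_gt0[] : wedge f1 g != 0 by [].
  by rewrite wedge_sub.
have [h1 [s le nf ng]] := adjust h f10 g0 n1.
have s' : sp2 f1 g (h1 - 1 *: h) by rewrite scale1r -opprB; apply: sp2N.
have s'' : sp2 f g (h1 - 1 *: h) by apply/(coset_esp2 _ es).
have r1 : reach f1 g h1 by apply: (reach_eqv r); apply: (esp2_eqv es (oner_neq0 _) s'').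
have ha1 : alg f1 g (h' - h1).
  by apply: (@alg_trans _ _ _ _ h); [apply/(esp2_alg _ es)|apply: sp2_alg].
have le3 : deg f1 + deg h1 + deg g <= deg f + deg g + deg h by dlra.
have d : dist h1 f1 g by [].
have r2 := closure_dist (closed_le le3 cl) (reach312 r1) (erefl _) d ha1.
apply: (reach_eqv (reach231 r2)); apply: (esp2_eqv (esp2_sym es) (oner_neq0 _)).
by rewrite scale1r subrr; apply: sp20.
Qed.
End Closure.

(** * Tame automorphisms *)

Section Evaluation.
Variable C : numClosedFieldType.
Local Notation P := {mpoly C[3]}.
Implicit Types (f g h x y z : P) (p q : Defs.mpoly C).

(** The nested encoding is evaluated one variable at a time, each stage being a ring morphism that
    serves as coefficient map of the next. *)
Definition ev1 f : {poly C} -> P := horner_eval f \o map_poly (@mpolyC 3 C).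
HB.instance Definition _ f := GRing.RMorphism.on (ev1 f).
Definition ev2 f g : {poly {poly C}} -> P := horner_eval g \o map_poly (ev1 f).
HB.instance Definition _ f g := GRing.RMorphism.on (ev2 f g).
Definition ev3 f g h : Defs.mpoly C -> P := horner_eval h \o map_poly (ev2 f g).
HB.instance Definition _ f g h := GRing.RMorphism.on (ev3 f g h).

Lemma ev1E f (s : {poly C}) : ev1 f s = \sum_(k < size s) (s`_k)%:MP * f ^+ k.
Proof. by rewrite /ev1 /= /horner_eval /map_poly horner_poly. Qed.
Lemma ev2E f g (s : {poly {poly C}}) : ev2 f g s = \sum_(j < size s) ev1 f s`_j * g ^+ j.
Proof. by rewrite /ev2 /= /horner_eval /map_poly horner_poly. Qed.
Lemma ev3E f g h p : ev3 f g h p = \sum_(i < size p) ev2 f g p`_i * h ^+ i.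
Proof. by rewrite /ev3 /= /horner_eval /map_poly horner_poly. Qed.

Lemma ev1C f (c : C) : ev1 f c%:P = c%:MP.
Proof. by rewrite /ev1 /= /horner_eval map_polyC hornerC. Qed.
Lemma ev1X f : ev1 f 'X = f.
Proof. by rewrite /ev1 /= /horner_eval map_polyX hornerX. Qed.
Lemma ev2C f g (s : {poly C}) : ev2 f g s%:P = ev1 f s.
Proof. by rewrite /ev2 /= /horner_eval map_polyC hornerC. Qed.
Lemma ev2X f g : ev2 f g 'X = g.
Proof. by rewrite /ev2 /= /horner_eval map_polyX hornerX. Qed.
Lemma ev3C f g h (s : {poly {poly C}}) : ev3 f g h s%:P = ev2 f g s.
Proof. by rewrite /ev3 /= /horner_eval map_polyC hornerC. Qed.
Lemma ev3X f g h : ev3 f g h (X3 C) = h.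
Proof. by rewrite /ev3 /= /horner_eval map_polyX hornerX. Qed.
Lemma ev3X1 f g h : ev3 f g h (X1 C) = f. Proof. by rewrite ev3C ev2C ev1X. Qed.
Lemma ev3X2 f g h : ev3 f g h (X2 C) = g. Proof. by rewrite ev3C ev2X. Qed.
Lemma ev3cst f g h (c : C) : ev3 f g h (cst c) = c%:MP. Proof. by rewrite ev3C ev2C ev1C. Qed.

Lemma ev3_subst f g h p q1 q2 q3 :
  ev3 f g h (subst p q1 q2 q3) = ev3 (ev3 f g h q1) (ev3 f g h q2) (ev3 f g h q3) p.
Proof.
rewrite /subst [RHS]ev3E rmorph_sum; apply: eq_bigr => i _; rewrite rmorphM rmorphXn; congr (_ * _).
rewrite ev2E rmorph_sum; apply: eq_bigr => j _; rewrite rmorphM rmorphXn; congr (_ * _).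
rewrite ev1E rmorph_sum; apply: eq_bigr => k _; rewrite rmorphM rmorphXn; congr (_ * _).
exact: ev3cst.
Qed.

Lemma alg_ev1 f g (s : {poly C}) : alg f g (ev1 f s).
Proof.
rewrite ev1E; elim/big_ind: _ => [||k _]; [exact: alg0|exact: algD|].
by apply: algM; [apply: algC|apply/algX/algl].
Qed.
Lemma alg_ev2 f g (s : {poly {poly C}}) : alg f g (ev2 f g s).
Proof.
rewrite ev2E; elim/big_ind: _ => [||k _]; [exact: alg0|exact: algD|].
by apply: algM; [apply: alg_ev1|apply/algX/algr].
Qed.

(** The image triple is passed to a predicate, so that composition of maps becomes nesting of
    predicates. *)
Definition image (F : polymap C) f g h (Q : P -> P -> P -> Prop) :=
  Q (ev3 f g h (pm1 F)) (ev3 f g h (pm2 F)) (ev3 f g h (pm3 F)).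

Lemma image_comp F G f g h Q : image (Defs.pcomp F G) f g h Q = image G f g h (fun f g h => image F f g h Q).
Proof. by rewrite /image /= !ev3_subst. Qed.
Lemma image_id f g h Q : image (polymap_id C) f g h Q = Q f g h.
Proof. by rewrite /image /= ev3X1 ev3X2 ev3X. Qed.

Lemma reach_triangular_aut f g h (s : {poly C}) (t : {poly {poly C}}) :
  reach f g h <-> reach f (g + ev1 f s) (h + ev2 f g t).
Proof.
have H f' g' h' s' t' : reach f' g' h' -> reach f' (g' + ev1 f' s') (h' + ev2 f' g' t').
  move=> r; apply/reach132; apply: (@reach_closed _ _ _ g'); last by rewrite addrAC subrr add0r; apply: alg_ev1.
  apply/reach132; apply: (reach_closed r); rewrite addrAC subrr add0r; exact: alg_ev2.
split; first exact: H.
move=> r; have r1 : reach f (g + ev1 f s) h.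
  apply: (reach_closed r); rewrite opprD addrA subrr add0r; apply: algN.
  by apply: alg_baser; [apply: alg_ev1|apply: alg_ev2].
apply/reach132; apply: (reach_closed (reach132 r1)); rewrite opprD addrA subrr add0r.
by apply/algN/alg_ev1.
Qed.

Definition tr f g h (i : 'I_3) : P := tnth [tuple f; g; h] i.

Lemma ev3_affine (A : 'M[C]_3) (b : 'cV[C]_3) f g h i :
  ev3 f g h (affine_comp A b i) = \sum_j A i j *: tr f g h j + (b i 0)%:MP.
Proof.
rewrite /affine_comp raddfD /= raddf_sum /=; congr (_ + _); last exact: ev3cst.
apply: eq_bigr => j _; rewrite rmorphM /= ev3cst mul_mpolyC; congr (_ *: _).
by rewrite /tr /Xv; case: j => -[|[|[|]]] //= lt; rewrite ?ev3X1 ?ev3X2 ?ev3X.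
Qed.

Lemma sp3_sum (a : 'I_3 -> C) (e : C) f g h : sp3 f g h (\sum_j a j *: tr f g h j + e%:MP).
Proof.
by exists (a ord0), (a (lift ord0 ord0)), (a (lift ord0 (lift ord0 ord0))), e;
  rewrite !big_ord_recl big_ord0 addr0 !addrA.
Qed.

Lemma tr_codom (u : 'I_3 -> P) i : tr (u (inord 0)) (u (inord 1)) (u (inord 2)) i = u i.
Proof.
rewrite /tr; case: i => -[|[|[|]]] //= lt; congr (u _); by apply: val_inj; rewrite /= inordK.
Qed.

Lemma eqv_affine (A : 'M[C]_3) (b : 'cV[C]_3) f g h (u : 'I_3 -> P) : A \in unitmx ->
  (forall i, u i = \sum_j A i j *: tr f g h j + (b i 0)%:MP) ->
  eqv f g h (u (inord 0)) (u (inord 1)) (u (inord 2)).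
Proof.
move=> uA uE; have S i : sp3 f g h (u i) by rewrite uE; apply: sp3_sum.
have T k : sp3 (u (inord 0)) (u (inord 1)) (u (inord 2)) (tr f g h k).
  have -> : tr f g h k = \sum_i invmx A k i *: tr (u (inord 0)) (u (inord 1)) (u (inord 2)) i
      + (- \sum_i invmx A k i * b i 0)%:MP; last exact: sp3_sum.
  have E i := etrans (tr_codom u i) (uE i).
  under eq_bigr do rewrite E scalerDr.
  rewrite big_split /= -addrA [X in _ = _ + X](_ : _ = 0) ?addr0; last first.
    rewrite mpolyCN raddf_sum /=; apply/eqP; rewrite subr_eq0; apply/eqP.
    by apply: eq_bigr => i _; rewrite -mul_mpolyC -mpolyCM.
  under eq_bigr do rewrite scaler_sumr; rewrite exchange_big /=.
  rewrite (eq_bigr (fun j => (k == j)%:R *: tr f g h j)) => [|j _]; last first.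
    under eq_bigr do rewrite scalerA; rewrite -scaler_suml.
    by have := mulVmx uA => /matrixP/(_ k j); rewrite !mxE => ->.
  rewrite (bigD1 k) //= big1 => [|j jk]; first by rewrite addr0 eqxx scale1r.
  by rewrite eq_sym (negPf jk) scale0r.
split; split; [exact: S|exact: S|exact: S|exact: (T ord0)|exact: (T (lift ord0 ord0))|].
exact: (T (lift ord0 (lift ord0 ord0))).
Qed.

(** Being an equivalence over all triples, the statement passes to inverses: for [G] it follows from
    that for [F], as composing the two gives the identity. *)
Lemma tame_reach (F : polymap C) : tame F -> forall f g h, reach f g h <-> image F f g h (@reach C).
Proof.
elim=> {F} [F [A [b [uA ->]]]|F [s [t ->]]|F G _ IHF _ IHG|F G _ IHF e1 e2] f g h.
- have E := eqv_affine uA (ev3_affine A b f g h).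
  by split=> r; apply: reach_eqv r _; [exact: E|exact: eqv_sym].
- rewrite /image /= rmorphD rmorphD /= ev3X1 ev3X2 ev3X !ev3C ev2C.
  exact: reach_triangular_aut.
- by rewrite image_comp (IHG f g h); apply: IHF.
rewrite -{1}(image_id f g h) -e1 image_comp /image; symmetry; exact: IHF.
Qed.
End Evaluation.

(** * Total degree in the nested encoding *)

Section TotalDegree.
Variable C : numClosedFieldType.
Local Notation P := {mpoly C[3]}.
Implicit Types (p : Defs.mpoly C).

Definition var1 : P := 'X_(inord 0).
Definition var2 : P := 'X_(inord 1).
Definition var3 : P := 'X_(inord 2).
Definition iota : Defs.mpoly C -> P := ev3 var1 var2 var3.

Lemma sum_coef (T : nzRingType) (p : {poly T}) (G : T -> C) m : G 0 = 0 ->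
  \sum_(i < size p) G p`_i * (i == m :> nat)%:R = G p`_m.
Proof.
move=> G0; have [lt|ge] := ltnP m (size p).
  rewrite (bigD1 (Ordinal lt)) //= eqxx mulr1 big1 ?addr0 // => i ne.
  by rewrite (negPf (_ : (i : nat) != m)) ?mulr0.
rewrite (nth_default _ ge) G0 big1 // => i _.
by rewrite ltn_eqF ?mulr0 // (leq_trans (ltn_ord i)).
Qed.

Definition mon (k j i : nat) : 'X_{1..3} :=
  (U_(inord 0) *+ k + U_(inord 1) *+ j + U_(inord 2) *+ i)%MM.

Lemma mon_eq k j i m : (mon k j i == m) = [&& k == m (inord 0), j == m (inord 1) & i == m (inord 2)].
Proof.
have v0 : val (inord 0 : 'I_3) = 0%N by rewrite /= inordK.
have v1 : val (inord 1 : 'I_3) = 1%N by rewrite /= inordK.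
have v2 : val (inord 2 : 'I_3) = 2%N by rewrite /= inordK.
apply/eqP/and3P => [<-|[/eqP e0 /eqP e1 /eqP e2]].
  by rewrite !mnmDE !mulmnE !mnmE -!val_eqE /= v0 v1 v2 /= !mul1n !mul0n !addn0 !add0n !eqxx.
apply/mnmP => t; rewrite !mnmDE !mulmnE !mnmE.
have : t \in [:: inord 0; inord 1; inord 2].
  by rewrite !inE -!val_eqE /= v0 v1 v2; case: t => -[|[|[|]]].
rewrite !inE => /or3P[] /eqP ->; rewrite -!val_eqE /= v0 v1 v2 /= !mul1n !mul0n !addn0 ?add0n //.
Qed.
Lemma mdeg_mon k j i : mdeg (mon k j i) = (k + j + i)%N.
Proof. by rewrite !mdegD !mdegMn !mdeg1 !mul1n. Qed.
Lemma mdeg_monE (m : 'X_{1..3}) : mdeg m = (m (inord 0) + m (inord 1) + m (inord 2))%N.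
Proof.
by rewrite -mdeg_mon; congr mdeg; apply/esym/eqP; rewrite mon_eq !eqxx.
Qed.

Lemma iota_coef p m : (iota p)@_m = p`_(m (inord 2))`_(m (inord 1))`_(m (inord 0)).
Proof.
rewrite -(@sum_coef _ p (fun q => q`_(m (inord 1))`_(m (inord 0)))) ?coef0 //.
rewrite /iota ev3E raddf_sum /=; apply: eq_bigr => i _.
rewrite -(@sum_coef _ p`_i (fun q => q`_(m (inord 0)))) ?coef0 //.
rewrite ev2E !mulr_suml raddf_sum /=; apply: eq_bigr => j _.
rewrite -(@sum_coef _ p`_i`_j id) //.
rewrite ev1E !mulr_suml raddf_sum /=; apply: eq_bigr => k _.
rewrite /var1 /var2 /var3 !mpolyXn -!mulrA -!mpolyXD mul_mpolyC mcoeffZ mcoeffX addmA mon_eq.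
by case: (_ == _); case: (_ == _); case: (_ == _); rewrite /= ?mulr1 ?mulr0.
Qed.

Lemma max_attained (T : nzRingType) (p : {poly T}) (F : T -> nat) : F 0 = 0%N -> p != 0 ->
  exists2 i, p`_i != 0 & \max_(i < size p) (i + F (p`_i)%R)%N = (i + F (p`_i)%R)%N.
Proof.
move=> F0 p0; have sp : (0 < #|'I_(size p)|)%N by rewrite card_ord size_poly_gt0.
have [i e] := @bigop.eq_bigmax _ (fun i : 'I_(size p) => (i + F (p`_i)%R)%N) sp.
(* An index reaching the maximum may carry a zero coefficient. Its weight is then [i], which the
   leading index also reaches. *)
have [z|nz] := eqVneq p`_i 0; last by exists i.
have lt : ((size p).-1 < size p)%N by rewrite prednK // size_poly_gt0.
exists (size p).-1; first by rewrite -/(lead_coef p) lead_coef_eq0.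
have := @bigop.leq_bigmax _ (fun i : 'I_(size p) => (i + F (p`_i)%R)%N) (Ordinal lt).
rewrite e z F0 addn0 /= => le; apply/eqP; rewrite eqn_leq le andbT.
by apply: leq_trans (leq_addr _ _); rewrite -ltnS prednK // size_poly_gt0.
Qed.

Lemma deg3E p : deg3 p = mdeg (mlead (iota p)).
Proof.
have [->|p0] := eqVneq p 0.
  by rewrite /deg3 size_poly0 big_ord0 /iota rmorph0 mlead0 mdeg0.
have d2 : deg2 (0 : {poly {poly C}}) = 0%N by rewrite /deg2 size_poly0 big_ord0.
have d1 : deg1 (0 : {poly C}) = 0%N by rewrite /deg1 size_poly0.
have [i pi e] := max_attained d2 p0; have [j pj e'] := max_attained d1 pi.
have nz : (iota p)@_(mon (deg1 p`_i`_j) j i) != 0.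
  have := eqxx (mon (deg1 p`_i`_j) j i); rewrite {1}mon_eq => /and3P[/eqP e0 /eqP e1 /eqP e2].
  by rewrite iota_coef -e0 -e1 -e2 -/(lead_coef _) lead_coef_eq0.
have v0 : iota p != 0 by apply: contraNneq nz => ->; rewrite mcoeff0.
apply/eqP; rewrite eqn_leq; apply/andP; split.
  have -> : deg3 p = mdeg (mon (deg1 p`_i`_j) j i).
    by rewrite /deg3 e /deg2 e' mdeg_mon addnC (addnC j).
  by rewrite -ltnS mlead_deg // msize_mdeg_lt // mcoeff_msupp.
have := mlead_supp v0; rewrite mcoeff_msupp iota_coef mdeg_monE.
set m := mlead _; set i' := m (inord 2); set j' := m (inord 1); set k' := m (inord 0) => cn.
have jn : p`_i'`_j' != 0 by apply: contraNneq cn => ->; rewrite coef0.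
have inz : p`_i' != 0 by apply: contraNneq jn => ->; rewrite coef0.
have kl : (k' <= deg1 (p`_i'`_j')%R)%N.
  by rewrite -ltnS prednK ?size_poly_gt0 // ltnNge; apply: contraNN cn => /(nth_default 0) ->.
have jl : (j' < size (p`_i')%R)%N by rewrite ltnNge; apply: contraNN jn => /(nth_default 0) ->.
have il : (i' < size p)%N by rewrite ltnNge; apply: contraNN inz => /(nth_default 0) ->.
have b1 : (i' + deg2 (p`_i')%R <= deg3 p)%N :=
  @bigop.leq_bigmax _ (fun i : 'I_(size p) => (i + deg2 (p`_i)%R)%N) (Ordinal il).
have b2 : (j' + deg1 (p`_i'`_j')%R <= deg2 (p`_i')%R)%N :=
  @bigop.leq_bigmax _ (fun j : 'I_(size (p`_i')%R) => (j + deg1 (p`_i'`_j)%R)%N) (Ordinal jl).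
by move: kl b1 b2; clear; lia.
Qed.
End TotalDegree.

(** * Total degrees of reached triples *)

Section Forward.
Variable C : numFieldType.
Local Notation P := {mpoly C[3]}.
Local Notation D f g := (fdeg (wedge f g)).
Implicit Types (f g h u v w : P).

Definition tdeg v := mdeg (mlead v).

Lemma tdeg_eq u v : deg u = deg v -> tdeg u = tdeg v.
Proof. by rewrite !degE /tdeg => /emb_inj ->. Qed.
Lemma tdeg_lt u v : (tdeg u < tdeg v)%N -> deg u < deg v.
Proof. by rewrite ltNge !degE => h; apply: contraL h => /emb_mdeg; rewrite -leqNgt. Qed.
Lemma tdeg_muln u v a b : deg u *+ a = deg v *+ b -> (tdeg u * a = tdeg v * b)%N.
Proof. by rewrite !degE -!embMn => /emb_inj e; rewrite /tdeg -!mdegMn e. Qed.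

Lemma elementary_tdeg f g h h' : reach f g h' -> alg f g (h - h') -> deg h' < deg h ->
  elementary_degrees (tdeg f) (tdeg g) (tdeg h).
Proof.
move=> r ha lt; have [f0 g0 _] := jac_deg_gt0 (reach_jac r).
have [wfg _ _ _] := jac_neq0 (reach_jac r).
have dphi : deg (h - h') = deg h by rewrite degD_lt_l ?degN.
have [[_ [|a [b]]]|[N e]|[L hc]] := alg_dich ha f0 g0 wfg.
- by rewrite dphi; apply: le_lt_trans (deg_ge0 _) lt.
- rewrite dphi !degE -!embMn -embD => /emb_inj e; constructor 1; exists a, b.
  by rewrite /tdeg -e mdegD !mdegMn mulnC (mulnC b).
- constructor 2; exists N; case: e => e; [left|right].
    by rewrite -(@tdeg_muln f g 1 N) ?muln1.
  by rewrite -(@tdeg_muln g f 1 N) ?muln1.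
have [_ [_ [[a [b [ab a1 b1 ea eb]]] _ _ _ _]]] := hc.
constructor 3; exists a, b; split=> //.
  by apply: tdeg_muln; rewrite ea eb.
have := cancels_deg wfg hc; have := fdeg_wedge_gt0 wfg.
have [k k0 ->] := fdeg_attained wfg; rewrite dphi -ea !degE emb_gt0 -mdeg_eq0 -lt0n => m0.
rewrite -embMn -!embD => /emb_mdeg; rewrite !mdegD mdegMn /tdeg.
by move: m0; clear; lia.
Qed.

Lemma middle_degree (f g h p q r : Gam) : f < g -> g < h -> r < q -> q < p ->
  [\/ p = f, p = g | p = h] -> [\/ q = f, q = g | q = h] -> [\/ r = f, r = g | r = h] -> q = g.
Proof. by move=> h1 h2 h3 h4 [] e1 [] e2 [] e3 //; exfalso; lra. Qed.

Lemma degree_perms (f g h p q r : Gam) : p != q -> p != r -> q != r ->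
  [\/ p = f, p = g | p = h] -> [\/ q = f, q = g | q = h] -> [\/ r = f, r = g | r = h] ->
  [\/ [/\ p = f, q = g & r = h], [/\ p = f, q = h & r = g] | [/\ p = g, q = h & r = f]] \/
  [\/ [/\ q = f, p = g & r = h], [/\ q = f, p = h & r = g] | [/\ q = g, p = h & r = f]].
Proof.
move=> n1 n2 n3 [] e1 [] e2 [] e3;
  first [by left; constructor 1|by left; constructor 2|by left; constructor 3|
         by right; constructor 1|by right; constructor 2|by right; constructor 3|exfalso];
  by rewrite ?e1 ?e2 ?e3 ?eqxx in n1 n2 n3.
Qed.

Lemma reach_degrees f g h p1 p2 d3 : reach f g h -> prime p1 -> prime p2 -> (3 <= p1)%N ->
  (p1 < p2)%N -> (p2 < d3)%N -> tdeg f = p1 -> tdeg g = p2 -> tdeg h = d3 ->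
  exists k1 k2 : nat, d3 = (k1 * p1 + k2 * p2)%N.
Proof.
move=> r pr1 pr2 p13 p12 p23 tf tg th.
have fg : deg f < deg g by apply: tdeg_lt; rewrite tf tg.
have gh : deg g < deg h by apply: tdeg_lt; rewrite tg th.
have J := reach_jac r; have [f0 g0 h0] := jac_deg_gt0 J.
have d : dist f g h by split; rewrite lt_eqF //; apply: lt_trans gh.
have [f' [g' [h' [E S]]]] := reach_inv r; have [[s1 s2 s3] [t1 t2 t3]] := E.
have [f0' g0' h0'] := jac_deg_gt0 (eqv_jac E J).
have if' := deg_in3 f0 g0 h0 d s1 f0'; have ig' := deg_in3 f0 g0 h0 d s2 g0'.
have ih' := deg_in3 f0 g0 h0 d s3 h0'.
case: S => [mf mg mh|h1 rh ah [d1 d2 d3'] lth|x u a a0 fE rx kx].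
(* An affine triple spans only polynomials of total degree at most 1, below [p1]. *)
- have := sp3_msize mf mg mh t1; rewrite -mlead_deg ?deg_gt0_neq0 // -/(tdeg f) tf ltnS.
  by rewrite leqNgt (leq_trans _ p13).
- have H := elementary_tdeg rh ah lth.
  have [c|c] := degree_perms d1 d2 d3' if' ig' ih'.
    apply: (elementary_arith pr1 pr2 p13 p12 p23 H); rewrite -tf -tg -th.
    by case: c => -[/tdeg_eq -> /tdeg_eq -> /tdeg_eq ->]; [constructor 1|constructor 2|constructor 3].
  apply: (elementary_arith pr1 pr2 p13 p12 p23 (elementary_degrees_sym H)); rewrite -tf -tg -th.
  by case: c => -[/tdeg_eq -> /tdeg_eq -> /tdeg_eq ->]; [constructor 1|constructor 2|constructor 3].
(* In an exceptional triple [g'] has the middle degree, so the relation [2 deg x = 3 deg g']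
   concerns [p2]. *)
have [_ [gf hg _]] := kshift_wedges a0 fE rx kx.
have eg := middle_degree fg gh hg gf if' ig' ih'.
have [_ e23 _ _ _] := kx; rewrite eg in e23; have := tdeg_muln e23; rewrite tg => e.
have : (2 %| p2)%N by rewrite -(@Gauss_dvdl 2 p2 3) // -e dvdn_mull.
by rewrite dvdn_prime2 // => /eqP e2; move: p12 p13; rewrite -e2; clear; lia.
Qed.
End Forward.

(** * The coordinate functions as a starting point *)

Section Converse.
Variable C : numClosedFieldType.
Local Notation P := {mpoly C[3]}.
Local Notation x1 := (var1 C).
Local Notation x2 := (var2 C).
Local Notation x3 := (var3 C).

Lemma deg_x (i : 'I_3) : deg ('X_i : P) = emb U_(i)%MM.
Proof. by rewrite degE mleadXm. Qed.
Lemma deg_x_gt0 (i : 'I_3) : 0 < deg ('X_i : P).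
Proof. by rewrite deg_x emb_gt0 -mdeg_eq0 mdeg1. Qed.

Lemma ldX (i j : 'I_3) : ld i ('X_j : P) = (j == i)%:R *: 'X_j.
Proof.
apply/mpolyP => m; rewrite ld_coeff mcoeffZ mcoeffX.
by case: eqP => [<-|_]; rewrite ?mulr0 // mnm1E.
Qed.

Lemma reach_x : reach x1 x2 x3.
Proof.
have v0 : inord 0 = 0 :> 'I_3 by apply: val_inj; rewrite /= inordK.
have v1 : inord 1 = 1 :> 'I_3 by apply: val_inj; rewrite /= inordK.
have v2 : inord 2 = 2 :> 'I_3 by apply: val_inj; rewrite /= inordK.
apply: reach_base; rewrite ?msizeX ?mdeg1 //.
rewrite jacE /var1 /var2 /var3 v0 v1 v2 !ldX /= !scale1r !scale0r.
rewrite !(mul0r, mulr0, subr0, sub0r, addr0, add0r).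
by rewrite !mulf_neq0 //; apply: deg_gt0_neq0; apply: deg_x_gt0.
Qed.
End Converse.

(** * Realizing the combinations of the two primes *)

Section Realization.
Variable C : numClosedFieldType.
Local Notation P := {mpoly C[3]}.
Local Notation x1 := (var1 C).
Local Notation x2 := (var2 C).
Local Notation x3 := (var3 C).
Variables p1 p2 k1 k2 : nat.
Hypotheses (p13 : (1 < p1)%N) (p12 : (1 < p2)%N) (d31 : (1 < k1 * p1 + k2 * p2)%N).

(** Triangular maps add only functions of earlier variables; conjugation by this exchange lets
    powers of the last variable be added to the first two. *)
Definition swapM : 'M[C]_3 := perm_mx (tperm (inord 0) (inord 2)).
Definition swap : polymap C :=
  PMap (affine_comp swapM 0 (inord 0)) (affine_comp swapM 0 (inord 1))
    (affine_comp swapM 0 (inord 2)).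
Definition shear (s : {poly C}) (t : {poly {poly C}}) : polymap C :=
  PMap (X1 C) (X2 C + s%:P%:P) (X3 C + t%:P).

Lemma tame_swap : tame swap.
Proof. by apply: tame_affine; exists swapM, 0; rewrite unitmx_perm. Qed.
Lemma tame_shear s t : tame (shear s t).
Proof. by apply: tame_triangular; exists s, t. Qed.

Lemma ev3_swap (f g h : P) : [/\ ev3 f g h (pm1 swap) = h, ev3 f g h (pm2 swap) = g &
  ev3 f g h (pm3 swap) = f].
Proof.
have E i : ev3 f g h (affine_comp swapM 0 i) = tr f g h (tperm (inord 0) (inord 2) i).
  rewrite ev3_affine mxE mpolyC0 addr0 (bigD1 (tperm (inord 0) (inord 2) i)) //= big1 => [|j ne].
    by rewrite addr0 /swapM /perm_mx !mxE eqxx scale1r.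
  by rewrite /swapM /perm_mx !mxE eq_sym (negPf ne) scale0r.
have ne02 : inord 0 != inord 2 :> 'I_3 by rewrite -val_eqE /= !inordK.
split; rewrite E ?tpermL ?tpermR ?tpermD -?val_eqE /= ?inordK //; rewrite /tr.
- by have -> : inord 2 = ord_max :> 'I_3 by apply: val_inj; rewrite /= inordK.
- by have -> : inord 1 = lift ord0 ord0 :> 'I_3 by apply: val_inj; rewrite /= inordK.
by have -> : inord 0 = ord0 :> 'I_3 by apply: val_inj; rewrite /= inordK.
Qed.

Lemma ev3_shear (f g h : P) s t : [/\ ev3 f g h (pm1 (shear s t)) = f,
  ev3 f g h (pm2 (shear s t)) = g + ev1 f s & ev3 f g h (pm3 (shear s t)) = h + ev2 f g t].
Proof. by rewrite !rmorphD /= ev3X1 ev3X2 ev3X !ev3C ev2C. Qed.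

Lemma ev1Xn (f : P) n : ev1 f 'X^n = f ^+ n.
Proof. by rewrite rmorphXn /= ev1X. Qed.
Lemma ev2Xn (f g : P) n : ev2 f g 'X^n = g ^+ n.
Proof. by rewrite rmorphXn /= ev2X. Qed.

Definition shear_x : polymap C := shear 'X^p2 ('X^p1)%:P.
Definition shear_xy : polymap C := shear 0 (('X^k1)%:P * 'X^k2).
Definition realization : polymap C :=
  Defs.pcomp shear_xy (Defs.pcomp swap (Defs.pcomp shear_x swap)).

Lemma tame_realization : tame realization.
Proof.
have h1 : tame shear_x := tame_shear 'X^p2 ('X^p1)%:P.
have h2 : tame shear_xy := tame_shear 0 (('X^k1)%:P * 'X^k2).
exact (@tame_comp C shear_xy _ h2 (@tame_comp C swap _ tame_swap
  (@tame_comp C shear_x swap h1 tame_swap))).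
Qed.

Lemma image_swap (f g h : P) (Q : P -> P -> P -> Prop) : Q h g f -> image swap f g h Q.
Proof. by have [s1 s2 s3] := ev3_swap f g h; rewrite /image s1 s2 s3. Qed.
Lemma image_shear_x (f g h : P) (Q : P -> P -> P -> Prop) :
  Q f (g + f ^+ p2) (h + f ^+ p1) -> image shear_x f g h Q.
Proof.
have [t1 t2 t3] := ev3_shear f g h 'X^p2 ('X^p1)%:P.
by rewrite ev1Xn in t2; rewrite ev2C ev1Xn in t3; rewrite /image t1 t2 t3.
Qed.
Lemma image_shear_xy (f g h : P) (Q : P -> P -> P -> Prop) :
  Q f g (h + f ^+ k1 * g ^+ k2) -> image shear_xy f g h Q.
Proof.
have [v1 v2 v3] := ev3_shear f g h 0 (('X^k1)%:P * 'X^k2).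
rewrite rmorph0 addr0 in v2; rewrite rmorphM /= ev2C ev1Xn ev2Xn in v3.
by rewrite /image v1 v2 v3.
Qed.
Lemma image_conj (S T H : polymap C) (f g h : P) Q :
  (forall f g h (Q : P -> P -> P -> Prop), Q h g f -> image S f g h Q) ->
  (forall f g h (Q : P -> P -> P -> Prop), Q f (g + f ^+ p2) (h + f ^+ p1) -> image T f g h Q) ->
  (forall f g h (Q : P -> P -> P -> Prop), Q f g (h + f ^+ k1 * g ^+ k2) -> image H f g h Q) ->
  Q (f + h ^+ p1) (g + h ^+ p2) (h + (f + h ^+ p1) ^+ k1 * (g + h ^+ p2) ^+ k2) ->
  image (Defs.pcomp H (Defs.pcomp S (Defs.pcomp T S))) f g h Q.
Proof.
move=> hS hT hH q; rewrite image_comp image_comp image_comp.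
by apply: (hS); apply: (hT); apply: (hS); apply: hH.
Qed.

Lemma iota_realization : [/\ iota (pm1 realization) = x1 + x3 ^+ p1,
  iota (pm2 realization) = x2 + x3 ^+ p2 &
  iota (pm3 realization) = x3 + (x1 + x3 ^+ p1) ^+ k1 * (x2 + x3 ^+ p2) ^+ k2].
Proof.
pose Q f g h := [/\ f = x1 + x3 ^+ p1, g = x2 + x3 ^+ p2 &
   h = x3 + (x1 + x3 ^+ p1) ^+ k1 * (x2 + x3 ^+ p2) ^+ k2].
have E : image realization x1 x2 x3 Q.
  by apply: (@image_conj swap shear_x shear_xy x1 x2 x3 Q image_swap image_shear_x image_shear_xy).
exact: E.
Qed.

Lemma mdeg_realization : Defs.mdeg realization = (p1, p2, k1 * p1 + k2 * p2)%N.
Proof.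
have [e1 e2 e3] := iota_realization; rewrite /Defs.mdeg !deg3E e1 e2 e3.
have lt (i : 'I_3) n : (1 < n)%N -> deg ('X_i : P) < deg (x3 ^+ n).
  by move=> n1; apply: tdeg_lt; rewrite /tdeg /var3 mpolyXn !mleadXm mdegMn !mdeg1 mul1n.
have D1 : deg (x1 + x3 ^+ p1) = deg x3 *+ p1.
  by rewrite degD_lt ?lt // degXn // deg_gt0_neq0 // deg_x_gt0.
have D2 : deg (x2 + x3 ^+ p2) = deg x3 *+ p2.
  by rewrite degD_lt ?lt // degXn // deg_gt0_neq0 // deg_x_gt0.
have x0 : 0 < deg x3 by apply: deg_x_gt0.
have n1 : x1 + x3 ^+ p1 != 0.
  by apply: deg_gt0_neq0; rewrite D1 pmulrn_lgt0 // (ltn_trans _ p13).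
have n2 : x2 + x3 ^+ p2 != 0.
  by apply: deg_gt0_neq0; rewrite D2 pmulrn_lgt0 // (ltn_trans _ p12).
set v := _ ^+ k1 * _ ^+ k2.
have D3 : deg v = deg x3 *+ (k1 * p1 + k2 * p2).
  rewrite /v degM ?expf_neq0 // !degXn // D1 D2 -!mulrnA mulrnDr.
  by rewrite (mulnC p1) (mulnC p2).
have D3' : deg (x3 + v) = deg x3 *+ (k1 * p1 + k2 * p2).
  have lv : deg x3 < deg v by rewrite D3 -{1}(mulr1n (deg x3)) ltr_pMn2l.
  by rewrite degD_lt.
have T (w : P) n : deg w = deg x3 *+ n -> mdeg (mlead w) = n.
  move=> e; have := @tdeg_muln _ w x3 1 n e.
  by rewrite /tdeg muln1 => ->; rewrite /var3 mleadXm mdeg1 mul1n.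
by rewrite (T _ _ D1) (T _ _ D2) (T _ _ D3').
Qed.
End Realization.

Local Close Scope ring_scope.
Import Pilot.Defs.

Theorem theorem1 (C : numClosedFieldType) (p1 p2 d3 : nat) :
  prime p1 -> prime p2 -> 3 <= p1 -> p1 < p2 -> p2 <= d3 ->
  ((exists F : polymap C, tame F /\ mdeg F = (p1, p2, d3)) <->
   (exists k1 k2 : nat, d3 = k1 * p1 + k2 * p2)).
Proof.
move=> pr1 pr2 p13 p12 p23; split=> [[F [tF]]|[k1 [k2 e]]].
  rewrite /Defs.mdeg !deg3E => -[e1 e2 e3].
  have r := (tame_reach tF (var1 C) (var2 C) (var3 C)).1 (reach_x C).
  (* For [d3 = p2] the combination is immediate; otherwise the three degrees are distinct, as
     [reach_degrees] requires. *)
  move: p23; rewrite leq_eqVlt => /orP[/eqP <-|p23]; first by exists 0%N, 1%N; rewrite mul1n.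
  exact: (reach_degrees r pr1 pr2 p13 p12 p23).
have p1' : (1 < p1)%N by apply: ltn_trans p13.
have p2' : (1 < p2)%N by apply: ltn_trans p12.
exists (realization C p1 p2 k1 k2); split; first exact: tame_realization.
rewrite e; apply: mdeg_realization => //.
by rewrite -e; apply: leq_trans p23.
Qed.
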